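(* For every integer $n\ge1$, the following identity of polynomials in $z$ holds: $$\sum_{i=2}^{4n-1}A_{QT}(4n,i)z^{i-2}=\left(\sum_{i=1}^{n}A(n,i)z^{i-1}\right)^2\left(\sum_{i=1}^{2n}A_{HT}(2n,i)z^{i-1}\right).$$
   Context: An alternating sign matrix (ASM) of order $m$ is an $m\times m$ matrix with entries in $\{1,-1,0\}$ such that every row and every column sums to $1$ and the nonzero entries alternate in sign along each row and each column; its first row contains exactly one $1$. An ASM is quarter-turn symmetric (QTSASM) if it is invariant under rotation by $90^\circ$, and half-turn symmetric (HTSASM) if it is invariant under rotation by $180^\circ$. $A(m,i)$, $A_{HT}(m,i)$ and $A_{QT}(m,i)$ denote, respectively, the number of all ASMs, of HTSASMs and of QTSASMs of order $m$ whose unique $1$ in the first row is in column $i$. *)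

(* Defs.v *)
From HB Require Import structures.
From mathcomp Require Import all_boot all_order all_algebra.
Set Implicit Arguments.
Unset Strict Implicit.
Unset Printing Implicit Defensive.
Import Order.TTheory GRing.Theory Num.Theory.
Local Open Scope ring_scope.

(* A finite type, so that matrices over it can be counted. *)
Definition asm_entry : finType := seq_sub [:: 1; -1; 0 : int].

Definition int_mx (m : nat) (A : 'M[asm_entry]_m) : 'M[int]_m :=
  map_mx (fun x : asm_entry => ssval x) A.

(* Any two consecutive nonzero entries of a row have opposite signs (for     *)
(* entries in {1, -1, 0} this is B i k = - B i j).                           *)
Definition rows_alternate (m : nat) (B : 'M[int]_m) : bool :=
  [forall i : 'I_m, forall j : 'I_m, forall k : 'I_m,
    [&& (j < k)%N, B i j != 0, B i k != 0
      & [forall l : 'I_m, (j < l < k)%N ==> (B i l == 0)]]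
    ==> (B i k == - B i j)].

Definition rows_sum1 (m : nat) (B : 'M[int]_m) : bool :=
  [forall i : 'I_m, \sum_(j < m) B i j == 1].

Definition is_asm (m : nat) (A : 'M[asm_entry]_m) : bool :=
  let B := int_mx A in
  [&& rows_sum1 B, rows_sum1 B^T, rows_alternate B & rows_alternate B^T].

Definition rot90 (T : Type) (m : nat) (A : 'M[T]_m) : 'M[T]_m :=
  \matrix_(i, j) A (rev_ord j) i.

Definition rot180 (T : Type) (m : nat) (A : 'M[T]_m) : 'M[T]_m :=
  \matrix_(i, j) A (rev_ord i) (rev_ord j).

Definition is_htsasm (m : nat) (A : 'M[asm_entry]_m) : bool :=
  is_asm A && (rot180 A == A).

Definition is_qtsasm (m : nat) (A : 'M[asm_entry]_m) : bool :=
  is_asm A && (rot90 A == A).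

(* The column number i is 1-based, whereas ordinals are 0-based. *)
Definition top_one_at (m i : nat) (A : 'M[asm_entry]_m) : bool :=
  [exists r : 'I_m, exists c : 'I_m,
    [&& r == 0%N :> nat, c.+1 == i & int_mx A r c == 1]].

Definition nb_asm (m i : nat) : nat :=
  #|[set A : 'M[asm_entry]_m | is_asm A & top_one_at i A]|.

Definition nb_htsasm (m i : nat) : nat :=
  #|[set A : 'M[asm_entry]_m | is_htsasm A & top_one_at i A]|.

Definition nb_qtsasm (m i : nat) : nat :=
  #|[set A : 'M[asm_entry]_m | is_qtsasm A & top_one_at i A]|.

(* Main.v *)
Require Import Defs.
From HB Require Import structures.
From mathcomp Require Import all_boot all_order all_algebra.
From mathcomp Require Import perm algC cyclotomic ring zify.
Set Implicit Arguments.
Unset Strict Implicit.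
Unset Printing Implicit Defensive.
Import Order.TTheory GRing.Theory Num.Theory.
Local Open Scope ring_scope.

(** An alternating sign matrix is a state of the six-vertex model on a square
    grid: write on every edge the partial sum of the row or column up to that
    edge; these sums are 0 or 1, and an entry together with its four edges is
    one of six vertices.  A half-turn symmetric matrix is a state on its upper
    half, a quarter-turn symmetric one a state on its upper left quadrant; the
    symmetry becomes a condition relating the bits on the free boundary.

    Row i carries a parameter x_i and column j a parameter y_j.  An entry 0
    weighs A = (y - w x) / (1 - w) or B = (x - w y) / (1 - w), according to
    whether its left and top edges agree, where w is a primitive cube root of
    unity; an entry 1 weighs 1 and an entry -1 weighs x y.  All weights are 1
    at x = y = 1, so the partition functions Z, Z_HT and Z_QT (the sums of the
    weights of all states) count matrices there.  If only the parameter of the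
    first line is t instead of 1, then a matrix whose top 1 is in column i
    weighs A^(i-1) B^(m-i) (for Z_QT: t A^(i-2) B^(m-1-i)), with A, B taken at
    (t, 1): the partition functions become the generating polynomials of the
    theorem at A / B, made homogeneous (asm_partition_refined,
    ht_partition_refined, qt_partition_refined).  So the theorem follows from
    the identity in 2n parameters

      Z_QT(x_1,...,x_n,y_1,...,y_n) = (prod x_i prod y_j) Z(x;y)^2 Z_HT(x;y)

    (qt_partition_factorization), which is proved by evaluating all three
    functions.  The Yang-Baxter equation makes Z and Z_HT symmetric in the x_i
    and Z_QT symmetric in all its parameters.  If two parameters have ratio w,
    then a weight A or B at a corner vanishes, which freezes two lines of the
    grid, and the partition function is an explicit product times the one with
    both parameters removed (asm_partition_rec, ht_partition_rec1,
    ht_partition_rec2, qt_partition_rec).  As polynomials in one parameter the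
    functions have a degree smaller than the number of such specializations, so
    these recursions determine them.

    The solution of the recursions is explicit.  Let s_e be the alternant with
    exponents 0, e, 3, 3+e, 6, 6+e, ... divided by the Vandermonde determinant;
    it is symmetric.  If x_2 = w x_1, subtracting x_1^3 times column j from
    column j + 2 clears the first two rows of the alternant outside its first
    two columns, because x_1 and x_2 have the same cube; hence s_e satisfies a
    recursion of the same form (schur_rec).  Comparing the factors gives,
    with a constant g depending on n only,
    Z = g s_1, Z_HT = g^2 s_1 s_2 and Z_QT = (prod x_i prod y_j) g^4 s_1^3 s_2,
    and the identity follows. *)

Local Notation zeros n := (nseq n false).
Local Notation ones n := (nseq n true).

(** * Vertex weights and the Yang-Baxter equation *)

Lemma sum_bool (V : nmodType) (f : bool -> V) : \sum_(i : bool) f i =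
  f false + f true.
Proof. by rewrite big_bool addrC. Qed.

Section SumTuples.
Variables (V : nmodType) (T : finType).

Lemma sum_tuple0 (f : seq T -> V) : \sum_(m : 0.-tuple T) f m = f [::].
Proof.
rewrite (big_pred1 [tuple]) // => m; rewrite /= tuple0.
by apply/esym/eqP.
Qed.

Lemma sum_tuple_cons n (f : seq T -> V) :
  \sum_(m : n.+1.-tuple T) f m = \sum_(x : T) \sum_(m : n.-tuple T) f (x :: m).
Proof.
rewrite pair_big /=.
rewrite (reindex (fun q : T * n.-tuple T => [tuple of q.1 :: q.2])) //=.
exists (fun m => (thead m, [tuple of behead m])) => [[a m] _|m _] /=.
  by congr (_, _); apply: val_inj.
by rewrite [m in RHS]tuple_eta.
Qed.

End SumTuples.

Section SixVertex.

Variables (F : numFieldType) (w : F).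
Hypothesis w_root : w ^+ 2 = - 1 - w.

Lemma subr_w_neq0 : 1 - w != 0.
Proof.
apply/eqP => /subr0_eq w1; move: w_root; rewrite -w1 => /eqP.
rewrite -subr_eq0 (_ : _ - _ = 3%:R); last by ring.
by rewrite pnatr_eq0.
Qed.

Definition weight_a (x y : F) : F := (y - w * x) / (1 - w).
Definition weight_b (x y : F) : F := (x - w * y) / (1 - w).

Lemma weight_a_diag z : weight_a z z = z.
Proof. by rewrite /weight_a -{1}[z]mul1r -mulrBl mulrAC mulfV ?mul1r //
  subr_w_neq0. Qed.

Lemma weight_bE x y : weight_b x y = weight_a y x. Proof. by []. Qed.

(** The bits [l], [t] and [b] sit on the left, top and bottom edges of the
    vertex; the matrix entry is b - t, and the bit on the right edge is
    [l (+) t (+) b], so that it need not be an argument.  The entries 1 and -1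
    would symmetrically both weigh the square root of x y.  Splitting this as 1
    and x y changes a partition function only by a factor that depends on the
    boundary bits, since both choices differ by factors telescoping along the
    lines, and it makes all weights polynomial. *)
Definition vertex_weight (x y : F) (l t b : bool) : F :=
  if t == b then (if l == t then weight_a x y else weight_b x y)
  else if l == t then (if t then x * y else 1) else 0.

Fixpoint row_weight (x : F) (cs : seq F) (l : bool) (t b : seq bool)
  (r : bool) : F :=
  match cs, t, b with
  | c :: cs', t0 :: t', b0 :: b' =>
      vertex_weight x c l t0 b0 * row_weight x cs' (l (+) t0 (+) b0) t' b' r
  | [::], [::], [::] => (l == r)%:R
  | _, _, _ => 0
  end.

(** Partition function of the grid with column parameters [cs] and row
    parameters [xs] whose left, right, top and bottom boundary bits are [ls],
    [rs], [t] and [b]. *)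
Fixpoint grid_sum (cs xs : seq F) (ls rs t b : seq bool) : F :=
  match xs, ls, rs with
  | x :: xs', l :: ls', r :: rs' =>
      \sum_(m : (size cs).-tuple bool) row_weight x cs l t m r *
        grid_sum cs xs' ls' rs' m b
  | [::], [::], [::] => (t == b)%:R
  | _, _, _ => 0
  end.

Definition two_row_weight x1 x2 cs l1 l2 t b r1 r2 :=
  \sum_(m : (size cs).-tuple bool) row_weight x1 cs l1 t m r1 *
    row_weight x2 cs l2 m b r2.

Lemma two_row_weight_nil x1 x2 l1 l2 r1 r2 :
  two_row_weight x1 x2 [::] l1 l2 [::] [::] r1 r2 = (l1 == r1)%:R *
    (l2 == r2)%:R.
Proof.
by rewrite /two_row_weight (sum_tuple0
  (fun m => row_weight x1 [::] l1 [::] m r1 * row_weight x2 [::] l2 m [::] r2)).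
Qed.

Lemma two_row_weight_cons x1 x2 c cs l1 l2 t0 t b0 b r1 r2 :
  two_row_weight x1 x2 (c :: cs) l1 l2 (t0 :: t) (b0 :: b) r1 r2 =
  \sum_(m0 : bool) vertex_weight x1 c l1 t0 m0 * vertex_weight x2 c l2 m0 b0 *
    two_row_weight x1 x2 cs (l1 (+) t0 (+) m0) (l2 (+) m0 (+) b0) t b r1 r2.
Proof.
rewrite /two_row_weight (sum_tuple_cons _ (fun m =>
  row_weight x1 (c :: cs) l1 (t0 :: t) m r1 *
    row_weight x2 (c :: cs) l2 m (b0 :: b) r2)).
apply: eq_bigr => m0 _; rewrite mulr_sumr; apply: eq_bigr => m _ /=.
by rewrite mulrACA.
Qed.

(** The R-matrix: two neighbouring lines with bits [l1], [l2] before and [k1],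
    [k2] after they cross. *)
Definition crossing_weight (x1 x2 : F) (l1 l2 k1 k2 : bool) : F :=
  if l1 == l2 then (if (k1 == l1) && (k2 == l1) then x2 - w * x1 else 0)
  else if k1 == k2 then 0
  else if l1 == k1 then (1 - w) * (if l1 then x2 else x1)
  else w ^+ 2 * (x1 - x2).

(** The function [G] of the two outgoing bits stands for the rest of the rows:
    in this form the equation can be iterated along a row. *)
Lemma yang_baxter_row x1 x2 c l1 l2 t b (G : bool -> bool -> F) :
  \sum_p1 \sum_p2 crossing_weight x1 x2 l1 l2 p1 p2 *
     (\sum_m vertex_weight x1 c p1 t m * vertex_weight x2 c p2 m b
        * G (p1 (+) t (+) m) (p2 (+) m (+) b)) =
  \sum_m vertex_weight x2 c l1 t m * vertex_weight x1 c l2 m b *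
     \sum_k1 \sum_k2 crossing_weight x1 x2 (l1 (+) t (+) m) (l2 (+) m (+) b) k1
       k2 * G k1 k2.
Proof.
have h := subr_w_neq0.
by rewrite !sum_bool; case: l1; case: l2; case: t; case: b;
  rewrite /vertex_weight /crossing_weight /weight_a /weight_b /=;
  field: w_root.
Qed.

(** The same R-matrix serves for two columns, with the parameters and the
    positions of the two lines interchanged. *)
Lemma yang_baxter_col x c1 c2 l u1 u2 b1 b2 (G : bool -> F) :
  \sum_t1 \sum_t2 crossing_weight c2 c1 u2 u1 t2 t1 *
     (vertex_weight x c1 l t1 b1 * vertex_weight x c2 (l (+) t1 (+) b1) t2 b2
        * G (l (+) t1 (+) b1 (+) t2 (+) b2)) =
  \sum_v1 \sum_v2 vertex_weight x c2 l u1 v1 *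
    vertex_weight x c1 (l (+) u1 (+) v1) u2 v2
       * G (l (+) u1 (+) v1 (+) u2 (+) v2) * crossing_weight c2 c1 v2 v1 b2 b1.
Proof.
have h := subr_w_neq0.
by rewrite !sum_bool; case: l; case: u1; case: u2; case: b1; case: b2;
  rewrite /vertex_weight /crossing_weight /weight_a /weight_b /=;
  field: w_root.
Qed.

(** Two lines that cross twice can be pulled apart.  The second crossing acts
    on columns, whose bits are the complements of those of the rows at the
    boundary of a quadrant; hence the negations. *)
Lemma crossing_weight_unitary x1 x2 a1 a2 b1 b2 :
  \sum_h1 \sum_h2 crossing_weight x1 x2 a1 a2 h1 h2 *
    crossing_weight x2 x1 b2 b1 (~~ h2) (~~ h1) =
  (x2 - w * x1) * (x1 - w * x2) * ((b1 == ~~ a1) && (b2 == ~~ a2))%:R.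
Proof.
by rewrite !sum_bool; case: a1; case: a2; case: b1; case: b2;
  rewrite /crossing_weight /=; ring: w_root.
Qed.

End SixVertex.

(** * Exchange of neighbouring lines *)

Section Exchange.

Variables (F : numFieldType) (w : F).
Hypothesis w_root : w ^+ 2 = - 1 - w.

Local Notation rw := (row_weight w).
Local Notation gz := (grid_sum w).
Local Notation two_rows := (two_row_weight w).
Local Notation Rm := (crossing_weight w).

Lemma two_row_weight_exchange x1 x2 cs l1 l2 t b r1 r2 :
  size t = size cs -> size b = size cs ->
  \sum_p1 \sum_p2 Rm x1 x2 l1 l2 p1 p2 * two_rows x1 x2 cs p1 p2 t b r1 r2 =
  \sum_k1 \sum_k2 two_rows x2 x1 cs l1 l2 t b k1 k2 * Rm x1 x2 k1 k2 r1 r2.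
Proof.
elim: cs l1 l2 t b => [|c cs IH] l1 l2 [|t0 t] [|b0 b] //= => [_ _|[st] [sb]].
  rewrite !sum_bool !two_row_weight_nil.
  by case: l1; case: l2; case: r1; case: r2; rewrite /Rm /=; ring.
under eq_bigr => p1 _ do under eq_bigr => p2 _ do rewrite two_row_weight_cons.
rewrite (yang_baxter_row w_root x1 x2 c l1 l2 t0 b0
   (fun a a' => two_rows x1 x2 cs a a' t b r1 r2)).
rewrite /=.
under eq_bigr => m _ do rewrite IH //.
by rewrite !sum_bool !two_row_weight_cons !sum_bool; ring.
Qed.

Lemma grid_sum_cons2 cs x1 x2 xs l1 l2 ls r1 r2 rs t b :
  gz cs (x1 :: x2 :: xs) (l1 :: l2 :: ls) (r1 :: r2 :: rs) t b =
  \sum_(m : (size cs).-tuple bool)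
     two_rows x1 x2 cs l1 l2 t m r1 r2 * gz cs xs ls rs m b.
Proof.
rewrite /=; under eq_bigr do rewrite mulr_sumr.
rewrite exchange_big /=; apply: eq_bigr => m _.
by rewrite mulr_suml; apply: eq_bigr => m' _; rewrite mulrA.
Qed.

(** A crossing to the left of two rows that start with equal bits is a scalar;
    the Yang-Baxter equation moves it through the grid, and it comes out on
    the right, acting on the outgoing bits of the two rows. *)
Lemma grid_sum_row_exchange cs xs1 x1 x2 xs2 ls1 ls2 rs1 r1 r2 rs2 t b :
  size t = size cs -> size ls1 = size xs1 -> size rs1 = size xs1 ->
  (x2 - w * x1) * gz cs (xs1 ++ x1 :: x2 :: xs2)
     (ls1 ++ false :: false :: ls2) (rs1 ++ r1 :: r2 :: rs2) t b =
  \sum_k1 \sum_k2 gz cs (xs1 ++ x2 :: x1 :: xs2)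
     (ls1 ++ false :: false :: ls2) (rs1 ++ k1 :: k2 :: rs2) t b
     * Rm x1 x2 k1 k2 r1 r2.
Proof.
elim: xs1 ls1 rs1 t => [|x xs1 IH] [|l ls1] [|r rs1] //= t st =>
  [_ _|[sl] [sr]].
  change ((x2 - w * x1) * gz cs (x1 :: x2 :: xs2) (false :: false :: ls2)
      (r1 :: r2 :: rs2) t b =
    \sum_k1 \sum_k2 gz cs (x2 :: x1 :: xs2) (false :: false :: ls2)
      (k1 :: k2 :: rs2) t b * Rm x1 x2 k1 k2 r1 r2).
  rewrite !sum_bool !grid_sum_cons2 mulr_sumr !mulr_suml -!big_split /=.
  apply: eq_bigr => m _.
  have := two_row_weight_exchange x1 x2 false false r1 r2 st (size_tuple m).
  rewrite !sum_bool {1 2 3 4}/Rm /= !mul0r !addr0 => E.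
  by rewrite mulrA E; ring.
rewrite mulr_sumr.
under [LHS]eq_bigr => m _ do rewrite mulrCA IH ?size_tuple //.
by rewrite !sum_bool !mulr_suml -!big_split /=; apply: eq_bigr => m _;
  rewrite !sum_bool; ring.
Qed.

Lemma sum_bits_cat p n1 n2 (f : seq bool -> F) : p = (n1 + n2)%N ->
  \sum_(m : p.-tuple bool) f m =
  \sum_(m1 : n1.-tuple bool) \sum_(m2 : n2.-tuple bool) f (m1 ++ m2).
Proof.
move=> ->; elim: n1 f => [|n1 IH] f.
  by rewrite (sum_tuple0 (fun m1 => \sum_(m2 : n2.-tuple bool) f (m1 ++ m2))).
rewrite (sum_tuple_cons _ (fun m1 => \sum_(m2 : n2.-tuple bool) f (m1 ++ m2))).
rewrite (sum_tuple_cons _ f).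
by apply: eq_bigr => m0 _; rewrite (IH (fun m => f (m0 :: m))).
Qed.

Lemma sum_bits_mid p n1 n2 (f : seq bool -> F) : p = (n1 + n2.+2)%N ->
  \sum_(m : p.-tuple bool) f m =
  \sum_(m1 : n1.-tuple bool) \sum_(m2 : n2.-tuple bool)
    \sum_a1 \sum_a2 f (m1 ++ a1 :: a2 :: m2).
Proof.
move=> pE; rewrite (sum_bits_cat f pE); apply: eq_bigr => m1 _.
rewrite (sum_tuple_cons _ (fun m => f (m1 ++ m))).
under eq_bigr => a1 _ do rewrite (sum_tuple_cons _
  (fun m => f (m1 ++ a1 :: m))).
by rewrite [RHS]exchange_big /=; apply: eq_bigr => a1 _; rewrite exchange_big.
Qed.

Lemma row_weight_col_exchange x cs1 c1 c2 cs2 l t1 u1 u2 t2 b1 v1 v2 b2 r :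
  size t1 = size cs1 -> size b1 = size cs1 ->
  \sum_p1 \sum_p2 Rm c2 c1 u2 u1 p2 p1 *
    rw x (cs1 ++ c1 :: c2 :: cs2) l (t1 ++ p1 :: p2 :: t2)
       (b1 ++ v1 :: v2 :: b2) r =
  \sum_p1 \sum_p2 rw x (cs1 ++ c2 :: c1 :: cs2) l (t1 ++ u1 :: u2 :: t2)
       (b1 ++ p1 :: p2 :: b2) r * Rm c2 c1 p2 p1 v2 v1.
Proof.
elim: cs1 l t1 b1 => [|c cs1 IH] l [|t0 t1] [|b0 b1] //= => [_ _|[st] [sb]].
  have := yang_baxter_col w_root x c1 c2 l u1 u2 v1 v2
     (fun a => rw x cs2 a t2 b2 r).
  by rewrite !sum_bool !mulrA => ->.
transitivity (vertex_weight w x c l t0 b0 *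
  \sum_p1 \sum_p2 Rm c2 c1 u2 u1 p2 p1 *
    rw x (cs1 ++ c1 :: c2 :: cs2) (l (+) t0 (+) b0) (t1 ++ p1 :: p2 :: t2)
       (b1 ++ v1 :: v2 :: b2) r).
  by rewrite !sum_bool; ring.
by rewrite IH // !sum_bool; ring.
Qed.

(** The crossing of two neighbouring columns is moved down through one row
    after the other. *)
Lemma grid_sum_col_exchange cs1 c1 c2 cs2 xs ls rs t1 u1 u2 t2 b1 v1 v2 b2 :
  size t1 = size cs1 -> size b1 = size cs1 ->
  \sum_p1 \sum_p2 Rm c2 c1 u2 u1 p2 p1 *
    gz (cs1 ++ c1 :: c2 :: cs2) xs ls rs (t1 ++ p1 :: p2 :: t2)
       (b1 ++ v1 :: v2 :: b2) =
  \sum_p1 \sum_p2 gz (cs1 ++ c2 :: c1 :: cs2) xs ls rs (t1 ++ u1 :: u2 :: t2)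
       (b1 ++ p1 :: p2 :: b2) * Rm c2 c1 p2 p1 v2 v1.
Proof.
move=> st sb; elim: xs ls rs t1 u1 u2 t2 st =>
  [|x xs IH] [|l ls] [|r rs] t1 u1 u2 t2 st;
  try by rewrite !sum_bool /=; ring.
  rewrite !sum_bool /= !eqseq_cat ?st // !eqseq_cons.
  case: (t1 == b1); case: (t2 == b2); rewrite /= ?andbF ?andbT; last 3 first.
  - by case: u1; case: u2; case: v1; case: v2; rewrite /Rm /=; ring.
  - by ring.
  - by ring.
  by case: u1; case: u2; case: v1; case: v2; rewrite /Rm /=; ring.
have pE c c' : size (cs1 ++ c :: c' :: cs2) = (size cs1 + (size cs2).+2)%N.
  by rewrite size_cat.
pose f p1 p2 m := rw x (cs1 ++ c1 :: c2 :: cs2) l (t1 ++ p1 :: p2 :: t2) m r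
   * gz (cs1 ++ c1 :: c2 :: cs2) xs ls rs m (b1 ++ v1 :: v2 :: b2).
pose g p1 p2 m := rw x (cs1 ++ c2 :: c1 :: cs2) l (t1 ++ u1 :: u2 :: t2) m r
   * gz (cs1 ++ c2 :: c1 :: cs2) xs ls rs m (b1 ++ p1 :: p2 :: b2).
rewrite /=.
under eq_bigr => p1 _ do under eq_bigr => p2 _ do
  rewrite (sum_bits_mid (f p1 p2) (pE _ _)) mulr_sumr.
under [RHS]eq_bigr => p1 _ do under eq_bigr => p2 _ do
  rewrite (sum_bits_mid (g p1 p2) (pE _ _)) mulr_suml.
rewrite !sum_bool -!big_split /=; apply: eq_bigr => m1 _.
rewrite !mulr_sumr !mulr_suml -!big_split /=; apply: eq_bigr => m2 _.
rewrite {}/f {}/g.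
have E1 a1 a2 := row_weight_col_exchange x c1 c2 cs2 l u1 u2 t2 a1 a2 m2 r st
  (size_tuple m1).
have E2 a1 a2 := IH ls rs m1 a1 a2 m2 (size_tuple m1).
pose f1 := fun p1 p2 a1 a2 => rw x (cs1 ++ c1 :: c2 :: cs2) l
  (t1 ++ p1 :: p2 :: t2)
   (m1 ++ a1 :: a2 :: m2) r.
pose f2 := fun a1 a2 => rw x (cs1 ++ c2 :: c1 :: cs2) l (t1 ++ u1 :: u2 :: t2)
       (m1 ++ a1 :: a2 :: m2) r.
pose g1 := fun a1 a2 => gz (cs1 ++ c1 :: c2 :: cs2) xs ls rs
  (m1 ++ a1 :: a2 :: m2)
       (b1 ++ v1 :: v2 :: b2).
pose g2 := fun a1 a2 p1 p2 => gz (cs1 ++ c2 :: c1 :: cs2) xs ls rs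
  (m1 ++ a1 :: a2 :: m2)
       (b1 ++ p1 :: p2 :: b2).
transitivity (\sum_a1 \sum_a2 (\sum_p1 \sum_p2 Rm c2 c1 u2 u1 p2 p1 *
  f1 p1 p2 a1 a2) * g1 a1 a2).
  by rewrite !sum_bool /f1 /g1; ring.
rewrite /f1 /=; under eq_bigr => a1 _ do under eq_bigr => a2 _ do rewrite E1.
transitivity (\sum_a1 \sum_a2 f2 a1 a2 *
  (\sum_p1 \sum_p2 Rm c2 c1 a2 a1 p2 p1 * g1 p1 p2)).
  by rewrite !sum_bool /f2 /g1; ring.
rewrite /g1 /=; under eq_bigr => a1 _ do under eq_bigr => a2 _ do rewrite E2.
by rewrite !sum_bool /f2 /g2; ring.
Qed.

End Exchange.

(** * Polynomial functions and frozen lines *)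

Lemma poly_eq0_nat (F : numFieldType) (N : nat) (p : {poly F}) :
  (forall n : nat, (N <= n)%N -> p.[n%:R] = 0) -> p = 0.
Proof.
move=> p0; apply: (roots_geq_poly_eq0 (rs :=
  [seq n%:R | n <- iota N (size p)])).
- apply/allP => _ /mapP [n nN ->]; rewrite rootE p0 //.
  by move: nN; rewrite mem_iota => /andP [].
- by rewrite map_inj_uniq ?iota_uniq // => m n /eqP; rewrite eqr_nat => /eqP.
- by rewrite size_map size_iota.
Qed.

Section PolyFun.
Variable F : numFieldType.

(** Polynomial functions rather than polynomials: the partition functions are
    studied in one parameter at a time, and this predicate can be established
    along the recursive definitions without moving them to a polynomial ring. *)
Definition polyfun (d : nat) (f : F -> F) : Prop :=
  exists2 p : {poly F}, (size p <= d.+1)%N & f =1 horner p.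

Lemma polyfun_ext d f g : f =1 g -> polyfun d f -> polyfun d g.
Proof. by move=> fg [p sp fp]; exists p => // x; rewrite -fg. Qed.

Lemma polyfunW d d' f : (d <= d')%N -> polyfun d f -> polyfun d' f.
Proof. by move=> dd [p sp fp]; exists p => //; apply: leq_trans sp _. Qed.

Lemma polyfun_cst d a : polyfun d (fun=> a).
Proof.
exists a%:P => [|x]; last by rewrite hornerC.
by apply: leq_trans (size_polyC_leq1 _) _.
Qed.

Lemma polyfun_id d : (0 < d)%N -> polyfun d id.
Proof.
by case: d => // d _; exists 'X => [|x]; rewrite ?size_polyX ?hornerX.
Qed.

Lemma polyfunD d f g :
  polyfun d f -> polyfun d g -> polyfun d (fun x => f x + g x).
Proof.
move=> [p sp fp] [q sq gq]; exists (p + q) => [|x].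
  by apply: leq_trans (size_polyD _ _) _; rewrite geq_max sp.
by rewrite hornerD fp gq.
Qed.

Lemma polyfunM d1 d2 f g :
  polyfun d1 f -> polyfun d2 g -> polyfun (d1 + d2) (fun x => f x * g x).
Proof.
move=> [p sp fp] [q sq gq]; exists (p * q) => [|x].
  apply: leq_trans (size_polyMleq _ _) _.
  by rewrite -subn1 leq_subLR (leq_trans (leq_add sp sq)) // addSn addnS.
by rewrite hornerM fp gq.
Qed.

Lemma polyfunZ d a f : polyfun d f -> polyfun d (fun x => a * f x).
Proof. by move=> Pf; apply: (@polyfunM 0 d) Pf; apply: polyfun_cst. Qed.

Lemma polyfunN d f : polyfun d f -> polyfun d (fun x => - f x).
Proof.
move=> Pf; apply: polyfun_ext (polyfunZ (-1) Pf) => x.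
by rewrite mulN1r.
Qed.

Lemma polyfun_sum d (I : Type) (r : seq I) (P : pred I) (f : I -> F -> F) :
  (forall i, P i -> polyfun d (f i)) ->
  polyfun d (fun x => \sum_(i <- r | P i) f i x).
Proof.
move=> Pf; elim: r => [|i r IH].
  by apply: polyfun_ext (polyfun_cst d 0) => x; rewrite big_nil.
have [Pi|nPi] := boolP (P i).
  by apply: polyfun_ext (polyfunD (Pf i Pi) IH) => x; rewrite big_cons Pi.
by apply: polyfun_ext IH => x; rewrite big_cons (negbTE nPi).
Qed.

Lemma polyfun_prod (I : Type) (r : seq I) (f : I -> F -> F) :
  (forall i, polyfun 1 (f i)) ->
  polyfun (size r) (fun x => \prod_(i <- r) f i x).
Proof.
move=> Pf; elim: r => [|i r IH].
  by apply: polyfun_ext (polyfun_cst _ 1) => x; rewrite big_nil.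
apply: polyfun_ext (polyfunM (Pf i) IH) => x.
by rewrite big_cons.
Qed.

Lemma polyfun_interp d f g (s : seq F) :
  polyfun d f -> polyfun d g -> uniq s -> (d < size s)%N ->
  {in s, f =1 g} -> f =1 g.
Proof.
move=> Pf Pg us ds fg x.
have [p sp hp] := polyfunD Pf (polyfunN Pg).
have p0 : p = 0.
  apply: (roots_geq_poly_eq0 (rs := s)) => //; last exact: leq_trans sp ds.
  by apply/allP => y ys; rewrite rootE -hp fg // subrr.
by apply/eqP; rewrite -subr_eq0 hp p0 horner0.
Qed.

Definition polyfun_some (f : F -> F) := exists d, polyfun d f.

Lemma polyfun_some_sum (I : finType) (f : I -> F -> F) :
  (forall i, polyfun_some (f i)) -> polyfun_some (fun s => \sum_i f i s).
Proof.
move=> /fin_all_exists [d dP]; exists (\max_i d i).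
by apply: polyfun_sum => i _; apply: polyfunW (leq_bigmax i) (dP i).
Qed.

Lemma polyfun_anyM f g :
  polyfun_some f -> polyfun_some g -> polyfun_some (fun s => f s * g s).
Proof. by move=> [d1 P1] [d2 P2]; exists (d1 + d2)%N; apply: polyfunM. Qed.

(** A polynomial factor that is not identically zero can be cancelled from an
    identity that is known at all large natural numbers. *)
Lemma polyfun_some_cancel (N : nat) (ph : {poly F}) f g :
  ph != 0 -> polyfun_some f -> polyfun_some g ->
  (forall n : nat, (N <= n)%N -> ph.[n%:R] * (f n%:R - g n%:R) = 0) -> f =1 g.
Proof.
move=> ph0 [d1 [p sp pE]] [d2 [q sq qE]] fg x.
have : ph * (p - q) = 0.
  by apply: (@poly_eq0_nat _ N) => n nN;
    rewrite hornerM hornerD hornerN -pE -qE fg.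
move/eqP; rewrite mulf_eq0 (negbTE ph0) subr_eq0 => /eqP pq.
by rewrite pE qE pq.
Qed.

End PolyFun.

Section FrozenLines.
Variables (F : numFieldType) (w : F).

Local Notation rw := (row_weight w).
Local Notation gz := (grid_sum w).
Local Notation wA := (weight_a w).
Local Notation wB := (weight_b w).
Local Notation vw := (vertex_weight w).

Lemma polyfun_weight_a_l y : polyfun 1 (fun x => wA x y).
Proof.
apply: (@polyfun_ext _ _ (fun x => y / (1 - w) + (- w / (1 - w)) * x)) => [x|].
  by rewrite /weight_a; ring.
by apply: polyfunD (polyfun_cst _ _) _; apply/polyfunZ/polyfun_id.
Qed.
Lemma polyfun_weight_a_r x : polyfun 1 (fun y => wA x y).
Proof.
apply: (@polyfun_ext _ _ (fun y => - (w * x) / (1 - w) + (1 - w)^-1 * y)) =>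
  [y|].
  by rewrite /weight_a; ring.
by apply: polyfunD (polyfun_cst _ _) _; apply/polyfunZ/polyfun_id.
Qed.
Lemma polyfun_weight_b_l y : polyfun 1 (fun x => wB x y).
Proof. exact: polyfun_weight_a_r. Qed.
Lemma polyfun_weight_b_r x : polyfun 1 (fun y => wB x y).
Proof. exact: polyfun_weight_a_l. Qed.

Lemma sum_bits_rcons p n (f : seq bool -> F) : p = n.+1 ->
  \sum_(m : p.-tuple bool) f m =
  \sum_m0 \sum_(m : n.-tuple bool) f (rcons m m0).
Proof.
move=> pE; rewrite exchange_big /= (@sum_bits_cat F p n 1) ?addn1 //.
apply: eq_bigr => m _; rewrite (sum_tuple_cons _ (fun m2 => f (m ++ m2))).
apply: eq_bigr => m0 _; rewrite (sum_tuple0 (fun m2 => f (m ++ m0 :: m2))).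
by rewrite cats1.
Qed.

(** Below an empty boundary a row can contain no -1, so its partial sums
    increase; if they start and end at 0, then the row is zero. *)
Lemma sum_row_weight_false_false x cs (G : seq bool -> F) :
  \sum_(m : (size cs).-tuple bool) rw x cs false (zeros (size cs)) m false * G m
  = (\prod_(c <- cs) wA x c) * G (zeros (size cs)).
Proof.
suff [] : \sum_(m : (size cs).-tuple bool) rw x cs false (zeros (size cs)) m
  false * G m
  = (\prod_(c <- cs) wA x c) * G (zeros (size cs)) /\
   \sum_(m : (size cs).-tuple bool) rw x cs true (zeros (size cs)) m false *
     G m = 0 by [].
elim: cs G => [|c cs IH] G.
  by split; rewrite (sum_tuple0 (fun m => rw x [::] _ [::] m false * G m)) /=
    ?big_nil ?mul0r.
split; rewrite (sum_tuple_cons _ (fun m =>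
  rw x (c :: cs) _ (zeros (size cs).+1) m false * G m)).
  rewrite sum_bool big_cons /= -mulrA.
  under eq_bigr do rewrite -mulrA.
  under [X in _ + X]eq_bigr do rewrite -mulrA.
  rewrite -!mulr_sumr.
  by rewrite (IH (fun m => G (false :: m))).1 (IH (fun m => G (true :: m))).2
    mulr0 addr0.
rewrite sum_bool /=.
under eq_bigr do rewrite -mulrA.
under [X in _ + X]eq_bigr do rewrite -mulrA.
rewrite -!mulr_sumr.
by rewrite (IH (fun m => G (false :: m))).2 /vw /= !mul0r mulr0 addr0.
Qed.

Lemma row_weight_true_zeros x cs m r : size m = size cs ->
  rw x cs true (zeros (size cs)) m r =
  ((m == zeros (size cs)) && r)%:R * \prod_(c <- cs) wB x c.
Proof.
elim: cs m => [|c cs IH] [|m0 m] //=; first by rewrite big_nil mulr1.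
case=> sm; rewrite eqseq_cons big_cons; case: m0;
  first by rewrite /vertex_weight /= !mul0r.
by rewrite /= IH // /vertex_weight /= mulrCA.
Qed.

Lemma sum_row_weight_true x cs r (G : seq bool -> F) :
  \sum_(m : (size cs).-tuple bool) rw x cs true (zeros (size cs)) m r * G m
  = r%:R * (\prod_(c <- cs) wB x c) * G (zeros (size cs)).
Proof.
rewrite (bigD1 (nseq_tuple (size cs) false)) //=
  row_weight_true_zeros ?size_nseq //.
rewrite eqxx /= [X in _ + X]big1 ?addr0 // => m mN;
  rewrite row_weight_true_zeros ?size_tuple //.
case: eqP => [E|_]; last by rewrite !mul0r.
by case/eqP: mN; apply: val_inj.
Qed.

Lemma row_weight_cons x c cs l t0 t b0 b r :
  rw x (c :: cs) l (t0 :: t) (b0 :: b) r =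
  vw x c l t0 b0 * rw x cs (l (+) t0 (+) b0) t b r.
Proof. by []. Qed.

Lemma row_weight_size_neq0 x cs l t b r : size b != size cs -> rw x cs l t b r =
  0.
Proof.
elim: cs l t b => [|c cs IH] l [|t0 t] [|b0 b] //=; rewrite eqSS => sb.
by rewrite IH ?mulr0.
Qed.

(** The row contains exactly one 1, whose weight is constant, so the degree is
    one less than the number of vertices. *)
Lemma polyfun_first_row c cs m :
  polyfun (size cs) (fun x => rw x (c :: cs) false (zeros (size cs).+1) m true).
Proof.
elim: cs c m => [|c' cs IH] c [|m0 m]; try exact: polyfun_cst.
  apply: polyfun_ext (polyfun_cst _ (m0 && (m == [::]))%:R) => x.
  by case: m0; case: m => [|? ?]; rewrite /= ?mulr0 ?mul1r.
apply: (@polyfun_ext _ _ _ _ (fun x => esym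
  (row_weight_cons x c (c' :: cs) false false (zeros (size cs).+1) m0 m true))).
case: m0; last exact: polyfunM (polyfun_weight_a_l c) (IH c' m).
have [sm|sm] := eqVneq (size m) (size (c' :: cs)); last first.
  by apply: polyfun_ext (polyfun_cst _ 0) => x;
    rewrite row_weight_size_neq0 ?mulr0.
apply: polyfun_ext (polyfunZ ((m == zeros (size (c' :: cs))))%:R
    (polyfun_prod (c' :: cs) polyfun_weight_b_l)) => x.
by rewrite (row_weight_true_zeros x true sm) andbT mul1r.
Qed.

(** No -1 can occur in the first column, because nothing enters it from the
    left; so a partial sum 1 never decreases. *)
Lemma grid_sum_col_true_false c cs xs rs t b :
  gz (c :: cs) xs (zeros (size xs)) rs (true :: t) (false :: b) = 0.
Proof.
elim: xs rs t => [|x xs IH] [|r rs] t //=.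
rewrite (sum_tuple_cons _ (fun m => rw x (c :: cs) false (true :: t) m r *
   gz (c :: cs) xs (zeros (size xs)) rs m (false :: b))) sum_bool !big1 ?addr0
     // => m _ /=.
  by rewrite IH mulr0.
by rewrite /vertex_weight /= !mul0r.
Qed.

Lemma grid_sum_col_true_true c cs xs rs t b :
  gz (c :: cs) xs (zeros (size xs)) rs (true :: t) (true :: b) =
  (\prod_(x <- xs) wB x c) * gz cs xs (zeros (size xs)) rs t b.
Proof.
elim: xs rs t => [|x xs IH] [|r rs] t //=; rewrite ?big_nil ?mulr0 ?mul1r //.
rewrite (sum_tuple_cons _ (fun m => rw x (c :: cs) false (true :: t) m r *
   gz (c :: cs) xs (zeros (size xs)) rs m (true :: b))) sum_bool /=.
rewrite big1 ?add0r => [|m _]; last by rewrite /vertex_weight /= !mul0r.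
rewrite mulr_sumr; apply: eq_bigr => m _.
by rewrite IH big_cons /vertex_weight /=; ring.
Qed.

Lemma grid_sum_col_false_false c cs xs rs t b :
  gz (c :: cs) xs (zeros (size xs)) rs (false :: t) (false :: b) =
  (\prod_(x <- xs) wA x c) * gz cs xs (zeros (size xs)) rs t b.
Proof.
elim: xs rs t => [|x xs IH] [|r rs] t //=; rewrite ?big_nil ?mulr0 ?mul1r //.
rewrite (sum_tuple_cons _ (fun m => rw x (c :: cs) false (false :: t) m r *
   gz (c :: cs) xs (zeros (size xs)) rs m (false :: b))) sum_bool /=.
rewrite [X in _ + X]big1 ?addr0 => [|m _];
  last by rewrite grid_sum_col_true_false mulr0.
rewrite mulr_sumr; apply: eq_bigr => m _.
by rewrite IH big_cons /vertex_weight /=; ring.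
Qed.

(** The first column contains exactly one 1, and its weight is constant in the
    parameter of that column. *)
Lemma polyfun_grid_sum_col cs xs rs t b :
  polyfun (size xs).-1 (fun c =>
    gz (c :: cs) xs (zeros (size xs)) rs (false :: t) (true :: b)).
Proof.
elim: xs rs t => [|x xs IH] [|r rs] t; try exact: polyfun_cst.
have E c : gz (c :: cs) (x :: xs) (zeros (size (x :: xs))) (r :: rs)
  (false :: t) (true :: b) =
  \sum_(m : (size cs).-tuple bool) (wA x c * (rw x cs false t m r *
       gz (c :: cs) xs (zeros (size xs)) rs (false :: m) (true :: b))
     + rw x cs true t m r * gz cs xs (zeros (size xs)) rs m b *
        \prod_(x <- xs) wB x c).
  rewrite /= (sum_tuple_cons _ (fun m => rw x (c :: cs) false (false :: t) m r *
     gz (c :: cs) xs (zeros (size xs)) rs m (true :: b))) sum_bool -big_split.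
  by apply: eq_bigr => m _; rewrite grid_sum_col_true_true /= /vertex_weight /=;
    ring.
apply: polyfun_ext (fsym E) _; apply: polyfun_sum => m _.
apply: polyfunD; last first.
  by apply/polyfunZ/polyfun_prod => y; apply: polyfun_weight_b_r.
case: xs IH {E} => [|x' xs] IH.
  by apply: polyfun_ext (polyfun_cst _ 0) => c; case: (rs) => [|? ?]; rewrite /=
    ?eqseq_cons /= !mulr0.
by apply: polyfunM (polyfun_weight_a_r _) (polyfunZ _ (IH _ _)).
Qed.

Lemma row_weight_rcons x cs c l t t0 b b0 r : size t = size cs -> size b =
  size cs ->
  rw x (rcons cs c) l (rcons t t0) (rcons b b0) r =
  vw x c (r (+) t0 (+) b0) t0 b0 * rw x cs l t b (r (+) t0 (+) b0).
Proof.
elim: cs l t b => [|c' cs IH] l [|t' t] [|b' b] //=.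
  by case: l; case: t0; case: b0; case: r; rewrite /= ?mulr1 ?mulr0.
by case=> st [sb]; rewrite IH // mulrCA.
Qed.

Lemma grid_sum_rcons c cs x xs l ls r rs t t0 b : size t = size cs ->
  gz (rcons cs c) (x :: xs) (l :: ls) (r :: rs) (rcons t t0) b =
  \sum_m0 \sum_(m : (size cs).-tuple bool)
    vw x c (r (+) t0 (+) m0) t0 m0 * rw x cs l t m (r (+) t0 (+) m0) *
      gz (rcons cs c) xs ls rs (rcons m m0) b.
Proof.
move=> st; rewrite /= (@sum_bits_rcons _ (size cs)
  (fun m => rw x (rcons cs c) l (rcons t t0) m r *
    gz (rcons cs c) xs ls rs m b)) ?size_rcons //.
by apply: eq_bigr => m0 _; apply: eq_bigr => m _;
  rewrite row_weight_rcons // size_tuple.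
Qed.

(** Mirror image of the situation in the first column: a vertex with right
    edge 1 cannot be a -1. *)
Lemma grid_sum_lastcol_true_false c cs xs ls t b : size t = size cs ->
  gz (rcons cs c) xs ls (ones (size xs)) (rcons t true) (rcons b false) = 0.
Proof.
elim: xs ls t => [|x xs IH] [|l ls] t st //=;
  first by rewrite eqseq_rcons andbF.
rewrite -/(gz (rcons cs c) (x :: xs) (l :: ls) (true :: ones (size xs))
  (rcons t true) _).
rewrite grid_sum_rcons // sum_bool !big1 ?addr0 // => m _ /=.
  by rewrite IH ?size_tuple // mulr0.
by rewrite /vertex_weight /= !mul0r.
Qed.

Lemma grid_sum_lastcol_true_true c cs xs ls t b : size t = size cs ->
  gz (rcons cs c) xs ls (ones (size xs)) (rcons t true) (rcons b true) =
  (\prod_(x <- xs) wA x c) * gz cs xs ls (ones (size xs)) t b.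
Proof.
elim: xs ls t => [|x xs IH] [|l ls] t st; rewrite ?big_nil ?mulr0 ?mul1r //.
  by rewrite /= eqseq_rcons andbT.
rewrite grid_sum_rcons // sum_bool big1 ?add0r => [|m _];
  last by rewrite /vertex_weight /= !mul0r.
rewrite [RHS]/= mulr_sumr; apply: eq_bigr => m _.
by rewrite IH ?size_tuple // big_cons /vertex_weight /=; ring.
Qed.

Lemma grid_sum_lastcol_false_false c cs xs ls t b : size t = size cs ->
  gz (rcons cs c) xs ls (ones (size xs)) (rcons t false) (rcons b false) =
  (\prod_(x <- xs) wB x c) * gz cs xs ls (ones (size xs)) t b.
Proof.
elim: xs ls t => [|x xs IH] [|l ls] t st; rewrite ?big_nil ?mulr0 ?mul1r //.
  by rewrite /= eqseq_rcons andbT.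
rewrite grid_sum_rcons // -/(ones (size xs)) sum_bool [X in _ + X]big1 ?addr0 =>
  [|m _]; last first.
  by rewrite grid_sum_lastcol_true_false ?size_tuple // mulr0.
rewrite [RHS]/= mulr_sumr; apply: eq_bigr => m _.
by rewrite IH ?size_tuple // big_cons /vertex_weight /=; ring.
Qed.

Lemma polyfun_grid_sum_lastcol cs xs ls t b : size t = size cs ->
  polyfun (size xs).-1 (fun c =>
    gz (rcons cs c) xs ls (ones (size xs)) (rcons t false) (rcons b true)).
Proof.
elim: xs ls t => [|x xs IH] [|l ls] t st; try exact: polyfun_cst.
have E c : gz (rcons cs c) (x :: xs) (l :: ls) (ones (size (x :: xs)))
  (rcons t false) (rcons b true) =
  \sum_(m : (size cs).-tuple bool) (wB x c * (rw x cs l t m true *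
       gz (rcons cs c) xs ls (ones (size xs)) (rcons m false) (rcons b true))
     + rw x cs l t m false * gz cs xs ls (ones (size xs)) m b *
        \prod_(x <- xs) wA x c).
  rewrite grid_sum_rcons // -/(ones (size xs)) sum_bool -big_split.
  by apply: eq_bigr => m _; rewrite grid_sum_lastcol_true_true ?size_tuple //=
    /vertex_weight /=; ring.
apply: polyfun_ext (fsym E) _; apply: polyfun_sum => m _.
apply: polyfunD; last first.
  by apply/polyfunZ/polyfun_prod => y; apply: polyfun_weight_a_r.
case: xs IH {E} => [|x' xs] IH.
  apply: polyfun_ext (polyfun_cst _ 0) => c.
  by case: (ls) => [|? ?]; rewrite /= ?eqseq_rcons ?andbF !mulr0.
by apply: polyfunM (polyfun_weight_b_r _) (polyfunZ _ (IH _ _ _));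
  rewrite size_tuple.
Qed.

Lemma polyfun_some_grid_sum (cs xs : seq {poly F}) ls rs t b :
  polyfun_some (fun s => gz [seq p.[s] | p : {poly F} <- cs]
    [seq p.[s] | p : {poly F} <- xs] ls rs t b).
Proof.
have wP (p q : {poly F}) l t0 b0 : polyfun_some
  (fun s => vw p.[s] q.[s] l t0 b0).
  rewrite /polyfun_some.
  exists ((size p + size q) + (size p + size q))%N.
  have Pp : polyfun (size p + size q) (horner p).
    by exists p => //; apply: leqW; apply: leq_addr.
  have Pq : polyfun (size p + size q) (horner q).
    by exists q => //; apply: leqW; apply: leq_addl.
  have PA u v : polyfun (size p + size q) u -> polyfun (size p + size q) v ->
      polyfun (size p + size q + (size p + size q)) (fun s => wA (u s) (v s)).
    move=> Pu Pv.
    apply: (@polyfun_ext _ _ (fun s => (1 - w)^-1 * v s - (1 - w)^-1 * w * u s))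
      => [s|].
      by rewrite /weight_a; ring.
    apply: polyfunW (leq_addr _ _) _.
    by apply: polyfunD; [|apply: polyfunN]; apply: polyfunZ.
  rewrite /vertex_weight; case: eqP => _; case: eqP => _; try exact:
    polyfun_cst; try exact: PA.
  by case: t0; [apply: polyfunM|apply: polyfun_cst].
have rP x l t0 b0 r : polyfun_some (fun s =>
  rw (x : {poly F}).[s] [seq p.[s] | p : {poly F} <- cs] l t0 b0 r).
  elim: cs l t0 b0 => [|c cs IH] l [|t0 t'] [|b0 b'] /=; try by exists 0; apply:
    polyfun_cst.
  have [d1 P1] := wP x c l t0 b0; have [d2 P2] := IH (l (+) t0 (+) b0) t' b'.
  by exists (d1 + d2)%N; apply: polyfunM.
elim: xs ls rs t => [|x xs IH] [|l ls] [|r rs] t /=; try by exists 0; apply: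
  polyfun_cst.
have [d dP] : polyfun_some (fun s => \sum_(m : (size cs).-tuple bool)
    rw x.[s] [seq p.[s] | p : {poly F} <- cs] l t m r *
    gz [seq p.[s] | p : {poly F} <- cs] [seq p.[s] | p : {poly F} <- xs] ls rs m
      b).
  by apply: polyfun_some_sum => m; apply: polyfun_anyM.
by exists d; apply: polyfun_ext dP => s; rewrite size_map.
Qed.

End FrozenLines.

(** * The three partition functions and their symmetry *)

(** Invariance under exchanges of neighbours implies invariance under all
    permutations.  The restriction [Q] is there because some functions are
    invariant only on lists of parameters in general position. *)
Lemma perm_eq_swap_invariant (T : eqType) (S : Type) (Q : seq T -> Prop)
  (f : seq T -> S) :
  (forall s t, perm_eq s t -> Q s -> Q t) ->
  (forall s1 x y s2, Q (s1 ++ x :: y :: s2) ->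
     f (s1 ++ x :: y :: s2) = f (s1 ++ y :: x :: s2)) ->
  forall s t, perm_eq s t -> Q s -> f s = f t.
Proof.
move=> Qp fs s t st Qs.
suff H p : Q (p ++ s) -> f (p ++ s) = f (p ++ t) by exact: (H [::]).
move: {Qs} p; elim: s t st => [|x s IH] t st p Qs.
  by move: st; rewrite perm_sym => /perm_nilP ->.
have /splitPr xt : x \in t by rewrite -(perm_mem st) mem_head.
case: xt st => t1 t2 st.
have st' : perm_eq s (t1 ++ t2).
  by rewrite -(perm_cons x) (perm_trans st) // -cat1s perm_catCA.
rewrite -cat_rcons (IH _ st') cat_rcons //.
have {Qs} Qt : Q (p ++ x :: t1 ++ t2).
  by apply: Qp Qs; rewrite perm_cat2l perm_cons.
move: {st st' IH} Qt; elim: t1 p => [|y t1 IH] p //= Qt.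
rewrite fs // -cat_rcons IH -?cat_rcons //.
by apply: Qp Qt; apply/seq.permP => a; rewrite -!cats1 !count_cat /= !count_cat;
  ring.
Qed.

Section Partition.
Variables (F : numFieldType) (w : F).
Hypothesis w_root : w ^+ 2 = - 1 - w.

Local Notation gz := (grid_sum w).
Local Notation Rm := (crossing_weight w).

Lemma w_cubed : w ^+ 3 = 1.
Proof. by ring: w_root. Qed.
Lemma w_neq0 : w != 0.
Proof. by apply: contraTneq (oner_neq0 F) => w0; rewrite -w_cubed w0 expr0n /=
  eqxx. Qed.

(** Domain wall boundary conditions: all rows and all columns sum to 1. *)
Definition asm_partition (xs ys : seq F) : F :=
  gz ys xs (zeros (size xs)) (ones (size xs)) (zeros (size ys))
    (ones (size ys)).

(** The upper half of a half-turn symmetric matrix.  Columns at equal distance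
    from the two sides share a parameter; the lower part of one of them is the
    upper part of the other turned around, so their sums over the upper half
    are complementary. *)
Definition ht_partition (xs ys : seq F) : F :=
  \sum_(b : (size ys).-tuple bool)
    gz (ys ++ rev ys) xs (zeros (size xs)) (ones (size xs))
       (zeros (size (ys ++ rev ys))) (b ++ rev (map negb b)).

(** The upper left quadrant of a quarter-turn symmetric matrix.  The rest of
    row i is column i of the quadrant turned around, so row i and column i form
    one line with one parameter, and their sums are complementary. *)
Definition qt_partition (xs : seq F) : F :=
  \sum_(h : (size xs).-tuple bool)
    gz xs xs (zeros (size xs)) h (zeros (size xs)) (map negb h).

(** General position: no ratio of two parameters is a cube root of unity, so the
    interpolation nodes differ from each other and from the parameters. *)
Definition generic (xs : seq F) := (0 \notin xs) && uniq [seq x ^+ 3 | x <- xs].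

Lemma generic_perm s t : perm_eq s t -> generic s -> generic t.
Proof.
by move=> st /andP [s0 us]; rewrite /generic -(perm_mem st)
  s0 -(perm_uniq (perm_map _ st)).
Qed.

Lemma generic_catl s t : generic (s ++ t) -> generic s.
Proof.
by rewrite /generic mem_cat map_cat cat_uniq negb_or -andbA => /and4P [-> _ ->].
Qed.

Lemma generic_catr s t : generic (s ++ t) -> generic t.
Proof.
by rewrite /generic mem_cat map_cat cat_uniq negb_or =>
  /andP [/andP [_ ->] /and3P [_ _ ->]].
Qed.

Lemma generic_neq s1 x y s2 : generic (s1 ++ x :: y :: s2) -> y - w * x != 0.
Proof.
move=> /generic_catr; rewrite /generic !inE /= !inE !negb_or.
case/andP => /and3P [x0 _ _] /andP [/andP [xy _] _].
by apply: contraNneq xy => /subr0_eq ->; rewrite exprMn w_cubed mul1r.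
Qed.

(** When both rows start with 0 and end with 1, the crossing is the same scalar
    on the two sides. *)
Lemma grid_sum_rows_perm cs xs xs' t b : size t = size cs -> perm_eq xs xs' ->
  generic xs ->
  gz cs xs (zeros (size xs)) (ones (size xs)) t b =
  gz cs xs' (zeros (size xs')) (ones (size xs')) t b.
Proof.
move=> st; apply: (@perm_eq_swap_invariant _ _ (fun s => is_true (generic s))
  (fun xs => gz cs xs (zeros (size xs)) (ones (size xs)) t b) generic_perm).
move=> s1 x y s2 Q; have nz := generic_neq Q.
rewrite !size_cat /= !nseqD /=.
have := @grid_sum_row_exchange F w w_root cs s1 x y s2 (zeros (size s1))
  (zeros (size s2))
   (ones (size s1)) true true (ones (size s2)) t b st.
rewrite !size_nseq !sum_bool /crossing_weight /= !mulr0 !add0r =>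
  /(_ erefl erefl) => E.
by apply: (mulfI nz); rewrite E mulrC.
Qed.

Lemma asm_partition_perm xs xs' ys : perm_eq xs xs' -> generic xs ->
  asm_partition xs ys = asm_partition xs' ys.
Proof. by apply: grid_sum_rows_perm; rewrite size_nseq. Qed.

Lemma ht_partition_perm xs xs' ys : perm_eq xs xs' -> generic xs ->
  ht_partition xs ys = ht_partition xs' ys.
Proof.
by move=> p g; apply: eq_bigr => h _; apply: grid_sum_rows_perm;
  rewrite ?size_nseq.
Qed.

(** A crossing is inserted at the left of rows k, k + 1, and another one on top
    of columns k, k + 1.  They come out at the right and at the bottom of the
    quadrant, where the lines are joined, and cancel there by unitarity. *)
Lemma qt_partition_swap_scaled s1 x1 x2 s2 :
  (x2 - w * x1) * (x1 - w * x2) *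
    (qt_partition (s1 ++ x1 :: x2 :: s2) - qt_partition (s1 ++ x2 :: x1 :: s2))
      = 0.
Proof.
apply/eqP; rewrite mulrBr subr_eq0; apply/eqP.
have sE a b : size (s1 ++ a :: b :: s2) =
  (size s1 + (size s2).+2)%N by rewrite size_cat.
rewrite /qt_partition.
pose G a b a' b' h v := gz (s1 ++ a :: b :: s2) (s1 ++ a' :: b' :: s2)
   (zeros (size s1) ++ false :: false :: zeros (size s2)) h
   (zeros (size s1) ++ false :: false :: zeros (size s2)) v.
have E a b : \sum_(h : (size (s1 ++ a :: b :: s2)).-tuple bool)
    gz (s1 ++ a :: b :: s2) (s1 ++ a :: b :: s2)
      (zeros (size (s1 ++ a :: b :: s2))) h
    (zeros (size (s1 ++ a :: b :: s2))) (map negb h) =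
    \sum_(h1 : (size s1).-tuple bool) \sum_(h2 : (size s2).-tuple bool)
    \sum_a1 \sum_a2 G a b a b (h1 ++ a1 :: a2 :: h2)
      (map negb h1 ++ ~~ a1 :: ~~ a2 :: map negb h2).
  rewrite sE nseqD /= (@sum_bits_mid F _ _ _ (fun h => G a b a b h (map negb h))
    (erefl _)).
  do 2 (apply: eq_bigr => ? _); do 2 (apply: eq_bigr => ? _).
  by rewrite map_cat.
rewrite !E !mulr_sumr; apply: eq_bigr => h1 _.
rewrite !mulr_sumr; apply: eq_bigr => h2 _.
have RE a1 a2 v : (x2 - w * x1) * G x1 x2 x1 x2 (h1 ++ a1 :: a2 :: h2) v =
   \sum_k1 \sum_k2 G x1 x2 x2 x1 (h1 ++ k1 :: k2 :: h2) v *
     Rm x1 x2 k1 k2 a1 a2.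
  by apply: grid_sum_row_exchange; rewrite ?size_cat /= ?size_nseq ?size_tuple.
have CE k1 k2 a1 a2 : (x1 - w * x2) * G x1 x2 x2 x1 (h1 ++ k1 :: k2 :: h2)
  (map negb h1 ++ a1 :: a2 :: map negb h2) =
  \sum_v1 \sum_v2 G x2 x1 x2 x1 (h1 ++ k1 :: k2 :: h2)
    (map negb h1 ++ v1 :: v2 :: map negb h2)
    * Rm x2 x1 v2 v1 a2 a1.
  have := @grid_sum_col_exchange F w w_root s1 x1 x2 s2 (s1 ++ x2 :: x1 :: s2)
    (zeros (size s1) ++ false :: false :: zeros (size s2))
      (h1 ++ k1 :: k2 :: h2)
    (zeros (size s1)) false false (zeros (size s2)) (map negb h1) a1 a2
      (map negb h2).
  rewrite size_nseq size_map size_tuple => /(_ erefl erefl).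
  by rewrite !sum_bool {1 2 3 4}/crossing_weight /= !mul0r !addr0.
pose g := fun k1 k2 v1 v2 => G x2 x1 x2 x1 (h1 ++ k1 :: k2 :: h2)
  (map negb h1 ++ v1 :: v2 :: map negb h2).
transitivity (\sum_a1 \sum_a2 \sum_k1 \sum_k2 \sum_v1 \sum_v2
    g k1 k2 v1 v2 * (Rm x1 x2 k1 k2 a1 a2 * Rm x2 x1 v2 v1 (~~ a2) (~~ a1))).
  rewrite !mulr_sumr; apply: eq_bigr => a1 _; rewrite !mulr_sumr; apply:
    eq_bigr => a2 _.
  rewrite mulrAC RE mulr_suml; apply: eq_bigr => k1 _.
  rewrite mulr_suml; apply: eq_bigr => k2 _.
  rewrite mulrAC [_ * (x1 - _)]mulrC CE mulr_suml; apply: eq_bigr => v1 _.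
  rewrite mulr_suml; apply: eq_bigr => v2 _.
  by rewrite /g; ring.
transitivity (\sum_k1 \sum_k2 \sum_v1 \sum_v2 g k1 k2 v1 v2 *
   (\sum_a1 \sum_a2 Rm x1 x2 k1 k2 a1 a2 * Rm x2 x1 v2 v1 (~~ a2) (~~ a1))).
  by rewrite !sum_bool; ring.
under eq_bigr => k1 _ do under eq_bigr => k2 _ do
  under eq_bigr => v1 _ do under eq_bigr =>
    v2 _ do rewrite (crossing_weight_unitary w_root).
by rewrite !sum_bool /= /g !mulr0 !addr0 !add0r !mulr1 -!mulrDl mulrC; ring.
Qed.

End Partition.

(** * Recursions of the partition functions *)

Section Recursions.
Variables (F : numFieldType) (w : F).
Hypothesis w_root : w ^+ 2 = - 1 - w.

Local Notation rw := (row_weight w).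
Local Notation gz := (grid_sum w).
Local Notation wA := (weight_a w).
Local Notation wB := (weight_b w).
Local Notation vw := (vertex_weight w).
Local Notation Zasm := (asm_partition w).
Local Notation Zht := (ht_partition w).
Local Notation Zqt := (qt_partition w).

Lemma polyfun_some_qt_partition (xs : seq {poly F}) :
  polyfun_some (fun s => Zqt [seq p.[s] | p : {poly F} <- xs]).
Proof.
have [d dP] : polyfun_some (fun s => \sum_(h : (size xs).-tuple bool)
   gz [seq p.[s] | p : {poly F} <- xs] [seq p.[s] | p : {poly F} <- xs]
     (zeros (size xs)) h (zeros (size xs)) (map negb h)).
  by apply: polyfun_some_sum => h; apply: polyfun_some_grid_sum.
by exists d; apply: polyfun_ext dP => s; rewrite /qt_partition size_map.
Qed.

Lemma polyfun_some_asm_partition (xs ys : seq {poly F}) :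
  polyfun_some (fun s => Zasm [seq p.[s] | p : {poly F} <- xs]
    [seq p.[s] | p : {poly F} <- ys]).
Proof.
have [d dP] := polyfun_some_grid_sum w ys xs (zeros (size xs)) (ones (size xs))
  (zeros (size ys)) (ones (size ys)).
by exists d; apply: polyfun_ext dP => s; rewrite /asm_partition !size_map.
Qed.

Lemma polyfun_some_ht_partition (xs ys : seq {poly F}) :
  polyfun_some (fun s => Zht [seq p.[s] | p : {poly F} <- xs]
    [seq p.[s] | p : {poly F} <- ys]).
Proof.
have [d dP] : polyfun_some (fun s => \sum_(b : (size ys).-tuple bool)
    gz [seq p.[s] | p : {poly F} <- ys ++ rev ys]
      [seq p.[s] | p : {poly F} <- xs] (zeros (size xs)) (ones (size xs))
       (zeros (size (ys ++ rev ys))) (b ++ rev (map negb b))).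
  by apply: polyfun_some_sum => h; apply: polyfun_some_grid_sum.
exists d; apply: polyfun_ext dP => s.
by rewrite /ht_partition !size_map !size_cat !size_rev !size_map map_cat
  map_rev.
Qed.

(** The scalar of the preceding lemma vanishes exactly at the ratios at which
    the symmetry is needed; it is removed by polynomiality. *)
Lemma qt_partition_swap s1 x1 x2 s2 : Zqt (s1 ++ x1 :: x2 :: s2) =
  Zqt (s1 ++ x2 :: x1 :: s2).
Proof.
pose C (c : F) := c%:P; pose ev (s : F) (p : {poly F}) := p.[s].
have evC s xs : [seq p.[s] | p : {poly F} <- map C xs] = xs.
  by rewrite -map_comp map_id_in // => c _ /=; rewrite hornerC.
have E1 x : [seq p.[x] | p : {poly F} <- map C s1 ++ 'X :: C x2 :: map C s2] =
  s1 ++ x :: x2 :: s2.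
  by rewrite map_cat /= !evC hornerX hornerC.
have E2 x : [seq p.[x] | p : {poly F} <- map C s1 ++ C x2 :: 'X :: map C s2] =
  s1 ++ x2 :: x :: s2.
  by rewrite map_cat /= !evC hornerX hornerC.
have P1 := polyfun_some_qt_partition (map C s1 ++ 'X :: C x2 :: map C s2).
have P2 := polyfun_some_qt_partition (map C s1 ++ C x2 :: 'X :: map C s2).
rewrite -E1 -E2; move: x1.
apply: (@polyfun_some_cancel _ 0 ((x2%:P - w *: 'X) * ('X - (w * x2)%:P))) =>
  //.
  rewrite mulf_neq0 ?polyXsubC_eq0 // subr_eq0; apply/eqP => /polyP /(_ 1%N).
  by rewrite coefC coefZ coefX /= mulr1 => /esym/eqP;
    rewrite (negbTE (w_neq0 w_root)).
move=> n _; rewrite E1 E2 hornerM !hornerE; exact: qt_partition_swap_scaled.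
Qed.

Lemma qt_partition_perm xs xs' : perm_eq xs xs' -> Zqt xs = Zqt xs'.
Proof.
move=> p; apply: (@perm_eq_swap_invariant _ _ (fun=> True) Zqt) p _ =>
  // s1 x y s2 _.
exact: qt_partition_swap.
Qed.

Lemma weight_a_mulw x : wA x (w * x) = 0.
Proof. by rewrite /weight_a subrr mul0r. Qed.

(** The top left vertex cannot be 0, so the first row and the first column are
    those of a matrix with 1 at the corner. *)
Lemma asm_partition_rec x xs ys :
  Zasm (x :: xs) (w * x :: ys) =
  (\prod_(y <- ys) wB x y) * (\prod_(z <- xs) wB z (w * x)) * Zasm xs ys.
Proof.
rewrite /asm_partition /= (sum_tuple_cons _
  (fun m => rw x (w * x :: ys) false (false :: zeros (size ys)) m true *
   gz (w * x :: ys) xs (zeros (size xs)) (ones (size xs)) m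
     (true :: ones (size ys)))).
rewrite sum_bool /= big1 ?add0r => [|m _]; last by rewrite {1}/vertex_weight /=
  weight_a_mulw !mul0r.
rewrite {1}/vertex_weight /=; under eq_bigr do rewrite mul1r.
rewrite (sum_row_weight_true w x ys true
  (fun m => gz (w * x :: ys) xs (zeros (size xs)) (ones (size xs))
   (true :: m) (true :: ones (size ys)))).
by rewrite grid_sum_col_true_true mul1r mulrA.
Qed.

(** The top left vertex is forced to be 1.  This fixes the first row and the
    first column, and by the boundary condition the last column is zero. *)
Lemma ht_partition_rec1 x xs ys :
  Zht (x :: xs) (w * x :: ys) =
  wB x (w * x) * ((\prod_(y <- ys) wB x y) * (\prod_(z <- xs) wB z (w * x)))
    ^+ 2 * Zht xs ys.
Proof.
set y := w * x; set Y := ys ++ rev ys.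
have YE : (y :: ys) ++ rev (y :: ys) = y :: rcons Y y.
  by rewrite rev_cons -cats1 catA cats1.
rewrite /ht_partition YE /=.
pose B b := b ++ rev (map negb b).
have BE b0 b : B (b0 :: b) = b0 :: rcons (B b) (~~ b0).
  by rewrite /B /= rev_cons -cats1 catA cats1.
pose f b := \sum_(m : (size (rcons Y y)).+1.-tuple bool) rw x (y :: rcons Y y)
  false (false :: zeros (size (rcons Y y))) m true *
  gz (y :: rcons Y y) xs (zeros (size xs)) (ones (size xs)) m (B b).
rewrite (sum_tuple_cons _ f) sum_bool.
have fE b : f b = (\prod_(c <- rcons Y y) wB x c) *
    gz (y :: rcons Y y) xs (zeros (size xs)) (ones (size xs))
      (true :: zeros (size (rcons Y y))) (B b).
  rewrite /f (sum_tuple_cons _ (fun m =>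
    rw x (y :: rcons Y y) false (false :: zeros (size (rcons Y y))) m true *
    gz (y :: rcons Y y) xs (zeros (size xs)) (ones (size xs)) m (B b))) sum_bool
      /=.
  rewrite big1 ?add0r => [|m _]; last by rewrite {1}/vertex_weight /=
    weight_a_mulw !mul0r.
  rewrite {1}/vertex_weight /=; under eq_bigr do rewrite mul1r.
  by rewrite (sum_row_weight_true w x (rcons Y y) true (fun m =>
    gz (y :: rcons Y y) xs (zeros (size xs)) (ones (size xs)) (true :: m)
      (B b))) mul1r.
rewrite big1 ?add0r => [|b _]; last by rewrite fE BE grid_sum_col_true_false
  mulr0.
have zE : zeros (size (rcons Y y)) = rcons (zeros (size Y)) false.
  by rewrite size_rcons -cats1 -[[:: false]]/(zeros 1) -nseqD addn1.
rewrite mulr_sumr; apply: eq_bigr => b _.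
rewrite fE BE grid_sum_col_true_true zE grid_sum_lastcol_false_false ?size_nseq
  // -/Y -/(B b).
rewrite -cats1 /Y !big_cat /= big_seq1 (perm_big _ (permEl (perm_rev ys))) /=.
ring.
Qed.

(** Here the top right vertex is forced to be 1, which empties the first
    column. *)
Lemma ht_partition_rec2 y xs ys :
  Zht (w * y :: xs) (y :: ys) =
  wA (w * y) y * ((\prod_(z <- ys) wA (w * y) z) * (\prod_(z <- xs) wA z y))
    ^+ 2 * Zht xs ys.
Proof.
set x := w * y; set Y := ys ++ rev ys.
have YE : (y :: ys) ++ rev (y :: ys) = rcons (y :: Y) y.
  by rewrite rev_cons -cats1 catA cats1.
rewrite /ht_partition YE [size (y :: ys)]/= [size (x :: xs)]/=.
pose B b := b ++ rev (map negb b).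
have BE b0 b : B (b0 :: b) = rcons (b0 :: B b) (~~ b0).
  by rewrite /B /= rev_cons -cats1 catA cats1.
have zE : zeros (size (rcons (y :: Y) y)) = rcons (zeros (size (y :: Y))) false.
  by rewrite size_rcons -cats1 -[[:: false]]/(zeros 1) -nseqD addn1.
pose f b := gz (rcons (y :: Y) y) (x :: xs) (false :: zeros (size xs))
  (true :: ones (size xs))
   (zeros (size (rcons (y :: Y) y))) (B b).
rewrite (sum_tuple_cons _ f) sum_bool.
have fE b : f b = (\prod_(c <- y :: Y) wA x c) *
    gz (rcons (y :: Y) y) xs (zeros (size xs)) (ones (size xs))
      (rcons (zeros (size (y :: Y))) true) (B b).
  rewrite /f zE grid_sum_rcons ?size_nseq // sum_bool.
  rewrite big1 ?add0r => [|m _]; last by rewrite {1}/vertex_weight /=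
    weight_bE weight_a_mulw !mul0r.
  rewrite -(sum_row_weight_false_false w x (y :: Y)
    (fun m => gz (rcons (y :: Y) y) xs (zeros (size xs)) (ones (size xs))
    (rcons m true) (B b))).
  by apply: eq_bigr => m _; rewrite {1}/vertex_weight /= mul1r.
rewrite [X in _ + X]big1 ?addr0 => [|b _];
  last by rewrite fE BE grid_sum_lastcol_true_false ?size_nseq ?mulr0.
rewrite mulr_sumr; apply: eq_bigr => b _.
rewrite fE BE grid_sum_lastcol_true_true ?size_nseq // [zeros (size (y :: Y))]/=
  grid_sum_col_false_false -/Y -/(B b).
rewrite big_cons /Y !big_cat /= (perm_big _ (permEl (perm_rev ys))) /=.
ring.
Qed.

(** The corner entry is 0, since a 1 there would give sum 1 both to the first
    row and to the first column.  The weight A of its right neighbour vanishes,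
    so this neighbour is 1; with the boundary condition this determines the
    first two rows and columns. *)
Lemma qt_partition_rec x s :
  Zqt (x :: w * x :: s) =
  x * wA (w * x) x * (w * x) *
  (\prod_(c <- s) (wB x c * wA c x * wB c (w * x) * wA (w * x) c)) * Zqt s.
Proof.
set y := w * x.
have wAxx z : wA z z = z := weight_a_diag w_root z.
have wBxx z : wB z z = z by rewrite weight_bE.
rewrite /qt_partition.
pose f h := gz (x :: y :: s) (x :: y :: s) (zeros (size (x :: y :: s))) h
  (zeros (size (x :: y :: s))) (map negb h).
rewrite (sum_tuple_cons _ f) sum_bool.
pose K0 := x * (\prod_(c <- s) wB x c) * (\prod_(c <- y :: s) wA c x).
have fE h1 h : f (h1 :: h) = if h1 then K0 *
  gz (y :: s) (y :: s) (zeros (size (y :: s))) h (true :: zeros (size s))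
  (map negb h) else 0.
  rewrite /f.
  pose g m := rw x (x :: y :: s) false (zeros (size (x :: y :: s))) m h1 *
     gz (x :: y :: s) (y :: s) (zeros (size (y :: s))) h m (map negb (h1 :: h)).
  rewrite [LHS](_ : _ = \sum_(m : (size (x :: y :: s)).-tuple bool) g m) //.
  rewrite (sum_tuple_cons _ g) sum_bool [X in _ + X](_ : _ = 0) ?addr0;
    last first.
    pose g' m := gz (x :: y :: s) (y :: s) (zeros (size (y :: s))) h (true :: m)
      (map negb (h1 :: h)).
    transitivity (\sum_(m : (size (y :: s)).-tuple bool) rw x (y :: s) true
      (zeros (size (y :: s))) m h1 * g' m).
      by apply: eq_bigr => m _; rewrite /g row_weight_cons /vertex_weight /=
        mul1r.
    rewrite sum_row_weight_true /g' map_cons; case: h1 {g g'};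
      last by rewrite !mul0r.
    by rewrite grid_sum_col_true_false mulr0.
  rewrite (sum_tuple_cons _ (fun m => g (false :: m))) sum_bool big1 ?add0r =>
    [|m _]; last first.
    by rewrite /g !row_weight_cons {2}/vertex_weight /=
      weight_a_mulw mul0r mulr0 mul0r.
  pose g' m := gz (x :: y :: s) (y :: s) (zeros (size (y :: s))) h
    (false :: true :: m) (map negb (h1 :: h)).
  transitivity (x * \sum_(m : (size s).-tuple bool) rw x s true (zeros (size s))
    m h1 * g' m).
    rewrite mulr_sumr; apply: eq_bigr => m _.
    have v1 : vw x x false false false = x by exact: wAxx.
    have v2 : vw x y (false (+) false (+) false) false true = 1 by [].
    by rewrite /g !row_weight_cons v1 v2 mul1r mulrA.
  rewrite sum_row_weight_true /g'; case: h1 {g g'};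
    last by rewrite !mul0r mulr0.
  by rewrite map_cons grid_sum_col_false_false /K0 mul1r; ring.
rewrite big1 ?add0r => [|h _]; last by rewrite fE.
rewrite (sum_tuple_cons _ (fun h => f (true :: h))) sum_bool [X in _ + X]big1
  ?addr0 => [|h _]; last first.
  by rewrite fE map_cons grid_sum_col_true_false mulr0.
rewrite mulr_sumr; apply: eq_bigr => h _.
rewrite fE map_cons grid_sum_col_true_true.
rewrite [gz s (y :: s) _ _ _ _]/=.
rewrite (sum_row_weight_false_false w y s
  (fun m => gz s s (zeros (size s)) h m (map negb h))).
rewrite /K0 !big_cons wBxx !big_split /=; ring.
Qed.

End Recursions.

(** * Degrees of the partition functions *)

Section Degrees.
Variables (F : numFieldType) (w : F).
Hypothesis w_root : w ^+ 2 = - 1 - w.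

Local Notation rw := (row_weight w).
Local Notation gz := (grid_sum w).
Local Notation wA := (weight_a w).
Local Notation wB := (weight_b w).
Local Notation Zasm := (asm_partition w).
Local Notation Zht := (ht_partition w).
Local Notation Zqt := (qt_partition w).

Lemma polyfun_asm_partition xs ys : polyfun (size xs).-1
  (fun y => Zasm xs (y :: ys)).
Proof. exact: polyfun_grid_sum_col. Qed.

(** The two columns with the parameter in question have complementary sums: one
    of them is zero, the other contains exactly one 1. *)
Lemma polyfun_ht_partition xs ys : polyfun (size xs + (size xs).-1)
  (fun y => Zht xs (y :: ys)).
Proof.
pose Y := ys ++ rev ys; pose B b := b ++ rev (map negb b).
have sY : size (ys ++ rev ys) = size Y by [].
have E y : \sum_(b : (size ys).-tuple bool)
     ((\prod_(z <- xs) wA z y) * gz (rcons Y y) xs (zeros (size xs))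
       (ones (size xs))
        (rcons (zeros (size Y)) false) (rcons (B b) true)
     + (\prod_(z <- xs) wB z y) * gz (y :: Y) xs (zeros (size xs))
       (ones (size xs))
        (false :: zeros (size Y)) (true :: B b)) = Zht xs (y :: ys).
  have YE : (y :: ys) ++ rev (y :: ys) = y :: rcons Y y.
    by rewrite rev_cons -cats1 catA cats1.
  have BE b0 b : B (b0 :: b) = b0 :: rcons (B b) (~~ b0).
    by rewrite /B /= rev_cons -cats1 catA cats1.
  have zE : zeros (size (rcons Y y)) = rcons (zeros (size Y)) false.
    by rewrite size_rcons -cats1 -[[:: false]]/(zeros 1) -nseqD addn1.
  rewrite /ht_partition YE /=.
  rewrite (sum_tuple_cons _ (fun b => gz (y :: rcons Y y) xs (zeros (size xs))
    (ones (size xs))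
    (false :: zeros (size (rcons Y y))) (B b))) sum_bool -big_split /=.
  apply: eq_bigr => b _; rewrite !BE zE grid_sum_col_false_false; congr (_ + _).
  by rewrite -!rcons_cons grid_sum_lastcol_false_false //= size_nseq.
apply: polyfun_ext E _; apply: polyfun_sum => b _; apply: polyfunD.
  apply: polyfunM; first by apply: polyfun_prod => z; apply: polyfun_weight_a_r.
  by apply: polyfun_grid_sum_lastcol; rewrite size_nseq.
apply: polyfunM; first by apply: polyfun_prod => z; apply: polyfun_weight_b_r.
exact: polyfun_grid_sum_col.
Qed.

(** The corner weighs [x] and is split off.  The first row and the first column
    together contain exactly one 1, so the degree is one less than the number
    of the other vertices on them. *)
Lemma polyfun_qt_partition c s : exists2 q, polyfun (size (c :: s) + size s) q &
  forall x, Zqt (x :: c :: s) = x * q x.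
Proof.
pose S := c :: s; rewrite -/S.
pose q x := \sum_(h : (size S).-tuple bool)
  ((\prod_(z <- S) wA x z) * gz (x :: S) S (zeros (size S)) h
    (false :: zeros (size S)) (true :: map negb h)
  + (\prod_(z <- S) wA z x) * \sum_(m : (size S).-tuple bool)
      gz S S (zeros (size S)) h m (map negb h) *
        rw x S false (zeros (size S)) m true).
exists q.
  apply: polyfun_sum => h _; apply: polyfunD.
    apply: polyfunM; first by apply: polyfun_prod => z; apply:
      polyfun_weight_a_l.
    exact: (polyfun_grid_sum_col w S S h (zeros (size S)) (map negb h)).
  apply: polyfunM; first by apply: polyfun_prod => z; apply: polyfun_weight_a_r.
  by apply: polyfun_sum => m _; apply/polyfunZ/polyfun_first_row.
move=> x; rewrite mulr_sumr.
pose f h := gz (x :: S) (x :: S) (zeros (size (x :: S))) h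
  (zeros (size (x :: S))) (map negb h).
rewrite /qt_partition (sum_tuple_cons _ f) sum_bool -big_split; apply:
  eq_bigr => h _.
rewrite mulrDr; congr (_ + _).
  rewrite /f [LHS]/=.
  rewrite (sum_row_weight_false_false w x (x :: S)
    (fun m => gz (x :: S) S (zeros (size S)) h m (true :: map negb h))).
  by rewrite big_cons (weight_a_diag w_root) mulrA.
rewrite /f map_cons grid_sum_col_false_false big_cons
  (weight_a_diag w_root) -!mulrA; congr (_ * (_ * _)).
by apply: eq_bigr => m _; rewrite mulrC.
Qed.

End Degrees.

(** * Alternants with exponents in two residue classes modulo 3 *)

Section Alternant.
Variables (F : numFieldType) (w : F).
Hypothesis w_root : w ^+ 2 = - 1 - w.

(** The size is an argument of its own, so that it can be rewritten
    independently of the list. *)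
Definition alternant_of_size n (f : nat -> nat) (X : seq F) : F :=
  \det (\matrix_(i < n, j < n) X`_i ^+ f j).

Definition alternant f X := alternant_of_size (size X) f X.

Lemma alternant_perm X Y : perm_eq X Y ->
  exists b : bool, forall f, alternant f Y = (-1) ^+ b * alternant f X.
Proof.
rewrite perm_sym => /(tuple_permP (t := in_tuple X)) [p ->].
exists (odd_perm p) => f; rewrite /alternant size_tuple.
rewrite -(det_perm F p) -det_mulmx -row_permE; congr (\det _).
apply/matrixP => i j; rewrite !mxE (nth_map i) ?size_enum_ord // nth_ord_enum.
by rewrite (tnth_nth 0).
Qed.

Lemma alternant_id_cons x X :
  alternant id (x :: X) = (\prod_(c <- X) (c - x)) * alternant id X.
Proof.
have E Y : alternant id Y = \prod_(i < size Y) \prod_(j < size Y | (i < j)%N)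
  (Y`_j - Y`_i).
  pose a : 'rV_(size Y) := \row_j Y`_j.
  rewrite /alternant /alternant_of_size -det_tr
    (_ : _^T = Vandermonde (size Y) a).
    by rewrite det_Vandermonde; do 2 (apply: eq_bigr => ? _); rewrite !mxE.
  by apply/matrixP => i j; rewrite !mxE.
rewrite !E /= big_ord_recl big_mkcond big_ord_recl /=
  mul1r (big_nth 0) big_mkord; congr (_ * _).
apply: eq_bigr => i _; rewrite big_mkcond big_ord_recl /= mul1r.
by rewrite [RHS]big_mkcond; apply: eq_bigr => j _.
Qed.

Lemma alternant_id_neq0 X : uniq X -> alternant id X != 0.
Proof.
elim: X => [|x X IH] /=; first by rewrite /alternant /alternant_of_size det_mx00
  oner_neq0.
case/andP => xX /IH; rewrite alternant_id_cons => nz;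
  rewrite mulf_neq0 // prodf_seq_neq0.
by apply/allP => c cX; rewrite subr_eq0; apply: contraNneq xX => <-.
Qed.

(** For exponents in increasing order this is a Schur function. *)
Definition schur f X := alternant f X / alternant id X.

Lemma schur_perm f X Y : perm_eq X Y -> schur f X = schur f Y.
Proof.
move=> /alternant_perm [b bE]; rewrite /schur !bE -mulf_div divff ?mul1r //.
by rewrite signr_eq0.
Qed.

Lemma schur_nil f : schur f [::] = 1.
Proof. by rewrite /schur /alternant /alternant_of_size !det_mx00 divr1. Qed.

Lemma alternant_poly f d X : (forall j, (j <= size X)%N -> (f j <= d)%N) ->
  exists2 p : {poly F}, (size p <= d.+1)%N & forall x, alternant f (x :: X) =
    p.[x].
Proof.
move=> fd; pose M x := \matrix_(i < (size X).+1, j < (size X).+1) (x :: X)`_i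
  ^+ f j.
exists (\sum_(j < (size X).+1) cofactor (M 0) ord0 j *: 'X^(f j)).
  apply: leq_trans (size_sum _ _ _) _; apply/bigmax_leqP => j _.
  by apply: leq_trans (size_scale_leq _ _) _;
    rewrite size_polyXn ltnS fd // -ltnS.
move=> x; rewrite /alternant /alternant_of_size (expand_det_row _ ord0)
  horner_sum.
apply: eq_bigr => j _; rewrite hornerZ hornerXn mulrC mxE; congr (_ * _).
rewrite /cofactor; congr (_ * \det _).
by apply/matrixP => i k; rewrite !mxE.
Qed.

(** As a polynomial in the first variable the alternant vanishes at the other
    variables, so the Vandermonde factor divides it. *)
Lemma schur_poly f d X : (forall j, (j <= size X)%N -> (f j <= d)%N) ->
  uniq X ->
  exists2 p : F -> F, polyfun (d - size X) p & forall x, x \notin X ->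
    schur f (x :: X) = p x.
Proof.
move=> fd uX; have [p sp pE] := alternant_poly fd.
have rX : all (root p) X.
  apply/allP => c cX; rewrite rootE -pE; apply/eqP.
  have iX : (index c X < size X)%N by rewrite index_mem.
  apply: (determinant_alternate (i1 := ord0) (i2 := lift ord0 (Ordinal iX))) =>
    // j.
  by rewrite !mxE /= nth_index.
have [q qE] := uniq_roots_prod_XsubC rX (etrans (uniq_rootsE X) uX).
exists (fun x => (-1) ^+ size X / alternant id X * q.[x]).
  apply: polyfunZ; exists q => //; have [->|q0] := eqVneq q 0;
    first by rewrite size_poly0.
  have nz : \prod_(z <- X) ('X - z%:P) !=
    0 by rewrite monic_neq0 ?monic_prod_XsubC.
  move: sp; rewrite qE size_mul // size_prod_XsubC.
  move: (size q) (size X) => a b; lia.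
move=> x xX; rewrite /schur pE alternant_id_cons qE hornerM horner_prod.
under eq_bigr do rewrite hornerXsubC.
have -> : \prod_(c <- X) (x - c) = (-1) ^+ size X * \prod_(c <- X) (c - x).
  by elim: (X) => [|c Y IH]; rewrite ?big_nil ?mul1r // !big_cons IH /= exprS;
    ring.
have nz : \prod_(c <- X) (c - x) != 0.
  rewrite prodf_seq_neq0; apply/allP => c cX; rewrite subr_eq0.
  by apply: contraNneq xX => <-.
have nz' := alternant_id_neq0 uX.
by field; rewrite nz nz'.
Qed.

(** The exponents 0, e, 3, 3 + e, 6, 6 + e, ... *)
Definition expo e j := ((j./2) * 3 + odd j * e)%N.

(** Subtracting x^3 times column j from column j + 2 multiplies the entry of
    row c by c^3 - x^3.  This is 0 for the rows of x and w x, so a two by two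
    block splits off. *)
Lemma alternant_rec e x X :
  alternant (expo e) (x :: w * x :: X) =
  (w ^+ e - 1) * x ^+ e * (\prod_(c <- X) (c ^+ 3 - x ^+ 3)) *
    alternant (expo e) X.
Proof.
set n := size X.
pose A : 'M[F]_(2 + n) := \matrix_(i, j) (x :: w * x :: X)`_i ^+ expo e j.
(* Right multiplication by U performs the column operations. *)
pose U : 'M[F]_(2 + n) := \matrix_(i, j)
  ((i == j)%:R - x ^+ 3 * (i.+2 == j :> nat)%:R).
have dU : \det U = 1.
  rewrite -det_tr det_trig.
    rewrite big1 // => i _; rewrite !mxE eqxx.
    have -> : (i.+2 == i :> nat) = false by apply/eqP; lia.
    by rewrite mulr0 subr0.
  apply/is_trig_mxP => i j ij; rewrite !mxE.
  have -> : (j == i) = false by apply/negbTE; rewrite neq_ltn ij orbT.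
  have -> : (j.+2 == i :> nat) = false by apply/eqP; lia.
  by rewrite mulr0 subr0.
pose K : 'M[F]_2 := \matrix_(i, j) (x :: w * x :: X)`_i ^+ expo e j.
pose D : 'rV[F]_n := \row_i (X`_i ^+ 3 - x ^+ 3).
pose B : 'M[F]_n := \matrix_(i, j) X`_i ^+ expo e j.
have expS j : expo e j.+2 = (expo e j + 3)%N.
  by rewrite /expo /= negbK mulSn; lia.
have AU : A *m U = block_mx K 0 (dlsubmx (A *m U)) (diag_mx D *m B).
  have AUE i j : (A *m U) i j = A i j -
    (if (j < 2)%N then 0 else x ^+ 3 * (x :: w * x :: X)`_i ^+ expo e (j - 2)).
    rewrite mxE.
    under eq_bigr => k _ do rewrite [U _ _]mxE mulrBr.
    rewrite sumrB; congr (_ - _).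
      rewrite (bigD1 j) //= eqxx mulr1 big1 ?addr0 // => k /negbTE ->.
      by rewrite mulr0.
    case: ltnP => j2.
      by rewrite big1 // => k _; rewrite (_ : (k.+2 == j :> nat) = false) ?mulr0
        //; apply/eqP; lia.
    have kP : (j - 2 < 2 + n)%N by apply:
      leq_ltn_trans (leq_subr _ _) (ltn_ord j).
    rewrite (bigD1 (Ordinal kP)) //= big1 ?addr0 => [|k kN].
      by rewrite mxE /= -(addn2 (j - 2)) subnK // eqxx mulr1 mulrC.
    suff -> : (k.+2 == j :> nat) = false by rewrite !mulr0.
    by apply: contraNF kN => /eqP kj; apply/eqP/val_inj => /=; lia.
  rewrite -[LHS]submxK; congr block_mx; apply/matrixP => i j.
  - by rewrite [LHS]mxE [LHS]mxE AUE /= ltn_ord subr0 !mxE.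
  - rewrite [LHS]mxE [LHS]mxE AUE /= mxE [RHS]mxE.
    rewrite (_ : expo e (rshift 2 j) = expo e j + 3)%N; last exact: expS.
    rewrite addKn exprD.
    by case: i => [[|[|//]]] ? /=; rewrite ?exprMn ?(w_cubed w_root); ring.
  - rewrite [LHS]mxE [LHS]mxE AUE mul_diag_mx !mxE /=.
    rewrite (_ : expo e (rshift 2 j) = expo e j + 3)%N; last exact: expS.
    by rewrite addKn exprD; ring.
have dA : \det A = \det K * ((\prod_(c <- X) (c ^+ 3 - x ^+ 3)) * \det B).
  transitivity (\det (A *m U)); first by rewrite det_mulmx dU mulr1.
  rewrite AU det_lblock det_mulmx det_diag.
  congr (_ * (_ * _)); rewrite [RHS](big_nth 0) big_mkord; apply: eq_bigr =>
    i _.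
  by rewrite mxE.
have dK : \det K = (w ^+ e - 1) * x ^+ e.
  rewrite (expand_det_row _ ord0) !big_ord_recl big_ord0 /cofactor !det_mx11
    !mxE /= /expo /= exprMn.
  have -> : (0 * 3 + 1 * e = e)%N by rewrite mul1n.
  have -> : (0 * 3 + 0 * e = 0)%N by [].
  by rewrite (_ : (0 + bump 0 0 = 1)%N) // !expr0 expr1; ring.
by rewrite [LHS]dA dK -[alternant _ X]/(\det B); ring.
Qed.

Lemma schur_rec e x X : x != 0 -> uniq (x :: w * x :: X) ->
  schur (expo e) (x :: w * x :: X) =
  (w ^+ e - 1) / (w - 1) * (x ^+ e / x) * (\prod_(c <- X) (c - w ^+ 2 * x)) *
    schur (expo e) X.
Proof.
move=> x0 /=; rewrite inE negb_or => /and3P [/andP [xw xX] wX uX].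
rewrite /schur alternant_rec !alternant_id_cons big_cons.
have n1 : \prod_(c <- X) (c - x) != 0.
  rewrite prodf_seq_neq0; apply/allP => c cX; rewrite /= subr_eq0.
  by apply: contraNneq xX => <-.
have n2 : \prod_(c <- X) (c - w * x) != 0.
  rewrite prodf_seq_neq0; apply/allP => c cX; rewrite /= subr_eq0.
  by apply: contraNneq wX => <-.
have n3 : w - 1 != 0 by rewrite -opprB oppr_eq0 (subr_w_neq0 w_root).
have n4 := alternant_id_neq0 uX.
have -> : \prod_(c <- X) (c ^+ 3 - x ^+ 3) = (\prod_(c <- X) (c - x)) *
  (\prod_(c <- X) (c - w * x)) *
    (\prod_(c <- X) (c - w ^+ 2 * x)).
  by rewrite -!big_split; apply: eq_bigr => c _ /=; ring: w_root.
have -> : w * x - x = (w - 1) * x by ring.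
by field; rewrite x0 n1 n2 n3 n4.
Qed.

End Alternant.

(** * Evaluation of the partition functions by interpolation *)

Section Interpolation.
Variables (F : numFieldType) (w : F).
Hypothesis w_root : w ^+ 2 = - 1 - w.

Local Notation wA := (weight_a w).
Local Notation wB := (weight_b w).
Local Notation Zasm := (asm_partition w).
Local Notation Zht := (ht_partition w).
Local Notation Zqt := (qt_partition w).
Local Notation s1 := (@schur F (expo 1)).
Local Notation s2 := (@schur F (expo 2)).

(** Its value is 3^(-n(n-1)/2), because (1 - w)^2 = - 3 w. *)
Fixpoint norm_const n : F :=
  if n is m.+1 then norm_const m * (- w) ^+ m / (1 - w) ^+ (2 * m) else 1.

Lemma w_neq1 : w - 1 != 0.
Proof. by rewrite -opprB oppr_eq0 (subr_w_neq0 w_root). Qed.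

Lemma schur1_rec x X : x != 0 -> uniq (x :: w * x :: X) ->
  s1 (x :: w * x :: X) = (\prod_(c <- X) (c - w ^+ 2 * x)) * s1 X.
Proof.
move=> x0 ux; rewrite (schur_rec w_root) // !expr1 !divff ?mulr1 ?mul1r //.
exact: w_neq1.
Qed.

Lemma schur2_rec x X : x != 0 -> uniq (x :: w * x :: X) ->
  s2 (x :: w * x :: X) = (1 + w) * x * (\prod_(c <- X) (c - w ^+ 2 * x)) * s2 X.
Proof.
move=> x0 ux; rewrite (schur_rec w_root) //; congr (_ * _ * _).
by have h := w_neq1; field; rewrite x0 h.
Qed.

(** With 2n + 2 variables the largest exponent is 3n + e, and the Vandermonde
    determinant has degree 2n + 1 in each variable. *)
Lemma schur_polyfun e n X : size X = n.*2.+1 -> uniq X ->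
  exists2 p : F -> F, polyfun (n + e - 1) p &
    forall x, x \notin X -> schur (expo e) (x :: X) = p x.
Proof.
move=> sX uX.
have := @schur_poly F (expo e) (3 * n + e) X _ uX.
case=> [j jX|p Pp pE]; last by exists p => //; apply: polyfunW Pp; lia.
rewrite /expo; have : (j./2 <= n)%N by lia.
by case: (odd j); lia.
Qed.

(** At the nodes all weights on the frozen lines are multiples of the factors
    c - w^2 x in the recursion of the alternants. *)
Lemma prod_weight_b_l x (s : seq F) : \prod_(c <- s) wB x c =
  ((- w) / (1 - w)) ^+ size s * \prod_(c <- s) (c - w ^+ 2 * x).
Proof.
elim: s => [|c s IH]; rewrite ?big_nil ?mul1r // !big_cons IH /=
  [_ ^+ (size s).+1]exprS.
have E : x - w * c = - w * (c - w ^+ 2 * x) by ring: w_root.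
by rewrite /weight_b E [- w * _ / _]mulrAC mulrACA.
Qed.

Lemma prod_weight_b_r x (s : seq F) : \prod_(c <- s) wB c (w * x) =
  (1 - w)^-1 ^+ size s * \prod_(c <- s) (c - w ^+ 2 * x).
Proof.
elim: s => [|c s IH]; rewrite ?big_nil ?mul1r // !big_cons IH /=
  [_ ^+ (size s).+1]exprS.
by rewrite /weight_b mulrA -expr2 [_ / _]mulrC mulrACA.
Qed.

Lemma norm_constS n : norm_const n.+1 = norm_const n * ((- w) / (1 - w)) ^+ n *
  (1 - w)^-1 ^+ n.
Proof.
rewrite /= mul2n -addnn exprD exprMn exprVn invfM.
by rewrite -!mulrA.
Qed.

Lemma generic_uniq (X : seq F) : generic X -> uniq X.
Proof. by case/andP => _; apply: map_uniq. Qed.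

Lemma generic_neq0 (X : seq F) x : generic X -> x \in X -> x != 0.
Proof. by case/andP => X0 _ xX; apply: contraNneq X0 => <-. Qed.

Lemma generic_node (x : F) k r : (0 < k < 3)%N -> generic (x :: r) ->
  (w ^+ k * x \notin r) && (w ^+ k * x != x).
Proof.
move=> kP g; have x0 : x != 0 by apply: generic_neq0 g _; rewrite mem_head.
have k3 : (w ^+ k * x) ^+ 3 = x ^+ 3.
  by rewrite exprMn -exprM mulnC exprM (w_cubed w_root) expr1n mul1r.
apply/andP; split.
  case/andP: g => _ /= /andP [xr _]; apply: contra xr => wr.
  by rewrite -k3; apply: map_f.
rewrite -subr_eq0 -[X in _ - X]mul1r -mulrBl mulf_neq0 //.
case: k kP {k3} => [|[|[|//]]] // _; first exact: w_neq1.
have -> : w ^+ 2 - 1 = (w - 1) * (- w ^+ 2) by ring: w_root.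
by rewrite mulf_neq0 ?w_neq1 // oppr_eq0 expf_neq0 // (w_neq0 w_root).
Qed.

Lemma uniq_node (x : F) r : generic (x :: r) -> uniq (x :: w * x :: r).
Proof.
move=> g; have /andP [n1 n2] := @generic_node x 1 _ isT g.
have := generic_uniq g; rewrite /= inE negb_or => /andP [-> ->].
by rewrite -[w]expr1 eq_sym n1 n2.
Qed.

Lemma asm_partition_node n u xs ys : size xs = n -> size ys = n -> u != 0 ->
  uniq (u :: w * u :: xs ++ ys) -> Zasm xs ys = norm_const n * s1 (xs ++ ys) ->
  Zasm (u :: xs) (w * u :: ys) = norm_const n.+1 * s1 (u :: w * u :: xs ++ ys).
Proof.
move=> sx sy u0 uu IH; rewrite asm_partition_rec IH schur1_rec // norm_constS
  prod_weight_b_l prod_weight_b_r sx sy.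
rewrite big_cat /=.
by move: (norm_const n) ((- w / (1 - w)) ^+ n) ((1 - w)^-1 ^+ n) => G e1 e2;
  ring.
Qed.

Lemma ht_partition_node1 n u xs ys : size xs = n -> size ys = n -> u != 0 ->
  uniq (u :: w * u :: xs ++ ys) -> Zht xs ys = norm_const n ^+ 2 *
    s1 (xs ++ ys) * s2 (xs ++ ys) ->
  Zht (u :: xs) (w * u :: ys) =
  norm_const n.+1 ^+ 2 * s1 (u :: w * u :: xs ++ ys) *
    s2 (u :: w * u :: xs ++ ys).
Proof.
move=> sx sy u0 uu IH; rewrite ht_partition_rec1 IH schur1_rec // schur2_rec //
  norm_constS prod_weight_b_l prod_weight_b_r sx sy.
have -> : wB u (w * u) = (1 + w) * u.
  by rewrite /weight_b; have h := subr_w_neq0 w_root; field.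
rewrite big_cat /=.
by move: (norm_const n) ((- w / (1 - w)) ^+ n) ((1 - w)^-1 ^+ n) => G e1 e2;
  ring.
Qed.

Lemma ht_partition_node2 n u xs ys : size xs = n -> size ys = n -> u != 0 ->
  uniq (u :: w * u :: xs ++ ys) -> Zht xs ys = norm_const n ^+ 2 *
    s1 (xs ++ ys) * s2 (xs ++ ys) ->
  Zht (w * u :: xs) (u :: ys) =
  norm_const n.+1 ^+ 2 * s1 (u :: w * u :: xs ++ ys) *
    s2 (u :: w * u :: xs ++ ys).
Proof.
move=> sx sy u0 uu IH; rewrite ht_partition_rec2 IH schur1_rec // schur2_rec //
  norm_constS.
rewrite (prod_weight_b_r u ys) (prod_weight_b_l u xs) sx sy.
have -> : wA (w * u) u = (1 + w) * u.
  by rewrite /weight_a; have h := subr_w_neq0 w_root; field.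
rewrite big_cat /=.
by move: (norm_const n) ((- w / (1 - w)) ^+ n) ((1 - w)^-1 ^+ n) => G e1 e2;
  ring.
Qed.

Lemma qt_partition_node n u s : size s = n.*2 -> u != 0 ->
  uniq (u :: w * u :: s) ->
  Zqt s = (\prod_(c <- s) c) * (norm_const n ^+ 4 * s1 s ^+ 3 * s2 s) ->
  Zqt (u :: w * u :: s) = (\prod_(c <- u :: w * u :: s) c) *
   (norm_const n.+1 ^+ 4 * s1 (u :: w * u :: s) ^+ 3 * s2 (u :: w * u :: s)).
Proof.
move=> ss u0 uu IH; rewrite (qt_partition_rec w_root) IH schur1_rec //
  schur2_rec // norm_constS !big_cons.
have -> : \prod_(c <- s) (wB u c * wA c u * wB c (w * u) * wA (w * u) c) =
    (\prod_(c <- s) wB u c) ^+ 2 * (\prod_(c <- s) wB c (w * u)) ^+ 2.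
  by rewrite !expr2 -!big_split; apply: eq_bigr => c _;
    rewrite /weight_a /weight_b /=; ring.
rewrite (prod_weight_b_l u s) (prod_weight_b_r u s) ss -addnn !exprD.
have -> : wA (w * u) u = (1 + w) * u.
  by rewrite /weight_a; have h := subr_w_neq0 w_root; field.
by move: (norm_const n) ((- w / (1 - w)) ^+ n) ((1 - w)^-1 ^+ n) => G e1 e2;
  ring.
Qed.

(** The interpolation nodes are the products of the other parameters with the
    two primitive cube roots of unity. *)
Lemma uniq_nodes (s : seq F) : generic s ->
  uniq ([seq w * x | x <- s] ++ [seq w ^+ 2 * x | x <- s]).
Proof.
move=> g; have w0 := w_neq0 w_root.
rewrite cat_uniq !map_inj_uniq ?generic_uniq //; try by apply: mulfI;
  rewrite ?expf_neq0.
rewrite /= andbT; apply/hasPn => _ /mapP [x xs ->]; apply/mapP => -[y ys].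
rewrite expr2 -mulrA => /(mulfI w0) E.
have gx : generic (x :: rem x s) by apply: generic_perm g; apply: perm_to_rem.
have := @generic_node x 1 _ isT gx; rewrite expr1 E.
move: ys; rewrite (perm_mem (perm_to_rem xs)) inE => /orP [/eqP ->|->];
  by rewrite ?eqxx ?andbF.
Qed.

(** Both sides have degree at most n - 1 in the first column parameter, and they
    agree at the n nodes w x_i. *)
Theorem asm_partition_schur n xs ys : size xs = n -> size ys = n ->
  generic (xs ++ ys) ->
  Zasm xs ys = norm_const n * s1 (xs ++ ys).
Proof.
elim: n xs ys => [|n IH] xs ys.
  by move=> /size0nil -> /size0nil -> _; rewrite /asm_partition /=
    schur_nil mulr1.
case: ys => [|y ys] // sx [sy] g.
have pY z : perm_eq (xs ++ z :: ys) (z :: xs ++ ys) by rewrite -cat1s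
  perm_catCA.
have gX : generic (y :: xs ++ ys) := generic_perm (pY y) g.
have gX' : generic (xs ++ ys) := generic_catr (s := [:: y]) gX.
have yX : y \notin xs ++ ys by case/andP: (generic_uniq gX).
have sX : size (xs ++ ys) = n.*2.+1 by rewrite size_cat sx sy addSn addnn.
have [p Pp pE] := @schur_polyfun 1 n _ sX (generic_uniq gX').
rewrite (schur_perm _ (pY y)) pE //.
have gx := generic_catl g.
move: (y); apply: (@polyfun_interp _ n _ _ [seq w * x | x <- xs]).
- by have := polyfun_asm_partition w xs ys; rewrite sx.
- by apply: polyfunZ; move: Pp; rewrite addnK.
- by have := uniq_nodes gx; rewrite cat_uniq => /and3P [].
- by rewrite size_map sx.
move=> _ /mapP [x xxs ->].
have px := perm_to_rem xxs; set r := rem x xs in px.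
have sr : size r = n by rewrite size_rem // sx.
have pX : perm_eq (xs ++ ys) (x :: r ++ ys) by rewrite -cat_cons perm_cat2r.
have g' := generic_perm pX gX'.
have /andP [n1 n2] := @generic_node x 1 _ isT g'; rewrite expr1 in n1 n2.
have x0 := generic_neq0 g' (mem_head _ _).
have uu := uniq_node g'.
rewrite -pE; last by rewrite (perm_mem pX) inE negb_or n1 n2.
rewrite (asm_partition_perm w_root _ px) // (asm_partition_node sr sy) //;
  last first.
  by apply: IH => //; exact: (generic_catr (s := [:: x]) g').
congr (_ * _); apply: schur_perm.
by rewrite -[x :: w * x :: _]/([:: x] ++ [:: w * x] ++ _) perm_catCA perm_cons
  perm_sym.
Qed.

(** Both sides have degree at most 2n - 1 in the first column parameter, and
    they agree at the 2n nodes w x_i and w^2 x_i. *)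
Theorem ht_partition_schur n xs ys : size xs = n -> size ys = n ->
  generic (xs ++ ys) ->
  Zht xs ys = norm_const n ^+ 2 * s1 (xs ++ ys) * s2 (xs ++ ys).
Proof.
elim: n xs ys => [|n IH] xs ys.
  move=> /size0nil -> /size0nil -> _; rewrite /ht_partition /= !schur_nil.
  rewrite (sum_tuple0 (fun b => grid_sum w [::] [::] [::] [::] [::]
    (b ++ rev (map negb b)))) /=.
  by rewrite expr1n !mulr1.
case: ys => [|y ys] // sx [sy] g.
have pY z : perm_eq (xs ++ z :: ys) (z :: xs ++ ys) by rewrite -cat1s
  perm_catCA.
have gX : generic (y :: xs ++ ys) := generic_perm (pY y) g.
have gX' : generic (xs ++ ys) := generic_catr (s := [:: y]) gX.
have yX : y \notin xs ++ ys by case/andP: (generic_uniq gX).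
have sX : size (xs ++ ys) = n.*2.+1 by rewrite size_cat sx sy addSn addnn.
have [p1 Pp1 pE1] := @schur_polyfun 1 n _ sX (generic_uniq gX').
have [p2 Pp2 pE2] := @schur_polyfun 2 n _ sX (generic_uniq gX').
rewrite !(schur_perm _ (pY y)) pE1 // pE2 //.
have gx := generic_catl g.
move: (y); apply: (@polyfun_interp _ n.*2.+1 _ _
    ([seq w * x | x <- xs] ++ [seq w ^+ 2 * x | x <- xs])).
- have := polyfun_ht_partition w xs ys; rewrite sx; congr polyfun; lia.
- have := polyfunM (polyfunZ (norm_const n.+1 ^+ 2) Pp1) Pp2; congr polyfun;
  lia.
- exact: uniq_nodes.
- by rewrite size_cat !size_map sx; lia.
move=> z; rewrite mem_cat => zs.
have [k kP [x xxs ->]] : exists2 k, (0 < k < 3)%N & exists2 x, x \in xs & z =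
  w ^+ k * x.
  by case/orP: zs => /mapP [x xxs ->]; [exists 1%N|exists 2%N] => //; exists x;
    rewrite ?expr1.
have px := perm_to_rem xxs; set r := rem x xs in px.
have sr : size r = n by rewrite size_rem // sx.
have pX : perm_eq (xs ++ ys) (x :: r ++ ys) by rewrite -cat_cons perm_cat2r.
have g' := generic_perm pX gX'.
have /andP [n1 n2] := @generic_node x k _ kP g'.
have x0 := generic_neq0 g' (mem_head _ _).
have nz : w ^+ k * x \notin xs ++ ys by rewrite (perm_mem pX) inE negb_or n1 n2.
rewrite -pE1 // -pE2 // (ht_partition_perm w_root _ px) //.
have IHr : Zht r ys = norm_const n ^+ 2 * s1 (r ++ ys) * s2 (r ++ ys).
  by apply: IH => //; exact: (generic_catr (s := [:: x]) g').
have pZ z' : perm_eq (x :: z' :: r ++ ys) (z' :: xs ++ ys).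
  by rewrite -[x :: z' :: _]/([:: x] ++ [:: z'] ++ _) perm_catCA perm_cons
    perm_sym.
case: k kP {zs} n1 n2 nz => [|[|[|//]]] // _ n1 n2 nz.
  rewrite expr1 (ht_partition_node1 sr sy) ?uniq_node //.
  by rewrite !(schur_perm _ (pZ (w * x))).
have E : x = w * (w ^+ 2 * x) by rewrite mulrA -exprS (w_cubed w_root) mul1r.
have pZ' : perm_eq (w ^+ 2 * x :: w * (w ^+ 2 * x) :: r ++ ys)
  (w ^+ 2 * x :: xs ++ ys).
  by rewrite -E perm_cons perm_sym.
rewrite {1}E (ht_partition_node2 sr sy) //;
  first by rewrite !(schur_perm _ pZ').
  by rewrite mulf_neq0 // expf_neq0 // (w_neq0 w_root).
rewrite -E; have := generic_uniq g'; rewrite /= inE negb_or n2 => /andP [-> ->].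
by rewrite n1.
Qed.

(** Both sides, divided by the first parameter, have degree at most 4n - 3 in
    it; they agree at w and w^2 times each of the 2n - 1 other parameters. *)
Theorem qt_partition_schur n s : size s = n.*2 -> generic s ->
  Zqt s = (\prod_(c <- s) c) * (norm_const n ^+ 4 * s1 s ^+ 3 * s2 s).
Proof.
elim: n s => [|n IH] s.
  move=> /size0nil -> _; rewrite /qt_partition /= !schur_nil big_nil.
  rewrite (sum_tuple0 (fun b => grid_sum w [::] [::] [::] b [::] (map negb b)))
    /=.
  by rewrite !expr1n !mulr1.
case: s => [|y [|c X']] //; set X := c :: X' => -[sX'] gX.
have sX : size X = n.*2.+1 by rewrite /= sX'.
have gX' : generic X := generic_catr (s := [:: y]) gX.
have yX : y \notin X by case/andP: (generic_uniq gX).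
have [p1 Pp1 pE1] := @schur_polyfun 1 n _ sX (generic_uniq gX').
have [p2 Pp2 pE2] := @schur_polyfun 2 n _ sX (generic_uniq gX').
have [q Pq qE] := polyfun_qt_partition w_root c X'; rewrite -/X in Pq qE.
rewrite qE big_cons -mulrA pE1 // pE2 //; congr (_ * _).
move: (y); apply: (@polyfun_interp _ (4 * n).+1 _ _
    ([seq w * x | x <- X] ++ [seq w ^+ 2 * x | x <- X])).
- by move: Pq; congr polyfun; rewrite sX sX'; lia.
- have P3 := polyfunM (polyfunM (polyfunM Pp1 Pp1) Pp1) Pp2.
  have := polyfunZ (\prod_(j <- X) j * norm_const n.+1 ^+ 4) P3.
  move=> P4; apply: polyfun_ext (polyfunW _ P4) => [x|]; first by ring.
  by lia.
- exact: uniq_nodes.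
- by rewrite size_cat !size_map sX; lia.
move=> z; rewrite mem_cat => zs.
have [k kP [x xxs ->]] : exists2 k, (0 < k < 3)%N & exists2 x, x \in X & z =
  w ^+ k * x.
  by case/orP: zs => /mapP [x xxs ->]; [exists 1%N|exists 2%N] => //; exists x;
    rewrite ?expr1.
have pX := perm_to_rem xxs; set r := rem x X in pX.
have sr : size r = n.*2 by rewrite size_rem // sX.
have g' := generic_perm pX gX'.
have /andP [n1 n2] := @generic_node x k _ kP g'.
have x0 := generic_neq0 g' (mem_head _ _).
have nz : w ^+ k * x \notin X by rewrite (perm_mem pX) inE negb_or n1 n2.
have wx0 : w ^+ k * x != 0 by rewrite mulf_neq0 // expf_neq0 // (w_neq0 w_root).
rewrite -pE1 // -pE2 //; apply: (mulfI wx0).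
rewrite -qE [RHS]mulrA (_ : w ^+ k * x * \prod_(j <- X) j =
  \prod_(j <- w ^+ k * x :: X) j); last by rewrite big_cons.
have IHr := IH r sr (generic_catr (s := [:: x]) g').
case: k kP {zs} n1 n2 nz wx0 => [|[|[|//]]] // _ n1 n2 nz wx0.
  rewrite expr1.
  have p : perm_eq (w * x :: X) (x :: w * x :: r).
    by rewrite perm_sym -[x :: w * x :: _]/([:: x] ++ [:: w * x] ++ _)
      perm_catCA perm_cons perm_sym.
  by rewrite (qt_partition_perm w_root p) (perm_big _ p) !(schur_perm _ p)
    (qt_partition_node sr) ?uniq_node.
have E : x = w * (w ^+ 2 * x) by rewrite mulrA -exprS (w_cubed w_root) mul1r.
have p : perm_eq (w ^+ 2 * x :: X) (w ^+ 2 * x :: w * (w ^+ 2 * x) :: r).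
  by rewrite -E perm_cons.
rewrite (qt_partition_perm w_root p) (perm_big _ p) !(schur_perm _ p)
  (qt_partition_node sr) //.
rewrite -E; have := generic_uniq g'; rewrite /= inE negb_or n2 => /andP [-> ->].
by rewrite n1.
Qed.

Theorem qt_partition_factorization n xs ys : size xs = n -> size ys = n ->
  generic (xs ++ ys) ->
  Zqt (xs ++ ys) = (\prod_(c <- xs ++ ys) c) * (Zasm xs ys ^+ 2 * Zht xs ys).
Proof.
move=> sx sy g; rewrite (asm_partition_schur sx sy g)
  (ht_partition_schur sx sy g) (@qt_partition_schur n) //.
  by congr (_ * _); ring.
by rewrite size_cat sx sy addnn.
Qed.

End Interpolation.

(** * Specialization of all parameters but one *)

Section Homogeneous.
Variables (F : numFieldType) (w : F).
Hypothesis w_root : w ^+ 2 = - 1 - w.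

Local Notation Zasm := (asm_partition w).
Local Notation Zht := (ht_partition w).
Local Notation Zqt := (qt_partition w).

(** Different positive integers have different cubes: enough generic points to
    reach every specialization by continuity of polynomials. *)
Lemma generic_nat (s : seq nat) : 0%N \notin s -> uniq s ->
  generic ([seq k%:R | k <- s] : seq F).
Proof.
move=> s0 us; apply/andP; split.
  apply: contra s0 => /mapP [k ks /eqP]; rewrite eq_sym pnatr_eq0.
  by move/eqP => k0; rewrite -k0.
rewrite -map_comp map_inj_in_uniq // => a b _ _ /eqP /=.
by rewrite -!natrX eqr_nat eqn_exp2r // => /eqP.
Qed.

(** The factorization is applied to the parameters m, 1 + s, 1 + 2s, ..., which
    are in general position for every natural number s >= m.  Both sides are
    polynomials in s, so they also agree at s = 0. *)
Lemma qt_partition_factorization_top n m : (0 < m)%N ->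
  Zqt (m%:R :: nseq n.*2.+1 1) =
  m%:R * (Zasm (m%:R :: nseq n 1) (nseq n.+1 1) ^+ 2 *
          Zht (m%:R :: nseq n 1) (nseq n.+1 1)).
Proof.
move=> m0.

pose L a k : seq {poly F} := [seq 1 + j%:R *: 'X | j <- iota a k].
pose xs := m%:R%:P :: L 1 n; pose ys := L n.+1 n.+1.
have L0 a k : [seq p.[0] | p : {poly F} <- L a k] = nseq k 1.
  rewrite /L -map_comp; elim: k a => //= k IH a; rewrite IH.
  by rewrite !hornerE ?mulr0 ?addr0.
have ->: m%:R :: nseq n 1 = [seq p.[0] | p : {poly F} <- xs].
  by rewrite /= L0 hornerC.
have ->: nseq n.+1 1 = [seq p.[0] | p : {poly F} <- ys] by rewrite L0.
have ->: m%:R :: nseq n.*2.+1 1 = [seq p.[0] | p : {poly F} <- xs ++ ys].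
  by rewrite /xs /ys cat_cons map_cons map_cat !L0 hornerC -nseqD addnS addnn.
have PM : polyfun_some (fun s : F => m%:R : F) by exists 0; apply: polyfun_cst.
pose P s := \prod_(p <- L 1 n ++ ys) p.[s].
have PP : polyfun_some P.
  rewrite /P; elim: (_ ++ _) => [|p s [d IH]].
    by exists 0; apply: polyfun_ext (polyfun_cst _ 1) => x; rewrite big_nil.
  exists (size p + d)%N; apply: polyfun_ext
    (polyfunM (_ : polyfun (size p) (horner p)) IH) => [x|].
    by rewrite big_cons.
  by exists p.
have P0 : P 0 = 1.
  rewrite /P -(big_map (fun p : {poly F} => p.[0]) predT id) map_cat !L0.
  by rewrite -nseqD big_nseq; elim: (_ + _)%N => //= k ->; rewrite mul1r.
rewrite -[X in X * _](_ : m%:R * P 0 = _); last by rewrite P0 mulr1.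
have P1 := polyfun_some_qt_partition w (xs ++ ys).
have PA := polyfun_some_asm_partition w xs ys.
have P2 := polyfun_anyM (polyfun_anyM PM PP)
  (polyfun_anyM (polyfun_anyM PA PA) (polyfun_some_ht_partition w xs ys)).
rewrite expr2; apply: (polyfun_some_cancel (N := m) (oner_neq0 _) P1 P2 _ 0) =>
  s ms.
apply/eqP; rewrite hornerC mul1r subr_eq0; apply/eqP => {P1 P2 PP PA PM}.
rewrite map_cat.
pose N a k := [seq (1 + j * s)%N | j <- iota a k].
have LE a k : [seq p.[s%:R] | p : {poly F} <- L a k] = [seq j%:R | j <- N a k].
  rewrite /L /N -!map_comp; apply: eq_map => j /=.
  by rewrite !hornerE natrD natrM.
have E : [seq p.[s%:R] | p : {poly F} <- xs ++ ys] =
  [seq j%:R | j <- m :: N 1%N n ++ N n.+1 n.+1].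
  by rewrite /xs /ys cat_cons !map_cons !map_cat !LE hornerC.
have g : generic [seq p.[s%:R] | p : {poly F} <- xs ++ ys].
  have s0 : (0 < s)%N by apply: leq_trans ms.
  rewrite E; apply: generic_nat.
    rewrite inE negb_or eq_sym -lt0n m0 /N -map_cat /=.
    by apply/mapP => -[j _].
  rewrite /= /N -map_cat (_ : iota 1 n ++ iota n.+1 n.+1 = iota 1 (n + n.+1));
    last by rewrite iotaD add1n.
  rewrite map_inj_uniq ?iota_uniq ?andbT.
    apply/mapP => -[j]; rewrite mem_iota => /andP [j1 _] mE.
    have : (m < 1 + j * s)%N by rewrite add1n ltnS (leq_trans ms) // leq_pmull.
    by rewrite -mE ltnn.
  by move=> a b /addnI /eqP; rewrite eqn_pmul2r // => /eqP.
rewrite map_cat in g.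
rewrite (qt_partition_factorization w_root (n := n.+1) _ _ g) ?size_map
  ?size_iota //; last first.
  by rewrite /= !size_map size_iota.
rewrite expr2; congr (_ * _).
by rewrite -map_cat big_map /P big_cons hornerC.
Qed.

End Homogeneous.

(** * Alternation and partial sums *)

Definition zero_or_one (z : int) := (z == 0) || (z == 1).

Definition entry0 : asm_entry := SeqSub (isT : 0 \in [:: 1; -1; 0 : int]).
Definition entry1 : asm_entry := SeqSub (isT : 1 \in [:: 1; -1; 0 : int]).
Definition entryN1 : asm_entry := SeqSub (isT : -1 \in [:: 1; -1; 0 : int]).

(** Entries are indexed by natural numbers, with default value 0, so that
    reflected and shifted indices are plain arithmetic. *)
Definition entry_at m p (B : 'M[asm_entry]_(m, p)) (i j : nat) : asm_entry :=
  if insub i is Some i' then if insub j is Some j' then B i' j' else entry0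
  else entry0.

Definition int_entry_at m p (B : 'M[asm_entry]_(m, p)) i j : int :=
  ssval (entry_at B i j).

Definition partial_sum (u : nat -> int) k := \sum_(i < k) u i.

Lemma partial_sum0 u : partial_sum u 0 = 0. Proof.
  by rewrite /partial_sum big_ord0. Qed.
Lemma partial_sumS u k : partial_sum u k.+1 = partial_sum u k + u k.
Proof. by rewrite /partial_sum big_ord_recr. Qed.

Lemma eq_partial_sum u v k : (forall i, (i < k)%N -> u i = v i) ->
  partial_sum u k = partial_sum v k.
Proof. by move=> uv; apply: eq_bigr => i _; apply: uv. Qed.

Lemma partial_sum_zero u k j : (j <= k)%N ->
  (forall i, (j <= i < k)%N -> u i = 0) ->
  partial_sum u k = partial_sum u j.
Proof.
elim: k => [|k IH]; first by rewrite leqn0 => /eqP ->.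
rewrite leq_eqVlt => /orP [/eqP -> //|jk] u0.
rewrite partial_sumS (u0 k) ?addr0; last by rewrite -ltnS jk /=.
by apply: IH => // i /andP [ji ik]; apply: u0; rewrite ji ltnW.
Qed.

Lemma partial_sum_rev u m k : (k <= m)%N ->
  partial_sum (fun i => u (m.-1 - i)%N) k =
    partial_sum u m - partial_sum u (m - k)%N.
Proof.
elim: k => [|k IH] km; first by rewrite partial_sum0 subn0 subrr.
rewrite partial_sumS IH; last exact: ltnW.
have -> : (m - k = (m - k.+1).+1)%N by lia.
have -> : (m.-1 - k = m - k.+1)%N by lia.
by rewrite partial_sumS; ring.
Qed.

Definition alternating m (u : nat -> int) :=
  forall j k, (j < k < m)%N -> u j != 0 -> u k != 0 ->
    (forall l, (j < l < k)%N -> u l = 0) -> u k = - u j.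

Definition is_entry (z : int) := z \in [:: 1; -1; 0 : int].

Lemma zero_or_one_alternating m u : (forall i, is_entry (u i)) ->
  (forall k, (k <= m)%N -> zero_or_one (partial_sum u k)) -> alternating m u.
Proof.
move=> tu z j k /andP [jk km] uj uk u0.
have := z _ (ltnW (ltn_trans jk km)); have := z _ (ltn_trans jk km).
have Sk : partial_sum u k = partial_sum u j.+1 by apply: partial_sum_zero.
have := z _ km; rewrite !partial_sumS Sk partial_sumS.
move: (tu j) (tu k) uj uk; rewrite /is_entry /zero_or_one !inE.
move: (partial_sum u j) (u j) (u k) => a b c.
by move=> /or3P [] /eqP -> /or3P [] /eqP -> // _ _; case/orP => /eqP; lia.
Qed.

(** The partial sums of an alternating sequence are 0 or its first nonzero
    value f; since the last one is 1, f must be 1. *)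
Lemma alternating_zero_or_one m u : (forall i, is_entry (u i)) ->
  alternating m u ->
  partial_sum u m = 1 -> forall k, (k <= m)%N -> zero_or_one (partial_sum u k).
Proof.
move=> tu alt tot.
(* f is the sign of the first nonzero value, j the place of the last one. *)
have inv k : (k <= m)%N -> (forall i, (i < k)%N -> u i = 0) \/
   exists f j, [/\ (j < k)%N, f \in [:: 1; -1 : int],
     (forall i, (j < i < k)%N -> u i = 0),
     (u j == f) && (partial_sum u k == f) || (u j == - f) &&
       (partial_sum u k == 0) &
     forall i, (i <= k)%N -> partial_sum u i \in [:: 0; f]].
  elim: k => [|k IH] km; first by left.
  have [u0|[f [j [jk ff uz fS fz]]]] := IH (ltnW km).
    have S0 i : (i <= k)%N -> partial_sum u i = 0.
      by move=> ik; rewrite (@partial_sum_zero u i 0) ?partial_sum0 // => l li;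
        apply: u0; lia.
    have [uk|uk] := eqVneq (u k) 0.
      by left => i; rewrite ltnS leq_eqVlt => /orP [/eqP ->|/u0].
    right; exists (u k), k; rewrite ltnSn; split=> //.
    - by move: (tu k) uk; rewrite /is_entry !inE => /or3P [] /eqP ->.
    - by move=> i; lia.
    - by rewrite partial_sumS S0 // add0r !eqxx.
    - move=> i; rewrite leq_eqVlt => /orP [/eqP ->|]; rewrite ?ltnS.
        by rewrite partial_sumS S0 // add0r !inE eqxx orbT.
      by move=> /S0 ->; rewrite !inE eqxx.
  right; have [uk|uk] := eqVneq (u k) 0.
    exists f, j; split=> //.
    - exact: ltnW.
    - move=> i /andP [ji]; rewrite ltnS leq_eqVlt => /orP [/eqP -> //|ik].
      by apply: uz; rewrite ji.
    - by rewrite partial_sumS uk addr0.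
    - move=> i; rewrite leq_eqVlt => /orP [/eqP ->|]; rewrite ?ltnS; last exact:
      fz.
      by rewrite partial_sumS uk addr0; apply: fz.
  have uj : u j != 0.
    by move: fS ff; rewrite !inE => /orP [] /andP [/eqP -> _] /orP [] /eqP ->.
  have ukj : u k = - u j by apply: alt => //; rewrite jk.
  have fS' : (u k == f) && (partial_sum u k.+1 == f) || (u k == - f) &&
    (partial_sum u k.+1 == 0).
    rewrite partial_sumS ukj.
    case/orP: fS => /andP [/eqP -> /eqP ->]; first by rewrite subrr !eqxx orbT.
    by rewrite opprK add0r !eqxx.
  exists f, k; split=> //; first by move=> i; lia.
  move=> i; rewrite leq_eqVlt => /orP [/eqP ->|]; rewrite ?ltnS; last exact: fz.
  by case/orP: fS' => /andP [_ /eqP ->]; rewrite !inE eqxx ?orbT.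
have [u0|[f [j [_ ff _ _ fz]]]] := inv m (leqnn m).
  by move: tot; rewrite (@partial_sum_zero u m 0) ?partial_sum0.
move=> k /fz; have := fz m (leqnn m); rewrite tot /zero_or_one !inE.
by move: ff; rewrite !inE => /orP [] /eqP ->.
Qed.

Definition bint (b : bool) : int := (b : nat)%:Z.

Lemma zero_or_one_bint z : zero_or_one z -> z = bint (z == 1).
Proof. by case/orP => /eqP ->. Qed.

Lemma zero_or_one_bintP b : zero_or_one (bint b). Proof. by case: b. Qed.

Lemma partial_sum_ge0 (u : nat -> int) p :
  (forall j, (j < p)%N -> zero_or_one (u j)) -> 0 <= partial_sum u p.
Proof. by move=> z; apply: sumr_ge0 => j _; case/orP: (z j (ltn_ord j)) =>
  /eqP ->. Qed.

Lemma partial_sum_eq0 (u : nat -> int) p :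
  (forall j, (j < p)%N -> zero_or_one (u j)) -> partial_sum u p = 0 ->
  forall j, (j < p)%N -> u j = 0.
Proof.
elim: p => // p IH z; rewrite partial_sumS => s j.
have zz i (ip : (i < p)%N) := z i (ltnW ip).
have s0 := partial_sum_ge0 zz.
have [sp up] : partial_sum u p = 0 /\ u p = 0 by move: s; case/orP:
  (z p (ltnSn p)) => /eqP ->; lia.
by rewrite ltnS leq_eqVlt => /orP [/eqP -> //|]; apply: IH.
Qed.

Lemma unit_vector (u : nat -> int) p : (forall j, (j < p)%N ->
  zero_or_one (u j)) -> partial_sum u p = 1 ->
  exists2 k, (k < p)%N & forall j, (j < p)%N -> u j = bint (j == k).
Proof.
elim: p => [|p IH] z; first by rewrite partial_sum0.
have zz i (ip : (i < p)%N) := z i (ltnW ip).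
rewrite partial_sumS => s; case/orP: (z p (ltnSn p)) => /eqP up.
  move: s; rewrite up addr0 => /(IH zz) [k kp kE]; exists k; first exact: ltnW.
  move=> j; rewrite ltnS leq_eqVlt => /orP [/eqP ->|/kE //].
  by rewrite up; case: eqP kp => // ->; rewrite ltnn.
have s0 : partial_sum u p = 0 by move: s; rewrite up; lia.
exists p => // j; rewrite ltnS leq_eqVlt => /orP [/eqP ->|jp];
  first by rewrite up eqxx.
by rewrite (partial_sum_eq0 zz s0 jp) ltn_eqF.
Qed.

Lemma partial_sum_unit u p k j : (forall j, (j < p)%N -> u j = bint (j == k)) ->
  (j <= p)%N ->
  partial_sum u j = bint (k < j)%N.
Proof.
move=> uE; elim: j => [|j IH] jp; first by rewrite partial_sum0.
rewrite partial_sumS IH ?uE //; last exact: ltnW.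
by rewrite ltnS; case: (ltngtP j k).
Qed.

Section Entries.
Variables (m p : nat).
Implicit Type B : 'M[asm_entry]_(m, p).

Lemma entry_atE B (i : 'I_m) (j : 'I_p) : entry_at B i j = B i j.
Proof. by rewrite /entry_at !valK. Qed.

Lemma int_entry_atE B (i : 'I_m) (j : 'I_p) : int_entry_at B i j =
  ssval (B i j).
Proof. by rewrite /int_entry_at entry_atE. Qed.

Lemma int_entry_atP B i j : is_entry (int_entry_at B i j).
Proof. exact: ssvalP. Qed.

Lemma entry_at_out_row B i j : (m <= i)%N -> entry_at B i j = entry0.
Proof. by move=> mi; rewrite /entry_at insubF // ltnNge mi. Qed.

Lemma entry_at_out_col B i j : (p <= j)%N -> entry_at B i j = entry0.
Proof. by move=> mi; rewrite /entry_at; case: insub => // i';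
  rewrite insubF // ltnNge mi. Qed.

Lemma entry_at_inj B B' : (forall i j, (i < m)%N -> (j < p)%N ->
  entry_at B i j = entry_at B' i j) -> B = B'.
Proof. by move=> E; apply/matrixP => i j; rewrite -!entry_atE E. Qed.

Lemma entry_at_mx (f : nat -> nat -> asm_entry) i j : (i < m)%N -> (j < p)%N ->
  entry_at (\matrix_(i < m, j < p) f i j) i j = f i j.
Proof. by move=> im jp; rewrite /entry_at !insubT /= mxE. Qed.

Definition rowsum B i j := partial_sum (int_entry_at B i) j.
Definition colsum B i j := partial_sum (int_entry_at B ^~ j) i.

(** The matrices that are states of the six-vertex model with empty left and
    top boundaries. *)
Definition admissible B : bool :=
  [forall i : 'I_m, forall j : 'I_p.+1, zero_or_one (rowsum B i j)] &&
  [forall i : 'I_m.+1, forall j : 'I_p, zero_or_one (colsum B i j)].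

Lemma admissibleP B : reflect ((forall i j, (i < m)%N -> (j <= p)%N ->
  zero_or_one (rowsum B i j)) /\
                        (forall i j, (i <= m)%N -> (j < p)%N ->
                          zero_or_one (colsum B i j))) (admissible B).
Proof.
apply: (iffP andP) => [[/forallP h /forallP v]|[h v]]; split.
- by move=> i j im jp; have /forallP /(_ (Ordinal (jp : j < p.+1)%N)) :=
  h (Ordinal im).
- by move=> i j im jp; have /forallP /(_ (Ordinal jp)) :=
  v (Ordinal (im : i < m.+1)%N).
- by apply/forallP => i; apply/forallP => j; apply: h => //; rewrite -ltnS.
- by apply/forallP => i; apply/forallP => j; apply: v => //; rewrite -ltnS.
Qed.

End Entries.

Lemma rows_alternateP m (B : 'M[int]_m) (u : nat -> nat -> int) :
  (forall i j : 'I_m, B i j = u i j) ->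
  reflect (forall i, (i < m)%N -> alternating m (u i)) (rows_alternate B).
Proof.
move=> BE; apply: (iffP forallP) => [H i im j k /andP [jk km] uj uk u0|H i].
  have := H (Ordinal im) => /forallP /(_ (Ordinal (ltn_trans jk km))) /forallP
    /(_ (Ordinal km)).
  rewrite !BE /= jk uj uk /= => /implyP/(_ _)/eqP; apply.
  by apply/forallP => l; apply/implyP => /u0 ul; rewrite BE ul.
apply/forallP => j; apply/forallP => k; apply/implyP =>
  /and4P [jk uj uk /forallP u0].
rewrite !BE in uj uk *; apply/eqP; apply: (H i _ j k) => //;
  first by rewrite jk /=.
move=> l /andP [jl lk]; have := u0 (Ordinal (ltn_trans lk (ltn_ord k))).
by rewrite BE /= jl lk => /eqP.
Qed.

(** This replaces the condition on signs by the local condition of the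
    six-vertex model. *)
Lemma is_asmP m (A : 'M[asm_entry]_m) :
  reflect [/\ admissible A, forall i, (i < m)%N -> rowsum A i m = 1 &
              forall j, (j < m)%N -> colsum A m j = 1] (is_asm A).
Proof.
have BE (i j : 'I_m) : int_mx A i j = int_entry_at A i j by rewrite mxE
  int_entry_atE.
have BTE (i j : 'I_m) : (int_mx A)^T i j = int_entry_at A j i by rewrite mxE BE.
have s1 : reflect (forall i, (i < m)%N -> rowsum A i m = 1)
  (rows_sum1 (int_mx A)).
  apply: (iffP forallP) => [H i im|H i].
    have /eqP <- := H (Ordinal im); apply: eq_bigr => j _.
    by rewrite BE.
  by rewrite -(H i) //; apply/eqP; apply: eq_bigr => j _; rewrite BE.
have s2 : reflect (forall j, (j < m)%N -> colsum A m j = 1)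
  (rows_sum1 (int_mx A)^T).
  apply: (iffP forallP) => [H i im|H i].
    have /eqP <- := H (Ordinal im); apply: eq_bigr => j _.
    by rewrite BTE.
  by rewrite -(H i) //; apply/eqP; apply: eq_bigr => j _; rewrite BTE.
apply: (iffP and4P) => [[/s1 r1 /s2 c1]|[/admissibleP [h v] r1 c1]].
  move=> /(rows_alternateP BE) a1 /(@rows_alternateP _ _
    (fun i j => int_entry_at A j i) BTE) a2; split=> //.
  apply/admissibleP; split=> [i j im jm|i j im jm].
    by apply: alternating_zero_or_one jm;
      [exact: int_entry_atP|exact: a1|exact: r1].
  apply: alternating_zero_or_one im => [k||];
    [exact: int_entry_atP|exact: a2|exact: c1].
split; [exact/s1|exact/s2| |].
  apply/(rows_alternateP BE) => i im; apply: zero_or_one_alternating =>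
    [j|k km]; first exact: int_entry_atP.
  exact: h.
apply/(@rows_alternateP _ _ (fun i j => int_entry_at A j i) BTE) => j jm.
by apply: zero_or_one_alternating => [i|k km]; [exact: int_entry_atP|exact: v].
Qed.

(** * Partition functions as sums over matrices *)

Section StateSum.
Variables (F : numFieldType) (w : F).

Local Notation rw := (row_weight w).
Local Notation gz := (grid_sum w).
Local Notation vw := (vertex_weight w).

Definition row_state (l : bool) (t b : seq bool) (j : nat) : bool :=
  l (+) \big[addb/false]_(k < j) (nth false t k (+) nth false b k).

Lemma row_state0 l t b : row_state l t b 0 = l.
Proof. by rewrite /row_state big_ord0 addbF. Qed.

Lemma row_stateS l t b j : row_state l t b j.+1 =
  row_state l t b j (+) nth false t j (+) nth false b j.
Proof. by rewrite /row_state big_ord_recr /= !addbA. Qed.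

Lemma row_state_cons l t0 t b0 b j :
  row_state l (t0 :: t) (b0 :: b) j.+1 = row_state (l (+) t0 (+) b0) t b j.
Proof. by rewrite /row_state big_ord_recl /= !addbA. Qed.

Lemma row_weight_prod x cs l t b r : size t = size cs -> size b = size cs ->
  rw x cs l t b r = (row_state l t b (size cs) == r)%:R *
    \prod_(j < size cs) vw x cs`_j (row_state l t b j) (nth false t j)
      (nth false b j).
Proof.
elim: cs l t b => [|c cs IH] l [|t0 t] [|b0 b] //=.
  by rewrite big_ord0 mulr1 row_state0.
case=> st [sb]; rewrite IH // row_state_cons big_ord_recl row_state0 /= mulrCA;
  congr (_ * (_ * _)).
by apply: eq_bigr => j _; rewrite row_state_cons.
Qed.

Definition column_state p (t : seq bool) (V : seq (p.-tuple bool)) i :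
  seq bool :=
  nth [::] (t :: map val V) i.

(** A state is determined by the bits on its vertical edges. *)
Lemma grid_sum_chain cs xs ls rs t b : size ls = size xs -> size rs = size xs ->
  gz cs xs ls rs t b =
  \sum_(V : (size xs).-tuple ((size cs).-tuple bool))
    (column_state t V (size xs) == b)%:R *
    \prod_(i < size xs) rw xs`_i cs (nth false ls i) (column_state t V i)
      (column_state t V i.+1) (nth false rs i).
Proof.
elim: xs ls rs t => [|x xs IH] [|l ls] [|r rs] //= t.
  move=> _ _; rewrite (sum_tuple0 (fun V : seq ((size cs).-tuple bool) =>
    (column_state t V 0 == b)%:R *
      \prod_(i < 0) rw [::]`_i cs (nth false [::] i) (column_state t V i)
        (column_state t V i.+1) (nth false [::] i))).
  by rewrite big_ord0 mulr1.
case=> sl [sr].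
pose f (V : seq ((size cs).-tuple bool)) :=
  (column_state t V (size xs).+1 == b)%:R *
    \prod_(i < (size xs).+1) rw (x :: xs)`_i cs (nth false (l :: ls) i)
      (column_state t V i) (column_state t V i.+1) (nth false (r :: rs) i).
rewrite (sum_tuple_cons _ f); apply: eq_bigr => m _.
rewrite (IH _ _ _ sl sr) mulr_sumr; apply: eq_bigr => V _.
by rewrite /f big_ord_recl /= mulrCA.
Qed.

End StateSum.

Definition compatible (l t b : bool) := (t == b) || (l == t).

(** Along a row the horizontal bits are computed modulo 2; they are the actual
    partial sums as soon as every vertex is one of the six allowed ones. *)
Lemma horizontal_sum_compatible (h t b : nat -> bool) n : h 0%N = false ->
  (forall j, h j.+1 = h j (+) t j (+) b j) ->
  (forall j, (j < n)%N -> compatible (h j) (t j) (b j)) ->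
  forall j, (j <= n)%N -> partial_sum (fun k => bint (b k) - bint (t k)) j =
    bint (h j).
Proof.
move=> h0 hS c; elim=> [|j IH] jn; first by rewrite partial_sum0 h0.
rewrite partial_sumS IH ?hS; last exact: ltnW.
by have := c _ jn; case: (h j); case: (t j); case: (b j).
Qed.

Lemma horizontal_sum_zero_or_one (h t b : nat -> bool) n : h 0%N = false ->
  (forall j, h j.+1 = h j (+) t j (+) b j) ->
  (forall j, (j <= n)%N -> zero_or_one (partial_sum
    (fun k => bint (b k) - bint (t k)) j)) ->
  forall j, (j <= n)%N -> partial_sum (fun k => bint (b k) - bint (t k)) j =
    bint (h j).
Proof.
move=> h0 hS c; elim=> [|j IH] jn; first by rewrite partial_sum0 h0.
have := c _ jn; rewrite partial_sumS IH ?hS; last exact: ltnW.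
by case: (h j); case: (t j); case: (b j).
Qed.

Section MatrixSum.
Variables (F : numFieldType) (w : F).

Local Notation rw := (row_weight w).
Local Notation vw := (vertex_weight w).

Variables (m p : nat).
Implicit Type B : 'M[asm_entry]_(m, p).

Definition rowtot B : seq bool := mkseq (fun i => rowsum B i p == 1) m.
Definition coltot B : seq bool := mkseq (fun j => colsum B m j == 1) p.

Definition state_weight (xs cs : seq F) B : F :=
  \prod_(i < m) \prod_(j < p)
    vw xs`_i cs`_j (rowsum B i j == 1) (colsum B i j == 1)
      (colsum B i.+1 j == 1).

Definition entry_of_bits (t b : bool) : asm_entry :=
  if t == b then entry0 else if b then entry1 else entryN1.

Lemma entry_of_bitsE t b : ssval (entry_of_bits t b) = bint b - bint t.
Proof. by case: t; case: b. Qed.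

Definition bits_of B : m.-tuple (p.-tuple bool) :=
  [tuple [tuple colsum B i.+1 j == 1 | j < p] | i < m].

Definition mx_of_bits (V : m.-tuple (p.-tuple bool)) : 'M[asm_entry]_(m, p) :=
  \matrix_(i < m, j < p)
    entry_of_bits (nth false (column_state (zeros p) V i) j)
      (nth false (column_state (zeros p) V i.+1) j).

Lemma column_stateS t (V : m.-tuple (p.-tuple bool)) (i : 'I_m) :
  column_state t V i.+1 = tnth V i.
Proof. by rewrite /column_state /= (nth_map (tnth_default V i)) ?size_tuple
  // -tnth_nth. Qed.

Lemma size_column_state (V : m.-tuple (p.-tuple bool)) i : (i <= m)%N ->
  size (column_state (zeros p) V i) = p.
Proof.
case: i => [|i] im; first by rewrite /column_state /= size_nseq.
by rewrite (column_stateS _ V (Ordinal im)) size_tuple.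
Qed.

Lemma entry_at_mx_of_bits V i j : (i < m)%N -> (j < p)%N ->
  entry_at (mx_of_bits V) i j =
  entry_of_bits (nth false (column_state (zeros p) V i) j)
    (nth false (column_state (zeros p) V i.+1) j).
Proof.
exact: (entry_at_mx (fun i j => entry_of_bits
  (nth false (column_state (zeros p) V i) j)
  (nth false (column_state (zeros p) V i.+1) j))).
Qed.

Lemma colsum_mx_of_bits V i j : (i <= m)%N -> (j < p)%N ->
  colsum (mx_of_bits V) i j = bint (nth false (column_state (zeros p) V i) j).
Proof.
move=> im jp; elim: i im => [|i IH] im.
  by rewrite /colsum partial_sum0 /column_state /= nth_nseq if_same.
rewrite /colsum partial_sumS -/(colsum _ _ _) IH; last exact: ltnW.
by rewrite /int_entry_at entry_at_mx_of_bits // entry_of_bitsE addrC subrK.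
Qed.

Lemma bits_ofK V : bits_of (mx_of_bits V) = V.
Proof.
apply: eq_from_tnth => i; apply: eq_from_tnth => j.
by rewrite !tnth_mktuple colsum_mx_of_bits // column_stateS -tnth_nth; case:
  (tnth _ j).
Qed.

Definition col_ok B := [forall i : 'I_m.+1, forall j : 'I_p,
  zero_or_one (colsum B i j)].

Lemma col_okP B : reflect (forall i j, (i <= m)%N -> (j < p)%N ->
  zero_or_one (colsum B i j)) (col_ok B).
Proof.
apply: (iffP forallP) => [v i j im jp|v i].
  by have /forallP /(_ (Ordinal jp)) := v (Ordinal (im : i < m.+1)%N).
by apply/forallP => j; apply: v => //; rewrite -ltnS.
Qed.

Lemma column_state_bits_of B i j : (i <= m)%N -> (j < p)%N ->
  nth false (column_state (zeros p) (bits_of B) i) j = (colsum B i j == 1).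
Proof.
case: i => [|i] im jp; first by rewrite /column_state /=
  nth_nseq if_same /colsum partial_sum0.
rewrite (column_stateS _ _ (Ordinal im)) tnth_mktuple.
by rewrite -(tnth_nth _ _ (Ordinal jp)) tnth_mktuple.
Qed.

(** Matrices correspond to arrays of vertical bits exactly when all partial sums
    of columns are 0 or 1; the rows are dealt with by the vanishing of the
    weights, see [row_weight_incompatible]. *)
Lemma mx_of_bitsK B : (mx_of_bits (bits_of B) == B) = col_ok B.
Proof.
apply/eqP/col_okP => [<- i j im jp|v].
  by rewrite colsum_mx_of_bits // zero_or_one_bintP.
apply: entry_at_inj => i j im jp; rewrite entry_at_mx_of_bits //
  !column_state_bits_of //; last exact: ltnW.
apply: val_inj; rewrite /= entry_of_bitsE -!zero_or_one_bint ?v //; last exact: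
  ltnW.
by rewrite /colsum partial_sumS addrC addKr.
Qed.

Lemma vertex_weight_incompatible x y l t b : ~~ compatible l t b ->
  vw x y l t b = 0.
Proof. by case: l; case: t; case: b. Qed.

Section Row.
Variables (B : 'M[asm_entry]_(m, p)) (i : nat).
Hypotheses (B_ok : col_ok B) (im : (i < m)%N).
Let t := column_state (zeros p) (bits_of B) i.
Let b := column_state (zeros p) (bits_of B) i.+1.

Lemma rowsum_bits j : (j <= p)%N -> rowsum B i j =
  partial_sum (fun k => bint (nth false b k) - bint (nth false t k)) j.
Proof.
move=> jp; apply: eq_partial_sum => k kj; have kp := leq_trans kj jp.
have v := elimT (col_okP B) B_ok.
rewrite /t /b !column_state_bits_of //; last exact: ltnW.
rewrite -!zero_or_one_bint ?v //; last exact: ltnW.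
by rewrite /colsum partial_sumS addrC addKr.
Qed.

Lemma row_state_rowsum j : (forall j, (j <= p)%N -> zero_or_one (rowsum B i j))
  -> (j <= p)%N ->
  row_state false t b j = (rowsum B i j == 1).
Proof.
move=> z jp; rewrite rowsum_bits //.
rewrite (@horizontal_sum_zero_or_one (row_state false t b) _ _ p
  (row_state0 _ _ _) (row_stateS _ _ _)) //.
  by case: row_state.
by move=> k kp; rewrite -rowsum_bits ?z.
Qed.

Lemma row_weight_incompatible x cs r : size cs = p ->
  ~~ [forall j : 'I_p.+1, zero_or_one (rowsum B i j)] -> rw x cs false t b r =
    0.
Proof.
move=> sc /forallPn [j0 nz].
rewrite row_weight_prod ?size_column_state ?sc //; last exact: ltnW.
suff [k nk] : exists k : 'I_p, ~~ compatible (row_state false t b k)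
  (nth false t k) (nth false b k).
  by rewrite (bigD1 k) //= vertex_weight_incompatible // mul0r mulr0.
apply/existsP; apply: contraR nz => /existsPn c.
have j0p : (j0 <= p)%N by rewrite -ltnS.
rewrite rowsum_bits // (@horizontal_sum_compatible (row_state false t b) _ _ p
  (row_state0 _ _ _) (row_stateS _ _ _)) ?zero_or_one_bintP //.
by move=> k kp; have := c (Ordinal kp); rewrite negbK.
Qed.

End Row.

End MatrixSum.

Lemma eq_seq_nth (s s' : seq bool) n : size s = n -> size s' = n ->
  (forall j, (j < n)%N -> nth false s j = nth false s' j) -> s = s'.
Proof. by move=> sn sn' E; apply: (@eq_from_nth _ false) => [|j];
  rewrite ?sn ?sn' // => /E. Qed.

(** The partition functions are sums over matrices, with weights read off from
    the partial sums. *)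
Lemma grid_sum_matrix (F : numFieldType) (w : F) m p cs xs rs b :
  size xs = m -> size cs = p -> size rs = m -> size b = p ->
  grid_sum w cs xs (nseq m false) rs (nseq p false) b =
  \sum_(B : 'M[asm_entry]_(m, p) | admissible B)
     ((rowtot B == rs) && (coltot B == b))%:R * state_weight w xs cs B.
Proof.
move=> sx sc; case: m / sx; case: p / sc => sr sb.
rewrite grid_sum_chain ?size_nseq //.
rewrite (reindex_onto (@bits_of _ _) (@mx_of_bits _ _)) /=; last by move=> V _;
  exact: bits_ofK.
rewrite big_mkcond [RHS]big_mkcond; apply: eq_bigr => B _.
rewrite mx_of_bitsK; have [ok|nok] := boolP (col_ok B); last by case:
  admissibleP => // -[_ /col_okP]; rewrite (negbTE nok).
set m := size xs; set p := size cs.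
have [a|na] := boolP (admissible B); last first.
  have [i ni] : exists i : 'I_m, ~~ [forall j : 'I_p.+1,
    zero_or_one (rowsum B i j)].
    apply/existsP; apply: contraR na => /existsPn h; apply/andP; split=> //.
    by apply/forallP => i; have := h i; rewrite negbK.
  by rewrite (bigD1 i) //= nth_nseq if_same row_weight_incompatible // mul0r
    mulr0.
have [h v] := elimT (admissibleP B) a.
have E (i : 'I_m) : row_weight w xs`_i cs (nth false (nseq m false) i)
  (column_state (nseq p false) (bits_of B) i)
    (column_state (nseq p false) (bits_of B) i.+1) (nth false rs i) =
  ((nth false (rowtot B) i == nth false rs i))%:R *
  \prod_(j < p) vertex_weight w xs`_i cs`_j (rowsum B i j == 1)
    (colsum B i j == 1) (colsum B i.+1 j == 1).
  rewrite nth_nseq if_same row_weight_prod ?size_column_state //; last exact: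
    ltnW.
  rewrite nth_mkseq // -/p row_state_rowsum // => [|j jp]; last exact: h.
  congr (_ * _); apply: eq_bigr => j _.
  rewrite row_state_rowsum //; first by rewrite !column_state_bits_of //; apply:
    ltnW.
    by move=> k kp; apply: h.
  exact: ltnW.
under eq_bigr => i _ do rewrite E.
rewrite big_split /= mulrA; congr (_ * _).
have -> : (column_state (nseq p false) (bits_of B) m == b) = (coltot B == b).
  suff -> : column_state (nseq p false) (bits_of B) m = coltot B by [].
  apply: (@eq_seq_nth _ _ p); rewrite ?size_column_state ?size_mkseq // => j jp.
  by rewrite column_state_bits_of // nth_mkseq.
have -> : \prod_(i < m) (nth false (rowtot B) i == nth false rs i)%:R =
  (rowtot B == rs)%:R :> F.
  have [->|ne] := eqVneq (rowtot B) rs; first by rewrite big1 // => i _;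
    rewrite eqxx.
  have [i ni] : exists i : 'I_m, nth false (rowtot B) i != nth false rs i.
    apply/existsP; apply: contraR ne => /existsPn H;
      apply/eqP/(@eq_seq_nth _ _ m); rewrite ?size_mkseq //.
    by move=> j jm; have := H (Ordinal jm); rewrite negbK => /eqP.
  by rewrite (bigD1 i) //= (negbTE ni) mul0r.
by rewrite -natrM mulnb andbC.
Qed.

(** * Half-turn and quarter-turn symmetric matrices *)

Lemma zero_or_one_sub1 z : zero_or_one z -> zero_or_one (1 - z).
Proof. by case/orP => /eqP ->. Qed.

Lemma zero_or_one_total z z' : zero_or_one z -> zero_or_one z' ->
  (z + z' == 1) = ((z' == 1) == ~~ (z == 1)).
Proof. by case/orP => /eqP -> /orP [] /eqP ->. Qed.

Lemma eq_int_entry_at m p (A : 'M[asm_entry]_(m, p)) m' p'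
  (B : 'M[asm_entry]_(m', p')) i j i' j' :
  entry_at A i j = entry_at B i' j' -> int_entry_at A i j =
    int_entry_at B i' j'.
Proof. by rewrite /int_entry_at => ->. Qed.

Definition corner N m p (A : 'M[asm_entry]_N) : 'M[asm_entry]_(m, p) :=
  \matrix_(i < m, j < p) entry_at A i j.

Section Corner.
Variables (N m p : nat) (A : 'M[asm_entry]_N).

Lemma entry_at_corner i j : (i < m)%N -> (j < p)%N ->
  entry_at (corner m p A) i j = entry_at A i j.
Proof. exact: (entry_at_mx (entry_at A)). Qed.

Lemma rowsum_corner i j : (i < m)%N -> (j <= p)%N -> rowsum (corner m p A) i j =
  rowsum A i j.
Proof.
move=> im jp; apply: eq_partial_sum => k kj; apply: eq_int_entry_at; apply:
  entry_at_corner => //.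
exact: leq_trans kj jp.
Qed.

Lemma colsum_corner i j : (i <= m)%N -> (j < p)%N -> colsum (corner m p A) i j =
  colsum A i j.
Proof.
move=> im jp; apply: eq_partial_sum => k kj; apply: eq_int_entry_at; apply:
  entry_at_corner => //.
exact: leq_trans kj im.
Qed.

Lemma admissible_corner : (m <= N)%N -> (p <= N)%N -> admissible A ->
  admissible (corner m p A).
Proof.
move=> mN pN /admissibleP [h v]; apply/admissibleP; split=> i j im jp.
  by rewrite rowsum_corner // h //; [exact: leq_trans mN|exact: leq_trans pN].
by rewrite colsum_corner // v //; [exact: leq_trans mN|exact: leq_trans pN].
Qed.

End Corner.

Lemma all_onesP (s : seq bool) n : size s = n ->
  reflect (forall i, (i < n)%N -> nth false s i) (s == nseq n true).
Proof.
move=> sn; apply: (iffP eqP) => [-> i im|H]; first by rewrite nth_nseq im.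
by apply: (eq_seq_nth sn) => [|i im]; rewrite ?size_nseq // nth_nseq im H.
Qed.

Lemma rowtotP m p (B : 'M[asm_entry]_(m, p)) :
  reflect (forall i, (i < m)%N -> rowsum B i p = 1) (rowtot B == nseq m true).
Proof.
apply: (iffP (all_onesP (size_mkseq _ _))) => H i im; have := H i im;
  rewrite nth_mkseq //.
  by move/eqP.
by move=> ->.
Qed.

Lemma coltotP m p (B : 'M[asm_entry]_(m, p)) :
  reflect (forall j, (j < p)%N -> colsum B m j = 1) (coltot B == nseq p true).
Proof.
apply: (iffP (all_onesP (size_mkseq _ _))) => H i im; have := H i im;
  rewrite nth_mkseq //.
  by move/eqP.
by move=> ->.
Qed.

Section HalfTurn.
Variables (n N : nat).
Hypothesis N_eq : N = (2 * n)%N.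
Implicit Type A : 'M[asm_entry]_N.
Implicit Type B : 'M[asm_entry]_(n, N).

Lemma rot180P A : reflect (forall i j, (i < N)%N -> (j < N)%N ->
   entry_at A i j = entry_at A (N.-1 - i) (N.-1 - j)) (rot180 A == A).
Proof.
have E (i j : 'I_N) : rot180 A i j = entry_at A (N.-1 - i) (N.-1 - j).
  rewrite mxE -entry_atE /=; congr entry_at; have := ltn_ord i; have :=
    ltn_ord j; lia.
apply: (iffP eqP) => [rA i j iN jN|H].
  by rewrite -{1}rA (entry_atE _ (Ordinal iN) (Ordinal jN)) E.
by apply/matrixP => i j; rewrite E -H ?entry_atE.
Qed.

(** The half-turn symmetric matrix with upper half [B]. *)
Definition ht_ext B : 'M[asm_entry]_N := \matrix_(i < N, j < N)
  (if (i < n)%N then entry_at B i j else entry_at B (N.-1 - i) (N.-1 - j)).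

Lemma entry_at_ht_ext B i j : (i < N)%N -> (j < N)%N ->
  entry_at (ht_ext B) i j =
  if (i < n)%N then entry_at B i j else entry_at B (N.-1 - i) (N.-1 - j).
Proof. exact: (entry_at_mx (fun i j => if (i < n)%N then entry_at B i j else
  entry_at B (N.-1 - i) (N.-1 - j))). Qed.

Lemma ht_extK B : corner n N (ht_ext B) = B.
Proof.
apply: entry_at_inj => i j im jn; rewrite entry_at_corner // entry_at_ht_ext ?im
  //; lia.
Qed.

Lemma ht_cornerK A : (ht_ext (corner n N A) == A) = (rot180 A == A).
Proof.
apply/eqP/rot180P => [<- i j iN jN|H].
  rewrite !entry_at_ht_ext; try lia; case: ltnP => im; case: ltnP => jm;
    try lia.
    by congr entry_at; lia.
  by [].
apply: entry_at_inj => i j iN jN; rewrite entry_at_ht_ext //; case: ltnP => im.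
  by rewrite entry_at_corner.
by rewrite entry_at_corner -?H //; lia.
Qed.

Definition ht_boundary (c : seq bool) :=
  [forall j : 'I_N, nth false c (N.-1 - j)%N == ~~ nth false c j].

(** The lower half repeats the upper half, so its partial sums are 1 minus those
    of the upper half once all totals are 1.  The total of column j is the sum
    of columns j and N - 1 - j over the upper half, whence the boundary
    condition. *)
Lemma is_htsasmE A : is_htsasm A =
  [&& admissible (corner n N A), rowtot (corner n N A) == nseq n true &
      ht_boundary (coltot (corner n N A))] && (ht_ext (corner n N A) == A).
Proof.
rewrite ht_cornerK /is_htsasm; have [sym|_] := boolP (rot180 A == A);
  last by rewrite !andbF.
rewrite !andbT; move/rot180P: sym => sym.
have nN : (n <= N)%N by lia.
have esym i j : (i < N)%N -> (j < N)%N -> int_entry_at A i j =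
  int_entry_at A (N.-1 - i) (N.-1 - j).
  by move=> iN jN; apply: eq_int_entry_at; apply: sym.
have rowE i j : (i < N)%N -> (j <= N)%N ->
    rowsum A i j = rowsum A (N.-1 - i) N - rowsum A (N.-1 - i) (N - j).
  move=> iN jN; rewrite -(partial_sum_rev (int_entry_at A (N.-1 - i))) //;
    apply: eq_partial_sum => k kj.
  by apply: esym => //; lia.
have colE i j : (i <= N)%N -> (j < N)%N ->
    colsum A i j = colsum A N (N.-1 - j) - colsum A (N - i) (N.-1 - j).
  move=> iN jN; rewrite -(partial_sum_rev
    (fun i => int_entry_at A i (N.-1 - j))) //; apply: eq_partial_sum => k kj.
  by apply: esym => //; lia.
have bdE : admissible (corner n N A) ->
  reflect (forall j, (j < N)%N -> colsum A N j = 1)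
  (ht_boundary (coltot (corner n N A))).
  move=> /admissibleP [_ v].
  have tot j : (j < N)%N -> colsum A N j = colsum A n j + colsum A n (N.-1 - j).
    move=> jN; rewrite (colE n (N.-1 - j)%N); try lia.
    have -> : (N.-1 - (N.-1 - j) = j)%N by lia.
    have -> : (N - n = n)%N by lia.
    by ring.
  apply: (iffP forallP) => [H j jN|H j].
    apply/eqP; rewrite tot // zero_or_one_total.
    - by have := H (Ordinal jN); rewrite !nth_mkseq //=; try lia;
      rewrite !colsum_corner //; lia.
    - by have := v n j; rewrite colsum_corner //; apply; lia.
    - by have := v n (N.-1 - j)%N; rewrite colsum_corner //; try lia; apply;
      lia.
  have jN := ltn_ord j; rewrite !nth_mkseq //; try lia.
  rewrite !colsum_corner //; try lia.
  rewrite -zero_or_one_total -?tot ?H //.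
  - by have := v n j; rewrite colsum_corner //; apply; lia.
  - by have := v n (N.-1 - j)%N; rewrite colsum_corner //; try lia; apply; lia.
apply/is_asmP/and3P => [[a r c]|[a /rowtotP r bd]].
  have a' : admissible (corner n N A) by apply: admissible_corner.
  split=> //; last exact/bdE.
  by apply/rowtotP => i im; rewrite rowsum_corner // r //; lia.
move/(bdE a): bd => c; move/admissibleP: a => [h v].
have r' i : (i < n)%N -> rowsum A i N = 1.
  by move=> im; rewrite -(@rowsum_corner _ n N) // r.
have h' i j : (i < n)%N -> (j <= N)%N -> zero_or_one (rowsum A i j).
  by move=> im jN; rewrite -(@rowsum_corner _ n N) // h.
have v' i j : (i <= n)%N -> (j < N)%N -> zero_or_one (colsum A i j).
  by move=> im jN; rewrite -(@colsum_corner _ n N) // v.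
split=> //.
  apply/admissibleP; split=> i j im jN.
    have [iln|nli] := ltnP i n; first exact: h'.
    rewrite rowE // r'; last lia.
    by apply: zero_or_one_sub1; apply: h'; lia.
  have [iln|nli] := leqP i n; first exact: v'.
  rewrite colE // c; last lia.
  by apply: zero_or_one_sub1; apply: v'; lia.
move=> i iN; have [iln|nli] := ltnP i n; first exact: r'.
rewrite rowE // subnn /rowsum partial_sum0 subr0; apply: r'; lia.
Qed.

End HalfTurn.

Section QuarterTurn.
Variables (M N : nat).
Hypothesis N_eq : N = (2 * M)%N.
Implicit Type A : 'M[asm_entry]_N.
Implicit Type B : 'M[asm_entry]_M.

Lemma rot90P A : reflect (forall i j, (i < N)%N -> (j < N)%N ->
   entry_at A i j = entry_at A (N.-1 - j) i) (rot90 A == A).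
Proof.
have E (i j : 'I_N) : rot90 A i j = entry_at A (N.-1 - j) i.
  rewrite mxE -entry_atE /=; congr entry_at; have := ltn_ord j; lia.
apply: (iffP eqP) => [rA i j iN jN|H].
  by rewrite -{1}rA (entry_atE _ (Ordinal iN) (Ordinal jN)) E.
by apply/matrixP => i j; rewrite E -H ?entry_atE.
Qed.

(** The entries outside the upper left quadrant [B] are those of the quadrant
    turned by one, two or three quarters. *)
Definition qt_entry B i j := if (i < M)%N then
    (if (j < M)%N then entry_at B i j else entry_at B (N.-1 - j) i)
  else if (j < M)%N then entry_at B j (N.-1 - i) else entry_at B (N.-1 - i)
    (N.-1 - j).

Definition qt_ext B : 'M[asm_entry]_N := \matrix_(i < N, j < N) qt_entry B i j.

Lemma entry_at_qt_ext B i j : (i < N)%N -> (j < N)%N ->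
  entry_at (qt_ext B) i j = qt_entry B i j.
Proof. exact: (entry_at_mx (qt_entry B)). Qed.

Lemma qt_extK B : corner M M (qt_ext B) = B.
Proof.
apply: entry_at_inj => i j im jn; rewrite entry_at_corner // entry_at_qt_ext;
  try lia.
by rewrite /qt_entry im jn.
Qed.

Lemma qt_cornerK A : (qt_ext (corner M M A) == A) = (rot90 A == A).
Proof.
apply/eqP/rot90P => [<- i j iN jN|H].
  rewrite !entry_at_qt_ext; try lia; rewrite /qt_entry.
  have [iM|iM] := ltnP i M; have [jM|jM] := ltnP j M; have [kM|kM] :=
    ltnP (N.-1 - j) M; try lia; congr entry_at; lia.
apply: entry_at_inj => i j iN jN; rewrite entry_at_qt_ext // /qt_entry.
have [iM|iM] := ltnP i M; have [jM|jM] := ltnP j M; rewrite entry_at_corner;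
  try lia.
- by [].
- by rewrite [RHS]H.
- by rewrite H; try lia; congr entry_at; lia.
- by rewrite [RHS]H // [RHS]H //; lia.
Qed.

(** By symmetry the partial sums of columns are 1 minus those of rows, so only
    rows have to be considered; the right half of row i is column i of the
    quadrant turned around. *)
Lemma is_qtsasmE A : is_qtsasm A =
  (admissible (corner M M A) && (coltot (corner M M A) == map negb
    (rowtot (corner M M A))))
  && (qt_ext (corner M M A) == A).
Proof.
rewrite qt_cornerK /is_qtsasm; have [sym|_] := boolP (rot90 A == A);
  last by rewrite !andbF.
rewrite !andbT; move/rot90P: sym => sym.
have MN : (M <= N)%N by lia.
have esym i j : (i < N)%N -> (j < N)%N -> int_entry_at A i j =
  int_entry_at A (N.-1 - j) i.
  by move=> iN jN; apply: eq_int_entry_at; apply: sym.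
have colE i j : (i <= N)%N -> (j < N)%N -> colsum A i j =
  rowsum A j N - rowsum A j (N - i).
  move=> iN jN; rewrite -(partial_sum_rev (int_entry_at A j)) //; apply:
    eq_partial_sum => k kj.
  rewrite [RHS]esym //; try lia; congr int_entry_at; lia.
have rowE i j : (i < N)%N -> (j <= N)%N ->
    rowsum A i j = rowsum A (N.-1 - i) N - rowsum A (N.-1 - i) (N - j).
  move=> iN jN; rewrite -(partial_sum_rev (int_entry_at A (N.-1 - i))) //;
    apply: eq_partial_sum => k kj.
  have kN : (k < N)%N by exact: leq_trans kj jN.
  have kN' : (N.-1 - k < N)%N by lia.
  by rewrite (esym i k) // (esym (N.-1 - k)%N i).
have bdE : admissible (corner M M A) ->
  reflect (forall i, (i < M)%N -> rowsum A i N = 1)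
    (coltot (corner M M A) == map negb (rowtot (corner M M A))).
  move=> /admissibleP [h v].
  have tot i : (i < M)%N -> rowsum A i N = rowsum A i M + colsum A M i.
    move=> iM; rewrite colE; try lia.
    have -> : (N - M = M)%N by lia.
    by ring.
  have zE i : (i < M)%N -> (rowsum A i N == 1) =
     (nth false (coltot (corner M M A)) i == nth false
       (map negb (rowtot (corner M M A))) i).
    move=> iM; rewrite tot // zero_or_one_total.
    - by rewrite (nth_map false) ?size_mkseq // !nth_mkseq // colsum_corner //
      rowsum_corner.
    - by have := h i M; rewrite rowsum_corner //; apply.
    - by have := v M i; rewrite colsum_corner //; apply.
  apply: (iffP eqP) => [E i iM|H]; first by apply/eqP; rewrite zE // E.
  apply: (@eq_seq_nth _ _ M) => [||i iM].
  - by rewrite size_mkseq.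
  - by rewrite size_map size_mkseq.
  by apply/eqP; rewrite -zE // H.
apply/is_asmP/andP => [[a r c]|[a bd]].
  have a' : admissible (corner M M A) by apply: admissible_corner.
  split=> //; apply/bdE => // i iM; apply: r; lia.
move/(bdE a): bd => r0; move/admissibleP: a => [h v].
have h' i j : (i < M)%N -> (j <= N)%N -> zero_or_one (rowsum A i j).
  move=> im jN; have [jM|Mj] := leqP j M;
    first by rewrite -(@rowsum_corner _ M M) // h.
  have -> : rowsum A i j = 1 - colsum A (N - j) i.
    rewrite colE ?r0 //; try lia.
    have -> : (N - (N - j) = j)%N by lia.
    by ring.
  by apply: zero_or_one_sub1; rewrite -(@colsum_corner _ M M) //; try lia;
    apply: v => //; lia.
have r i : (i < N)%N -> rowsum A i N = 1.
  move=> iN; have [iln|nli] := ltnP i M; first exact: r0.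
  by rewrite rowE // subnn /rowsum partial_sum0 subr0; apply: r0; lia.
have hh i j : (i < N)%N -> (j <= N)%N -> zero_or_one (rowsum A i j).
  move=> iN jN; have [iln|nli] := ltnP i M; first exact: h'.
  rewrite rowE // r; last lia.
  by apply: zero_or_one_sub1; apply: h'; lia.
split=> //.
  apply/admissibleP; split=> // i j iN jN; rewrite colE // r //.
  by apply: zero_or_one_sub1; apply: hh; lia.
by move=> j jN; rewrite colE // subnn /rowsum partial_sum0 subr0; apply: r.
Qed.

End QuarterTurn.

(** * Partition functions as sums over symmetry classes *)

Section Counting.
Variables (F : numFieldType) (w : F).
Hypothesis w_root : w ^+ 2 = - 1 - w.

Local Notation vw := (vertex_weight w).
Local Notation Zasm := (asm_partition w).
Local Notation Zht := (ht_partition w).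
Local Notation Zqt := (qt_partition w).
Local Notation wt := (state_weight w).

Lemma asm_partition_matrix n xs ys : size xs = n -> size ys = n ->
  Zasm xs ys = \sum_(A : 'M[asm_entry]_n | is_asm A) wt xs ys A.
Proof.
move=> sx sy; rewrite /asm_partition sx sy (@grid_sum_matrix F w n n) ?size_nseq
  //.
rewrite big_mkcond [RHS]big_mkcond; apply: eq_bigr => A _.
have [a|na] := boolP (admissible A); last by case: is_asmP => // -[a _ _];
  rewrite a in na.
case: is_asmP => [[_ /rowtotP -> /coltotP ->]|H]; first by rewrite mul1r.
case: (boolP (_ && _)) => [/andP [/rowtotP r /coltotP c]|_];
  last by rewrite mul0r.
by case: H.
Qed.

Lemma qt_partition_matrix M xs : size xs = M ->
  Zqt xs = \sum_(B : 'M[asm_entry]_M | admissible B &&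
    (coltot B == map negb (rowtot B))) wt xs xs B.
Proof.
move=> sx; rewrite /qt_partition sx.
under eq_bigr => h _ do
  rewrite (@grid_sum_matrix F w M M) ?size_map ?size_tuple //.
rewrite exchange_big /= [RHS]big_mkcondr; apply: eq_bigr => B _.
rewrite -mulr_suml.
have [E|nE] := eqVneq (coltot B) (map negb (rowtot B)).
  pose b0 : M.-tuple bool := [tuple rowsum B i M == 1 | i < M].
  have b0E : rowtot B = b0.
    apply: (@eq_seq_nth _ _ M); rewrite ?size_tuple ?size_mkseq // => i iM.
    by rewrite nth_mkseq // -(tnth_nth _ _ (Ordinal iM)) tnth_mktuple.
  rewrite (bigD1 b0) //= -b0E E !eqxx /= [X in _ + X]big1 ?addr0 ?mul1r // =>
    b nb.
  rewrite (_ : (rowtot B == b) = false) //; apply: contraNF nb => /eqP bs.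
  by apply/eqP/val_inj; exact: (etrans (esym bs) b0E).
rewrite big1 ?mul0r // => h _; case: eqP => //= Eh.
by rewrite -Eh (negbTE nE).
Qed.

Lemma ht_boundaryP n (c : seq bool) : size c = (2 * n)%N ->
  ht_boundary (2 * n) c = (c == take n c ++ rev (map negb (take n c))).
Proof.
move=> sc; have st : size (take n c) = n by rewrite size_takel // sc; lia.
have E j : (j < 2 * n)%N -> nth false (take n c ++ rev (map negb (take n c)))
  j =
    if (j < n)%N then nth false c j else ~~ nth false c ((2 * n).-1 - j).
  move=> jn; rewrite nth_cat st; case: ltnP => jln; first by rewrite nth_take.
  rewrite nth_rev ?size_map st; last by lia.
  rewrite (nth_map false) ?st; last by lia.
  by rewrite nth_take; [congr (~~ nth _ _ _); lia|lia].
apply/forallP/eqP => [H|H j].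
  apply: (@eq_seq_nth _ _ (2 * n)) => // [|j jn].
    by rewrite size_cat size_rev size_map st; lia.
  rewrite E //; case: ltnP => // nj.
  have := H (Ordinal jn) => /eqP /= ->.
  by rewrite negbK.
have jn := ltn_ord j; apply/eqP.
have [jl|nj] := ltnP j n.
  rewrite {1}H E; last lia.
  have -> : ((2 * n).-1 - j < n)%N = false by apply/negbTE; rewrite -leqNgt;
    lia.
  by congr (~~ nth _ _ _); lia.
rewrite [in RHS]H E //.
have -> : (j < n)%N = false by apply/negbTE; rewrite -leqNgt; lia.
by rewrite negbK.
Qed.

Lemma ht_partition_matrix n xs ys : size xs = n -> size ys = n ->
  Zht xs ys = \sum_(B : 'M[asm_entry]_(n, 2 * n) |
     [&& admissible B, rowtot B == ones n & ht_boundary (2 * n) (coltot B)]) wt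
       xs (ys ++ rev ys) B.
Proof.
move=> sx sy; rewrite /ht_partition sx.
have sY : size (ys ++ rev ys) = (2 * n)%N by rewrite size_cat size_rev sy mul2n
  addnn.
rewrite sY sy.
have sb (b : n.-tuple bool) : size (b ++ rev (map negb b)) = (2 * n)%N.
  by rewrite size_cat size_rev size_map size_tuple mul2n addnn.
under eq_bigr => b _ do rewrite (@grid_sum_matrix F w n (2 * n)) ?size_nseq ?sb
  //.
rewrite exchange_big /= [RHS]big_mkcondr; apply: eq_bigr => B _.
rewrite -mulr_suml; case: (rowtot B == ones n); last by rewrite big1 ?mul0r.
have sc : size (coltot B) = (2 * n)%N by rewrite size_mkseq.
rewrite /= ht_boundaryP //.
set c := coltot B in sc *.
have st : size (take n c) == n by rewrite size_takel // sc; lia.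
pose b0 : n.-tuple bool := Tuple st.
case: eqP => [E|nE].
  rewrite (bigD1 b0) //= -E eqxx [X in _ + X]big1 ?addr0 ?mul1r // => b nb.
  rewrite (_ : (c == _) = false) //; apply: contraNF nb => /eqP bs.
  apply/eqP/val_inj; rewrite /= bs take_cat size_tuple ltnn subnn take0 cats0
    //.
rewrite big1 ?mul0r // => b _; case: eqP => // bs; case: nE.
by rewrite {2 3}bs take_cat size_tuple ltnn subnn take0 cats0.
Qed.

Lemma ht_partition_htsasm n xs ys : size xs = n -> size ys = n ->
  Zht xs ys = \sum_(A : 'M[asm_entry]_(2 * n) | is_htsasm A)
     wt xs (ys ++ rev ys) (corner n (2 * n) A).
Proof.
move=> sx sy; rewrite (ht_partition_matrix sx sy).
rewrite (reindex_onto (corner n (2 * n)) (@ht_ext n (2 * n))) /=; last first.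
  by move=> B _; apply: ht_extK.
by apply: eq_bigl => A; rewrite -is_htsasmE.
Qed.

Lemma qt_partition_qtsasm M N xs : N = (2 * M)%N -> size xs = M ->
  Zqt xs = \sum_(A : 'M[asm_entry]_N | is_qtsasm A) wt xs xs (corner M M A).
Proof.
move=> N_eq sx; rewrite (qt_partition_matrix sx).
rewrite (reindex_onto (@corner N M M) (@qt_ext M N)) /=; last first.
  by move=> B _; apply: qt_extK.
by apply: eq_bigl => A; rewrite -is_qtsasmE.
Qed.

(** This is why the partition functions count at parameters 1. *)
Lemma vertex_weight_one l t b : compatible l t b -> vw 1 1 l t b = 1.
Proof.
by case: l; case: t; case: b; rewrite /vertex_weight /=
  ?weight_bE ?(weight_a_diag w_root) ?mulr1.
Qed.

Section Weights.
Variables (m p : nat) (B : 'M[asm_entry]_(m, p)).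
Hypothesis B_adm : admissible B.

Lemma rowsumS i j : rowsum B i j.+1 = rowsum B i j + int_entry_at B i j.
Proof. exact: partial_sumS. Qed.
Lemma colsumS i j : colsum B i.+1 j = colsum B i j + int_entry_at B i j.
Proof. exact: partial_sumS. Qed.

Lemma admissible_compatible i j : (i < m)%N -> (j < p)%N ->
  compatible (rowsum B i j == 1) (colsum B i j == 1) (colsum B i.+1 j == 1).
Proof.
move=> im jp; have [h v] := elimT (admissibleP B) B_adm.
have := h i _ im jp; have := h i j im (ltnW jp).
have := v _ _ im jp; have := v i j (ltnW im) jp.
rewrite rowsumS colsumS.
move: (rowsum B i j) (colsum B i j) (int_entry_at B i j) => a b c.
case/orP => /eqP -> //; case/orP => /eqP E1; case/orP => /eqP E2; case/orP =>
  /eqP E3;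
  rewrite E2; move: E1 E3; rewrite E2 ?add0r => E1 E3;
    rewrite /compatible ?E1 //; move: E3; rewrite ?E1 //;
  lia.
Qed.

Lemma state_weight_unit_row xs cs i : (i < m)%N -> xs`_i = 1 ->
  (forall j, (j < p)%N -> cs`_j = 1) ->
  \prod_(j < p) vw xs`_i cs`_j (rowsum B i j == 1) (colsum B i j == 1)
    (colsum B i.+1 j == 1) = 1.
Proof.
move=> im xi cj; rewrite big1 // => j _; rewrite xi cj //.
by rewrite vertex_weight_one // admissible_compatible.
Qed.

End Weights.

Lemma nth_ones n j : (j < n)%N -> (nseq n (1 : F))`_j = 1.
Proof. by move=> jn; rewrite nth_nseq jn. Qed.

(** All weights below the first row are 1. *)
Lemma state_weight_top m p (B : 'M[asm_entry]_(m.+1, p)) t : admissible B ->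
  wt (t :: nseq m 1) (nseq p 1) B =
  \prod_(j < p) vw t 1 (partial_sum (int_entry_at B 0) j == 1) false
    (int_entry_at B 0 j == 1).
Proof.
move=> a; rewrite /state_weight big_ord_recl [X in _ * X]big1 ?mulr1 => [|i _].
  apply: eq_bigr => j _; rewrite /= nth_ones // colsumS.
  by rewrite /colsum partial_sum0 add0r.
by apply: (state_weight_unit_row a (ltn_ord (lift ord0 i))) => [|j jp]; apply:
  nth_ones.
Qed.

Lemma prod_step_function (a b : F) p k : (k < p)%N ->
  \prod_(j < p) (if (j < k)%N then a else if j == k :> nat then 1 else b)
  = a ^+ k * b ^+ (p - k.+1).
Proof.
elim: p => // p IH; rewrite ltnS leq_eqVlt big_ord_recr /= => /orP [/eqP <-|kp].
  rewrite ltnn eqxx mulr1 subnn mulr1.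
  under eq_bigr => j _ do rewrite ltn_ord.
  by rewrite prodr_const card_ord.
rewrite IH // ltnNge (ltnW kp) /=.
have -> : (p == k) = false by lia.
by rewrite subSn // exprSr mulrA.
Qed.

End Counting.

(** * Refined enumerations *)

Lemma top_one_atE N (A : 'M[asm_entry]_N) k : top_one_at k.+1 A =
  (int_entry_at A 0 k == 1).
Proof.
apply/existsP/idP => [[r /existsP [c /and3P [/eqP r0 /eqP [ck] e1]]]|].
  by move: e1; rewrite mxE -int_entry_atE r0 ck.
have [N0|N0] := leqP N 0; first by rewrite /int_entry_at entry_at_out_row.
have [Nk|kN] := leqP N k; first by rewrite /int_entry_at entry_at_out_col.
move=> e1; exists (Ordinal N0); apply/existsP; exists (Ordinal kN).
by rewrite /= !eqxx mxE -int_entry_atE.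
Qed.

Section Refined.
Variables (F : numFieldType) (w : F).
Hypothesis w_root : w ^+ 2 = - 1 - w.

Local Notation wA := (weight_a w).
Local Notation wB := (weight_b w).
Local Notation vw := (vertex_weight w).
Local Notation Zasm := (asm_partition w).
Local Notation Zht := (ht_partition w).
Local Notation Zqt := (qt_partition w).
Local Notation wt := (state_weight w).

(** Grouping the matrices by the column of the 1 in the first row. *)
Lemma refined_sum N (P : pred 'M[asm_entry]_N) (W : 'M[asm_entry]_N -> F) lo hi
  (c : nat -> F) :
  (0 < lo)%N ->
  (forall A, P A -> exists k, [/\ (lo <= k.+1 < hi)%N,
     forall j, (int_entry_at A 0 j == 1) = (j == k) & W A = c k.+1]) ->
  \sum_(A | P A) W A =
  \sum_(lo <= i < hi) #|[set A | P A & top_one_at i A]|%:R * c i.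
Proof.
move=> lo0 H.
under [RHS]eq_bigr => i _ do rewrite -sum1_card natr_sum mulr_suml big_mkcond
  /=.
rewrite exchange_big /= big_mkcond; apply: eq_bigr => A _.
under [RHS]eq_bigr => i _ do rewrite inE mul1r.
case: (boolP (P A)) => [/H [k [kP kE ->]]|_]; last by rewrite big1.
rewrite (bigD1_seq k.+1) ?iota_uniq ?mem_index_iota //= top_one_atE kE eqxx.
rewrite big_nat_cond big1 ?addr0 // => -[|i]; first by rewrite leqNgt lo0.
by rewrite top_one_atE kE eqSS => /andP [_ /negbTE ->].
Qed.

(** In a first row, zeros to the left of the 1 weigh A and those to the right
    of it weigh B. *)
Lemma prod_unit_row t (u : nat -> int) p k : (k < p)%N ->
  (forall j, (j < p)%N -> u j = bint (j == k)) ->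
  \prod_(j < p) vw t 1 (partial_sum u j == 1) false (u j == 1) =
  wA t 1 ^+ k * wB t 1 ^+ (p - k.+1).
Proof.
move=> kp uE; rewrite -(prod_step_function _ _ kp); apply: eq_bigr => j _.
rewrite (partial_sum_unit uE (ltnW (ltn_ord j))) uE // /vertex_weight.
by case: (ltngtP j k).
Qed.

Lemma asm_top_row N (A : 'M[asm_entry]_N) : (0 < N)%N -> is_asm A ->
  exists2 k, (k < N)%N & forall j, (j < N)%N -> int_entry_at A 0 j =
    bint (j == k).
Proof.
move=> N0 /is_asmP [/admissibleP [_ v] r _]; apply: unit_vector; last exact: r.
by move=> j jN; have := v 1%N j N0 jN; rewrite /colsum partial_sumS partial_sum0
  add0r.
Qed.

Lemma int_entry_at_unit N (A : 'M[asm_entry]_N) k : (k < N)%N ->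
  (forall j, (j < N)%N -> int_entry_at A 0 j = bint (j == k)) ->
  forall j, (int_entry_at A 0 j == 1) = (j == k).
Proof.
move=> kN kE j; have [jN|jN] := ltnP j N; first by rewrite kE //; case:
  (j == k).
have jk : (j == k) = false by apply/negbTE; apply: contraTneq kN => <-;
  rewrite -leqNgt.
by rewrite jk /int_entry_at entry_at_out_col.
Qed.

Lemma asm_partition_refined n t : Zasm (t :: nseq n 1) (nseq n.+1 1) =
  \sum_(1 <= i < n.+2) (nb_asm n.+1 i)%:R *
    (wA t 1 ^+ (i - 1) * wB t 1 ^+ (n.+1 - i)).
Proof.
rewrite (@asm_partition_matrix F w n.+1) ?size_nseq //= ?size_nseq //.
apply: (refined_sum (c := fun i => wA t 1 ^+ (i - 1) * wB t 1 ^+ (n.+1 - i))) =>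
  // A aA.
have [k kn kE] := asm_top_row (isT : 0 < _.+1)%N aA; exists k; split=> //;
  first exact: int_entry_at_unit.
have [a _ _] := elimT (is_asmP A) aA.
by rewrite (state_weight_top w_root) // (prod_unit_row _ kn kE) subn1.
Qed.

Lemma ht_partition_refined n t : Zht (t :: nseq n 1) (nseq n.+1 1) =
  \sum_(1 <= i < (2 * n.+1).+1) (nb_htsasm (2 * n.+1) i)%:R *
     (wA t 1 ^+ (i - 1) * wB t 1 ^+ (2 * n.+1 - i)).
Proof.
rewrite (@ht_partition_htsasm F w n.+1) ?size_nseq //; last by rewrite /=
  size_nseq.
apply: (refined_sum (c := fun i => wA t 1 ^+ (i - 1) *
  wB t 1 ^+ (2 * n.+1 - i))) => // A /andP [aA _].
have [k kn kE] := asm_top_row (isT : 0 < _.+1)%N aA; exists k; split=> //;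
  first exact: int_entry_at_unit.
have [a _ _] := elimT (is_asmP A) aA.
have a' : admissible (corner n.+1 (2 * n.+1) A) by apply: admissible_corner =>
  //; lia.
have -> : nseq n.+1 1 ++ rev (nseq n.+1 1) = nseq (2 * n.+1) (1 : F).
  by rewrite rev_nseq -nseqD mul2n addnn.
rewrite (state_weight_top w_root) // (@prod_unit_row _ _ _ k) ?subn1 // => j jn.
by rewrite -kE //; apply: eq_int_entry_at; apply: entry_at_corner.
Qed.

(** Only the first row and the first column of the quadrant carry [t]; their
    common vertex, a zero, weighs [t]. *)
Lemma state_weight_qt M (B : 'M[asm_entry]_M.+1) t : admissible B ->
  int_entry_at B 0 0 = 0 ->
  wt (t :: nseq M 1) (t :: nseq M 1) B =
  t * (\prod_(j < M) vw t 1 (partial_sum (int_entry_at B 0) j.+1 == 1) false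
    (int_entry_at B 0 j.+1 == 1)) *
  (\prod_(i < M) vw 1 t false (partial_sum (int_entry_at B ^~ 0) i.+1 == 1)
    (partial_sum (int_entry_at B ^~ 0) i.+2 == 1)).
Proof.
move=> a e00; rewrite /state_weight big_ord_recl; congr (_ * _).
  rewrite big_ord_recl /=; congr (_ * _).
    rewrite /rowsum /colsum !partial_sumS !partial_sum0 e00 /vertex_weight /=.
    by rewrite (weight_a_diag w_root).
  apply: eq_bigr => j _; rewrite /= nth_ones; last exact: ltn_ord.
  rewrite colsumS /colsum partial_sum0 add0r.
  by rewrite /rowsum.
apply: eq_bigr => i _; rewrite big_ord_recl /= nth_ones; last exact: ltn_ord.
rewrite [X in _ * X]big1 ?mulr1.
  by rewrite /rowsum partial_sum0.
move=> j _; rewrite /= nth_ones; last exact: ltn_ord.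
exact/(vertex_weight_one w_root)/(admissible_compatible a
  (ltn_ord (lift ord0 i)) (ltn_ord (lift ord0 j))).
Qed.

(** The right half of the first row of the whole matrix is the first column of
    the quadrant turned around.  So exactly one of the first row and the first
    column of the quadrant contains a 1, and its place is that of the 1 in the
    first row of the whole matrix; the other line contributes a pure power. *)
Lemma qt_partition_refined n t : Zqt (t :: nseq n.*2.+1 1) =
  t * \sum_(2 <= i < 4 * n.+1) (nb_qtsasm (4 * n.+1) i)%:R *
     (wA t 1 ^+ (i - 2) * wB t 1 ^+ ((4 * n.+1).-1 - i)).
Proof.
set M := n.*2.+1; set N := (4 * n.+1)%N.
have N_eq : N = (2 * M.+1)%N by rewrite /N /M; lia.
rewrite (@qt_partition_qtsasm F w M.+1 N) //= ?size_nseq //.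
rewrite mulr_sumr.
under [RHS]eq_bigr => i _ do rewrite mulrCA.
apply: (refined_sum (c := fun i => t * (wA t 1 ^+ (i - 2) *
  wB t 1 ^+ (N.-1 - i)))) => // A qA.
have MN : (M.+1 <= N)%N by lia.
have /andP [aA /(rot90P N_eq) sym] := qA.
have : is_qtsasm A := qA; rewrite (is_qtsasmE N_eq) => /andP [/andP [a bd] _].
have [k kn kE] : exists2 k, (k < N)%N & forall j, (j < N)%N ->
  int_entry_at A 0 j = bint (j == k).
  by apply: asm_top_row aA; rewrite N_eq.
set B := corner M.+1 M.+1 A in a bd *.
have rE j : (j < M.+1)%N -> int_entry_at B 0 j = bint (j == k).
  move=> jM; rewrite -kE; last exact: leq_trans MN.
  by apply: eq_int_entry_at; apply: entry_at_corner.
have [h v] := elimT (admissibleP B) a.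
have cz i : (i < M.+1)%N -> zero_or_one (int_entry_at B i 0).
  by move=> iM; have := h i 1%N iM isT;
    rewrite /rowsum partial_sumS partial_sum0 add0r.
have tot : partial_sum (int_entry_at B 0) M.+1 + partial_sum
  (int_entry_at B ^~ 0%N) M.+1 = 1.
  apply/eqP; rewrite zero_or_one_total; [|exact: h|exact: v].
  by move/eqP: bd => /(congr1 (fun s => nth false s 0)) /= ->.
have zr j : (j < M.+1)%N -> zero_or_one (int_entry_at B 0 j) by move=> /rE ->;
  apply: zero_or_one_bintP.
(* Either the 1 of the first row lies in the quadrant, and the first column is
   zero there, or conversely. *)
have psr : partial_sum (int_entry_at B 0) M.+1 = bint (k < M.+1)%N by exact:
  (partial_sum_unit rE (leqnn _)).
have wtE := state_weight_qt t a; rewrite wtE.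
  exists k; have [kM|Mk] := ltnP k M.+1.
    have c0 i : (i < M.+1)%N -> int_entry_at B i 0 = 0.
      by apply: (partial_sum_eq0 cz); move: tot; rewrite psr kM /bint; lia.
    have k0 : (0 < k)%N.
      by rewrite lt0n; apply/eqP => kz; have := rE 0%N isT; rewrite c0 // kz.
    have -> : \prod_(j < M) vw t 1 (partial_sum (int_entry_at B 0) j.+1 == 1)
      false (int_entry_at B 0 j.+1 == 1) =
       wA t 1 ^+ k.-1 * wB t 1 ^+ (M - k).
      rewrite -[in RHS](prednK k0) -prod_step_function; last by lia.
      apply: eq_bigr => j _; rewrite (partial_sum_unit rE) ?rE //;
        try by have := ltn_ord j; lia.
      have -> : (k < j.+1)%N = (k.-1 < j)%N by lia.
      have -> : (j.+1 == k) = (j == k.-1 :> nat) by lia.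
      by rewrite /vertex_weight; case: (ltngtP j k.-1).
    have -> : \prod_(i < M) vw 1 t false
      (partial_sum (int_entry_at B ^~ 0%N) i.+1 == 1)
      (partial_sum (int_entry_at B ^~ 0%N) i.+2 == 1)
       = wB t 1 ^+ M.
      rewrite -[M in RHS]card_ord -prodr_const; apply: eq_bigr => i _.
      have z0 q : (q <= M.+1)%N -> partial_sum (int_entry_at B ^~ 0%N) q = 0.
        by move=> qM; rewrite (@partial_sum_zero _ q 0) ?partial_sum0 // =>
          l /andP [_ lq]; apply: c0; lia.
      by rewrite !z0 //; have := ltn_ord i; lia.
    split; [by lia|exact: int_entry_at_unit|].
    rewrite -!mulrA -exprD; congr (_ * (_ ^+ _ * _ ^+ _)); lia.
  have r0 j : (j < M.+1)%N -> int_entry_at B 0 j = 0.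
    by move=> jM; rewrite rE //; have -> : (j == k) = false by lia.
  have [q qM cE] : exists2 q, (q < M.+1)%N & forall i, (i < M.+1)%N ->
    int_entry_at B i 0 = bint (i == q).
    apply: (@unit_vector (int_entry_at B ^~ 0%N)) => //.
    by move: tot; rewrite psr ltnNge Mk /= add0r.
  have q0 : (0 < q)%N.
    by rewrite lt0n; apply/eqP => qz; have := cE 0%N isT; rewrite r0 // qz.
  have qE : q = (N.-1 - k)%N.
    have kN' : (N.-1 - k < M.+1)%N by lia.
    have : int_entry_at B (N.-1 - k) 0 = 1.
      transitivity (int_entry_at A 0 k); last by rewrite kE // eqxx.
      rewrite (eq_int_entry_at (entry_at_corner _ _ _)) //; apply:
        eq_int_entry_at.
      by rewrite [RHS]sym //; lia.
    by rewrite cE //; case: eqP.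
  have -> : \prod_(j < M) vw t 1 (partial_sum (int_entry_at B 0) j.+1 == 1)
    false (int_entry_at B 0 j.+1 == 1) =
       wA t 1 ^+ M.
    rewrite -[M in RHS]card_ord -prodr_const; apply: eq_bigr => j _.
    have z0 l : (l <= M.+1)%N -> partial_sum (int_entry_at B 0) l = 0.
      by move=> qM'; rewrite (@partial_sum_zero _ l 0) ?partial_sum0 // =>
        l' /andP [_ lq]; apply: r0; lia.
    by rewrite z0 ?r0 //; have := ltn_ord j; lia.
  have -> : \prod_(i < M) vw 1 t false (partial_sum (int_entry_at B ^~ 0%N)
    i.+1 == 1) (partial_sum (int_entry_at B ^~ 0%N) i.+2 == 1)
     = wB t 1 ^+ q.-1 * wA t 1 ^+ (M - q).
    rewrite -[in RHS](prednK q0) -prod_step_function; last by lia.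
    apply: eq_bigr => i _; rewrite !(@partial_sum_unit (int_entry_at B ^~ 0%N) _
      q _ cE); try by have := ltn_ord i; lia.
    have -> : (q < i.+1)%N = (q.-1 < i)%N by lia.
    have -> : (q < i.+2)%N = (q.-1 <= i)%N by lia.
    by rewrite /vertex_weight; case: (ltngtP i q.-1).
  split; [by lia|exact: int_entry_at_unit|].
  rewrite -mulrA [wB _ _ ^+ _ * _]mulrC [wA _ _ ^+ M * _]mulrA -exprD.
  by congr (_ * (_ ^+ _ * _ ^+ _)); lia.
have : zero_or_one (partial_sum (int_entry_at B 0) M.+1) by apply: h.
case/orP => /eqP s; first exact: (partial_sum_eq0 zr s).
apply: (partial_sum_eq0 cz) => //; move: tot; rewrite s; lia.
Qed.

End Refined.

(** * Comparison of the generating polynomials *)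

Section Dehomogenization.
Variable F : numFieldType.

Lemma horner_homogeneous (N : nat -> nat) lo hi (a b : F) : b != 0 ->
  \sum_(lo <= i < hi) (N i)%:R * (a ^+ (i - lo) * b ^+ (hi.-1 - i)) =
  b ^+ (hi.-1 - lo) *
  (map_poly intr (\sum_(lo <= i < hi) (N i)%:R *: 'X^(i - lo) : {poly int})).[a
    / b].
Proof.
move=> b0; rewrite rmorph_sum horner_sum mulr_sumr.
apply: eq_big_nat => i /andP [li ih].
rewrite /= map_polyZ map_polyXn hornerZ hornerXn rmorph_nat [RHS]mulrCA;
  congr (_ * _).
have -> : (hi.-1 - lo = (hi.-1 - i) + (i - lo))%N by lia.
by rewrite exprD exprMn exprVn; field; rewrite expf_neq0.
Qed.

Lemma int_poly_eq (p q : {poly int}) (z : nat -> F) : injective z ->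
  (forall m, (map_poly intr p).[z m] = (map_poly intr q).[z m]) -> p = q.
Proof.
move=> zI pq; apply: (@map_inj_poly _ _ (intr : int -> F)) => //; first exact:
  intr_inj.
apply/eqP; rewrite -subr_eq0; apply/eqP.
set d := _ - _; apply: (roots_geq_poly_eq0
  (rs := [seq z m | m <- iota 0 (size d)])).
- by apply/allP => _ /mapP [m _ ->]; rewrite rootE hornerD hornerN pq subrr.
- by rewrite map_inj_uniq ?iota_uniq.
- by rewrite size_map size_iota.
Qed.

End Dehomogenization.

Lemma cube_root_of_unity : exists w : algC, w ^+ 2 = - 1 - w.
Proof.
have [w w_cubed] := C_prim_root_exists (isT : (0 < 3)%N); exists w.
have w1 : w - 1 != 0.
  rewrite subr_eq0; apply/eqP => w1; have := prim_order_dvd w_cubed 1.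
  by rewrite expr1 w1 eqxx.
apply/eqP; rewrite -subr_eq0; apply/eqP/(mulfI w1).
have -> : (w - 1) * (w ^+ 2 - (-1 - w)) = w ^+ 3 - 1 by ring.
by rewrite (prim_expr_order w_cubed) subrr mulr0.
Qed.

Section Ratio.
Variables (F : numFieldType) (w : F).
Hypothesis w_root : w ^+ 2 = - 1 - w.

Lemma natr_neq_w (m : nat) : m%:R - w != 0.
Proof.
apply/eqP => /subr0_eq mw; move: w_root; rewrite -mw => /eqP.
rewrite -subr_eq0 (_ : _ - _ = (m * m + m + 1)%:R);
  last by rewrite !natrD natrM; ring.
by rewrite pnatr_eq0 addn1.
Qed.

Lemma weight_b_nat_neq0 m : weight_b w m.+1%:R 1 != 0.
Proof.
by rewrite /weight_b mulr1 mulf_neq0 ?natr_neq_w // invr_eq0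
  (subr_w_neq0 w_root).
Qed.

(** The ratio A / B is a nondegenerate homography in the parameter, so it takes
    infinitely many values. *)
Lemma weight_ratio_inj : injective (fun m =>
  weight_a w m.+1%:R 1 / weight_b w m.+1%:R 1).
Proof.
move=> m k /eqP; rewrite eqr_div ?weight_b_nat_neq0 // /weight_a /weight_b
  !mulr1 => /eqP E.
have h := subr_w_neq0 w_root.
have {}E : (1 - w * m.+1%:R) * (k.+1%:R - w) = (1 - w * k.+1%:R) *
  (m.+1%:R - w).
  apply: (@mulIf _ ((1 - w)^-1 * (1 - w)^-1));
    first by rewrite mulf_neq0 ?invr_eq0.
  by rewrite mulrACA [RHS]mulrACA.
have : (1 - w) * (1 + w) * (k.+1%:R - m.+1%:R) = 0.
  transitivity ((1 - w * m.+1%:R) * (k.+1%:R - w) - (1 - w * k.+1%:R) *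
    (m.+1%:R - w)).
    by ring.
  by rewrite E subrr.
move/eqP; rewrite !mulf_eq0 (negbTE h) /= subr_eq0 eqr_nat eqSS =>
  /orP [/eqP w1|/eqP ->] //.
have : w ^+ 2 = 0 by rewrite w_root -opprD w1 oppr0.
by move/eqP; rewrite expf_eq0 /= (negbTE (w_neq0 w_root)).
Qed.

End Ratio.

Theorem theorem8p1 (n : nat) (n_ge1 : (1 <= n)%N) :
  \sum_(2 <= i < (4 * n)%N) (nb_qtsasm (4 * n) i)%:R *: 'X^(i - 2)
  = (\sum_(1 <= i < n.+1) (nb_asm n i)%:R *: 'X^(i - 1)) ^+ 2
    * (\sum_(1 <= i < (2 * n).+1) (nb_htsasm (2 * n) i)%:R *: 'X^(i - 1))
    :> {poly int}.
Proof.
case: n n_ge1 => // n _.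
have [w w_root] := cube_root_of_unity.
apply: (int_poly_eq (weight_ratio_inj w_root)) => m /=.
set a := weight_a w m.+1%:R 1; set b := weight_b w m.+1%:R 1.
have b0 : b != 0 := weight_b_nat_neq0 w_root m.
have m0 : (m.+1%:R : algC) != 0 by rewrite pnatr_eq0.
have := qt_partition_factorization_top w_root n (ltn0Sn m).
rewrite (qt_partition_refined w_root) (asm_partition_refined w_root)
  (ht_partition_refined w_root) => /(mulfI m0).
rewrite -/a -/b.
rewrite (horner_homogeneous _ 2 (4 * n.+1) a b0).
rewrite (horner_homogeneous _ 1 n.+2 a b0)
  (horner_homogeneous _ 1 (2 * n.+1).+1 a b0).
(* Both sides are homogeneous of degree 4n - 3 in (a, b). *)
move: (a) (b) b0 => {}a {}b b0; rewrite exprMn -exprM mulrACA -exprD.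
have -> : ((n.+2.-1 - 1) * 2 + ((2 * n.+1).+1.-1 - 1) = (4 * n.+1).-1 - 2)%N
  by lia.
by move/(mulfI (expf_neq0 _ b0)) => ->;
  rewrite rmorphM rmorphXn hornerM horner_exp.
Qed.
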